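(* Let $q\ge2$, $c>0$, $f\in L^2(Q_T)$, $u_0\in H_0^1(\Omega)$, $v_0\in L^2(\Omega)$. There exists a constant $C_{\mathrm{CFL}}>0$ depending only on $p$, $q$ (and on the dimension $d$ and the shape-regularity constant of $\mathcal T_h$) such that, if $\tau\le C_{\mathrm{CFL}}h_{\min}/c$, then any $u_{h\tau}\in\mathring{\mathcal V}_{h\tau}^{\mathsf{disc}(q)}$ satisfying $\mathcal B_{h\tau}(u_{h\tau},w_{h\tau})=\ell(w_{h\tau})$ for all $w_{h\tau}\in\mathring{\mathcal V}_{h\tau}^{\mathsf{disc}(q)}$ satisfies $$\|\partial_\tau u_{h\tau}\|_{L^\infty(0,T;L^2(\Omega))}^2+c^2\|\nabla u_{h\tau}\|_{L^\infty(0,T;L^2(\Omega)^d)}^2+|\partial_\tau u_{h\tau}|_{\mathsf J}^2+c^2|\nabla u_{h\tau}|_{\mathsf J}^2\le C\Big(\|f\|_{L^1(0,T;L^2(\Omega))}^2+\|v_0\|_{L^2(\Omega)}^2+c^2\|\nabla u_0\|_{L^2(\Omega)^d}^2\Big),$$ where $C>0$ depends only on $q$.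
   Context: Setting: $\Omega\subset\mathbb R^d$ ($d\in\{1,2,3\}$) is a polytopic domain, $T>0$, $Q_T=\Omega\times(0,T)$. $\mathcal T_h$ is a shape-regular conforming simplicial mesh of $\Omega$ with meshsize $h$ and minimum element diameter $h_{\min}$. $0=t_0<t_1<\dots<t_N=T$ is an arbitrary partition, $I_n=(t_{n-1},t_n)$, $\tau_n=t_n-t_{n-1}$, $\tau=\max_n\tau_n$, $Q_n=\Omega\times I_n$. $(\cdot,\cdot)_D$ is the $L^2(D)$ inner product. $p\ge1$ is an integer. Spaces: $\mathring{\mathcal V}_h^p=\{v_h\in H_0^1(\Omega): v_h|_K\in\mathbb P^p(K)\ \forall K\in\mathcal T_h\}$; $\mathring{\mathcal V}_{h\tau}^{\mathsf{disc}(q)}$ is the space of functions whose restriction to each $Q_n$ lies in $\mathbb P^q(I_n)\otimes\mathring{\mathcal V}_h^p$ (no continuity in time across the $t_n$). $\partial_\tau$ is the broken (interval-by-interval) first time derivative. Jumps: $[\![v]\!]_n=v(t_n^+)-v(t_n^-)$ for $n=1,\dots,N-1$; values at $t=0,T$ are one-sided traces from inside $(0,T)$. $|v|_{\mathsf J}^2=\|v(\cdot,T)\|_{L^2(\Omega)}^2+\sum_{n=1}^{N-1}\|[\![v]\!]_n\|_{L^2(\Omega)}^2+\|v(\cdot,0)\|_{L^2(\Omega)}^2$ (with $L^2(\Omega)^d$ norms for vector-valued $v$). Forms (DG time discretization of $\partial_{tt}u-c^2\Delta u=f$ with $u(0)=u_0$, $\partial_tu(0)=v_0$): $$\mathcal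 B_{h\tau}(u,w)=\sum_{n=1}^N(\partial_{tt}u,\partial_tw)_{Q_n}+\sum_{n=1}^{N-1}([\![\partial_tu]\!]_n,\partial_tw(\cdot,t_n^+))_\Omega+(\partial_tu(\cdot,0),\partial_tw(\cdot,0))_\Omega$$ $$\qquad+c^2\sum_{n=1}^N(\nabla u,\nabla\partial_tw)_{Q_n}+c^2\sum_{n=1}^{N-1}([\![\nabla u]\!]_n,\nabla w(\cdot,t_n^+))_\Omega+c^2(\nabla u(\cdot,0),\nabla w(\cdot,0))_\Omega,$$ $$\ell(w)=\sum_{n=1}^N(f,\partial_tw)_{Q_n}+(v_0,\partial_tw(\cdot,0))_\Omega+c^2(\nabla u_0,\nabla w(\cdot,0))_\Omega.$$ *)

(* Defs.v *)
From HB Require Import structures.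
From mathcomp Require Import all_boot all_order all_algebra.
From mathcomp Require Import all_classical all_reals all_analysis.

Set Implicit Arguments.
Unset Strict Implicit.
Unset Printing Implicit Defensive.

Import Order.TTheory GRing.Theory Num.Theory.
Import numFieldNormedType.Exports.

Local Open Scope classical_set_scope.
Local Open Scope ring_scope.

(** * Lebesgue measure on R^d *)

(* The sigma-algebra on R^d is the product (Borel) one, generated by the
   coordinate maps. *)
Section measurable_rV.
Variables (R : realType) (d : nat).

Let coord : 'I_d -> 'rV[R]_d -> R := fun i x => x ord0 i.

Let rV_set0 : g_sigma_preimage coord set0.
Proof. exact: sigma_algebra0. Qed.

Let rV_setC A : g_sigma_preimage coord A -> g_sigma_preimage coord (~` A).
Proof. exact: sigma_algebraC. Qed.

Let rV_bigcup (F : (set 'rV[R]_d)^nat) :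
  (forall i, g_sigma_preimage coord (F i)) ->
  g_sigma_preimage coord (\bigcup_i F i).
Proof. exact: sigma_algebra_bigcup. Qed.

HB.instance Definition _ :=
  @isMeasurable.Build (measure_tuple_display default_measure_display)
    'rV[R]_d (g_sigma_preimage coord) rV_set0 rV_setC rV_bigcup.

End measurable_rV.

Lemma measurable_fun_coord (R : realType) d (i : 'I_d) :
  measurable_fun [set: 'rV[R]_d] (fun x : 'rV[R]_d => x ord0 i).
Proof.
move=> _ Y mY; rewrite setTI; apply: sub_sigma_algebra => /=.
rewrite -bigcup_seq/=; exists i => /=; first by rewrite mem_index_enum.
by exists Y => //; rewrite setTI.
Qed.

Lemma measurable_fun_rVP (R : realType) d (dT : measure_display)
    (T : measurableType dT) (f : T -> 'rV[R]_d) :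
  (forall i, measurable_fun [set: T] (fun z => f z ord0 i)) ->
  measurable_fun [set: T] f.
Proof.
move=> mf _ A mA; rewrite setTI.
pose F := image_set_system [set: T] f measurable.
have : F A.
  apply: (mA F); split; first exact/sigma_algebra_image/sigma_algebra_measurable.
  move=> B; rewrite -bigcup_seq => -[i _ [C mC <-]].
  rewrite /F /image_set_system /= setTI setTI -[X in measurable X]setTI.
  exact: (mf i measurableT C mC).
by rewrite /F /image_set_system /= setTI.
Qed.

Section lebesgue_rV.
Variable R : realType.

Definition cons_rV d (z : R * 'rV[R]_d) : 'rV[R]_d.+1 :=
  \row_i (if unlift ord0 i is Some j then z.2 ord0 j else z.1).

Definition uncons_rV d (x : 'rV[R]_d.+1) : R * 'rV[R]_d :=
  (x ord0 ord0, \row_j x ord0 (lift ord0 j)).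

Lemma cons_rVK d : cancel (@cons_rV d) (@uncons_rV d).
Proof.
move=> [a x]; rewrite /uncons_rV /cons_rV; congr (_, _).
  by rewrite mxE unlift_none.
by apply/rowP => j; rewrite !mxE liftK.
Qed.

Lemma measurable_cons_rV d :
  measurable_fun [set: (measurableTypeR R * 'rV[R]_d)%type] (@cons_rV d).
Proof.
apply: measurable_fun_rVP => i; rewrite /cons_rV.
under eq_fun do rewrite mxE.
case: unliftP => [j _|_]; last exact: measurable_fst.
apply: (@measurableT_comp _ _ _ _ _ _ (fun x : 'rV[R]_d => x ord0 j)) => //.
exact: measurable_fun_coord.
Qed.

Lemma measurable_uncons_rV d :
  measurable_fun [set: 'rV[R]_d.+1]
    (@uncons_rV d : _ -> (measurableTypeR R * 'rV[R]_d)%type).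
Proof.
apply/measurable_fun_pairP; split; first exact: measurable_fun_coord.
apply: measurable_fun_rVP => i /=.
under eq_fun do rewrite mxE.
exact: measurable_fun_coord.
Qed.

Section lebesgue_rVS.
Variables (d : nat) (mu : {sigma_finite_measure set 'rV[R]_d -> \bar R}).

Definition lebesgue_rVS : set 'rV[R]_d.+1 -> \bar R :=
  pushforward (@lebesgue_measure R \x mu)%E (@cons_rV d).

Let lebesgue_rVS0 : lebesgue_rVS set0 = 0%E.
Proof. by rewrite /lebesgue_rVS /pushforward preimage_set0 measure0. Qed.

Let lebesgue_rVS_ge0 A : (0 <= lebesgue_rVS A)%E.
Proof. by rewrite /lebesgue_rVS /pushforward measure_ge0. Qed.

Let lebesgue_rVS_additive : semi_sigma_additive lebesgue_rVS.
Proof.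
move=> F mF tF mUF; rewrite /lebesgue_rVS /pushforward preimage_bigcup.
apply: measure_semi_sigma_additive.
- by move=> n; rewrite -[X in measurable X]setTI; exact: measurable_cons_rV.
- apply/trivIsetP => /= i j _ _ ij; rewrite -preimage_setI.
  by move/trivIsetP : tF => /(_ _ _ _ _ ij) ->//; rewrite preimage_set0.
- rewrite -preimage_bigcup -[X in measurable X]setTI.
  exact: measurable_cons_rV.
Qed.

HB.instance Definition _ := isMeasure.Build _ _ _
  lebesgue_rVS lebesgue_rVS0 lebesgue_rVS_ge0 lebesgue_rVS_additive.

Let lebesgue_rVS_sigma_finite : sigma_finite setT lebesgue_rVS.
Proof.
have /sigma_finiteP[A [TA ndA Aoo]] := sigma_finiteT (@lebesgue_measure R).
have /sigma_finiteP[B [TB ndB Boo]] := sigma_finiteT mu.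
pose F n : set (measurableTypeR R * 'rV[R]_d) := A n `*` B n.
have TF : [set: _] = \bigcup_n F n.
  apply/seteqP; split => // -[a x] _.
  have [n _ An] : (\bigcup_k A k) a by rewrite -TA.
  have [k _ Bk] : (\bigcup_k B k) x by rewrite -TB.
  exists (maxn n k) => //; split => /=.
  - by move: a An; exact/subsetPset/ndA/leq_maxl.
  - by move: x Bk; exact/subsetPset/ndB/leq_maxr.
have Foo n : measurable (F n) /\ ((@lebesgue_measure R \x mu) (F n) < +oo)%E.
  have [mA Ay] := Aoo n; have [mB By] := Boo n.
  split; first exact: measurableX.
  by rewrite product_measure1E// lte_mul_pinfty// ge0_fin_numE.
exists (fun n => @uncons_rV d @^-1` F n).
  by rewrite -preimage_bigcup -TF preimage_setT.
move=> n; have [mF muF] := Foo n; split.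
  by rewrite -[X in measurable X]setTI; exact: measurable_uncons_rV.
rewrite /lebesgue_rVS /pushforward -comp_preimage.
rewrite (_ : _ \o _ = idfun) ?preimage_id//.
by apply/funext => z; exact: cons_rVK.
Qed.

HB.instance Definition _ := Measure_isSigmaFinite.Build _ _ _
  lebesgue_rVS lebesgue_rVS_sigma_finite.

End lebesgue_rVS.

(* d-dimensional Lebesgue measure, as an iterated product of one-dimensional
   Lebesgue measures; R^0 is a point of mass 1. *)
Fixpoint lebesgue_rV (d : nat) : {sigma_finite_measure set 'rV[R]_d -> \bar R} :=
  match d return {sigma_finite_measure set 'rV[R]_d -> \bar R} with
  | 0%N => \d_(0 : 'rV[R]_0)
  | d'.+1 => lebesgue_rVS (lebesgue_rV d')
  end.

End lebesgue_rV.

Lemma lebesgue_rV_box (R : realType) d (A : 'I_d -> set R) :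
  (forall i, measurable (A i)) ->
  lebesgue_rV R d [set x | forall i, A i (x ord0 i)] =
  (\prod_(i < d) lebesgue_measure (A i))%E.
Proof.
elim: d A => [|d IH] A mA.
  by rewrite big_ord0 /= diracE mem_set//=; case.
rewrite big_ord_recl /= -IH// /lebesgue_rVS /pushforward.
rewrite -product_measure1E; [|exact: mA|].
  congr (_ _); apply/seteqP; split => -[a x] /=.
    move=> h; split=> /=; first by have := h ord0; rewrite /cons_rV mxE unlift_none.
    by move=> i; have := h (lift ord0 i); rewrite /cons_rV mxE liftK.
  move=> [ha hx] i; rewrite /cons_rV mxE; case: unliftP => [j ->|->]; [exact: hx|exact: ha].
rewrite [X in measurable X](_ : _ = \bigcap_i
    ((fun x : 'rV[R]_d => x ord0 i) @^-1` A (lift ord0 i))).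
  apply: fin_bigcap_measurable => // i _.
  by rewrite -[X in measurable X]setTI; exact: measurable_fun_coord.
by apply/seteqP; split=> x /= h i; [move=> _; exact: h|exact: (h i I)].
Qed.

(** * Euclidean structure, L^2 spaces and norms *)

Section lebesgue_spaces.
Variables (R : realType) (d : nat).
Implicit Types (Om : set 'rV[R]_d) (v w : 'rV[R]_d -> R)
  (G H : 'rV[R]_d -> 'rV[R]_d).

Definition dotv (x y : 'rV[R]_d) : R := \sum_i x ord0 i * y ord0 i.

(* The canonical norm on 'rV is the sup norm, hence the Euclidean norm is
   introduced separately. *)
Definition enorm (x : 'rV[R]_d) : R := Num.sqrt (dotv x x).

Definition L2norm Om v : \bar R :=
  Lnorm (lebesgue_rV R d) 2%:E (EFin \o (v \_ Om)).

Definition L2normv Om G : \bar R := L2norm Om (enorm \o G).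

Definition L2fun Om v : Prop := measurable_fun Om v /\ (L2norm Om v < +oo)%E.

Definition L2funv Om G : Prop :=
  forall i, L2fun Om (fun x => G x ord0 i).

Definition ip Om v w : R := \int[lebesgue_rV R d]_(x in Om) (v x * w x).

Definition ipv Om G H : R := \int[lebesgue_rV R d]_(x in Om) dotv (G x) (H x).

(* f t x, with time first, belongs to L^2(Om x (0,T)). *)
Definition L2funQ Om (T : R) (f : R -> 'rV[R]_d -> R) : Prop :=
  let QT : set (measurableTypeR R * 'rV[R]_d) := `]0, T[ `*` Om in
  let g := fun z : measurableTypeR R * 'rV[R]_d => f z.1 z.2 in
  measurable_fun QT g /\
  (Lnorm (@lebesgue_measure R \x lebesgue_rV R d)%E 2%:E
     (EFin \o (g \_ QT)) < +oo)%E.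

(* Norm of L^r(0,T; X), where g t is the X-norm of the value at time t. *)
Definition bochner_norm (r : \bar R) (T : R) (g : R -> \bar R) : \bar R :=
  Lnorm (@lebesgue_measure R) r (g \_ `]0, T[).

End lebesgue_spaces.

(** * H^1 and H^1_0 *)

Section sobolev.
Variables (R : realType) (d : nat).
Implicit Types (Om : set 'rV[R]_d) (v phi : 'rV[R]_d -> R)
  (G : 'rV[R]_d -> 'rV[R]_d).

Definition partial (i : 'I_d) v : 'rV[R]_d -> R :=
  fun x => 'D_(delta_mx ord0 i) v x.

Fixpoint Ck (k : nat) v : Prop :=
  continuous v /\
  if k is k'.+1 then
    forall i, (forall x, derivable v x (delta_mx ord0 i)) /\ Ck k' (partial i v)
  else True.

Definition test_function Om phi : Prop :=
  [/\ forall k, Ck k phi,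
      compact (closure [set x | phi x != 0]) &
      closure [set x | phi x != 0] `<=` Om].

Definition weak_gradient Om v G : Prop :=
  forall phi, test_function Om phi -> forall i,
    \int[lebesgue_rV R d]_(x in Om) (v x * partial i phi x) =
    - \int[lebesgue_rV R d]_(x in Om) (G x ord0 i * phi x).

Definition H1 Om v : Prop :=
  L2fun Om v /\ exists G, L2funv Om G /\ weak_gradient Om v G.

(* A representative of the weak gradient, which is unique up to null sets. *)
Definition grad Om v : 'rV[R]_d -> 'rV[R]_d :=
  xget (fun=> 0) [set G | L2funv Om G /\ weak_gradient Om v G].

Definition H1norm Om v : \bar R :=
  ((L2norm Om v ^+ 2 + L2normv Om (grad Om v) ^+ 2) `^ 2^-1)%E.

Definition H10 Om v : Prop :=
  H1 Om v /\
  forall e : R, 0 < e -> exists phi, test_function Om phi /\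
    (H1norm Om (fun x => v x - phi x)%R < e%:E)%E.

End sobolev.

(** * Simplicial meshes *)

Section meshes.
Variables (R : realType) (d : nat).
Implicit Types (V : 'M[R]_(d.+1, d)) (Om : set 'rV[R]_d).

(* The convex hull of the vertices indexed by I of the d-simplex whose vertices
   are the rows of V. *)
Definition face V (I : {set 'I_d.+1}) : set 'rV[R]_d :=
  [set x | exists l : 'I_d.+1 -> R,
     [/\ forall i, 0 <= l i, forall i, i \notin I -> l i = 0,
         \sum_i l i = 1 & x = \sum_i l i *: row i V]].

Definition simplex V : set 'rV[R]_d := face V [set: 'I_d.+1]%SET.

(* Affine independence of the rows of V. *)
Definition nondegenerate V : Prop :=
  row_free (row_mx (const_mx 1 : 'cV[R]_d.+1) V).

Definition diam V : R :=
  sup [set enorm (z.1 - z.2) | z in simplex V `*` simplex V].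

(* Diameter of the largest ball contained in the simplex. *)
Definition inball_diam V : R :=
  sup [set r : R | exists x : 'rV[R]_d,
         0 <= r /\ [set y | enorm (y - x) <= r / 2] `<=` simplex V].

Definition polytopic_domain Om : Prop :=
  [/\ Om !=set0, connected Om &
      exists s : seq 'M[R]_(d.+1, d), (forall V, V \in s -> nondegenerate V) /\
        Om = interior (\bigcup_(V in [set` s]) simplex V)].

Definition conforming_mesh Om (m : nat) (K : 'I_m -> 'M[R]_(d.+1, d)) : Prop :=
  [/\ forall i, nondegenerate (K i),
      closure Om = \bigcup_i simplex (K i),
      forall i j, i != j ->
        interior (simplex (K i)) `&` interior (simplex (K j)) = set0 &
      forall i j, exists I J : {set 'I_d.+1},
        simplex (K i) `&` simplex (K j) = face (K i) I /\
        simplex (K i) `&` simplex (K j) = face (K j) J].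

Definition shape_regular (sigma : R) (m : nat) (K : 'I_m -> 'M[R]_(d.+1, d)) :
    Prop :=
  forall i, diam (K i) <= sigma * inball_diam (K i).

Definition hmin (m : nat) (K : 'I_m -> 'M[R]_(d.+1, d)) : R :=
  inf [set diam (K i) | i in [set: 'I_m]].

End meshes.

(** * Discrete spaces *)

Section discrete_spaces.
Variables (R : realType) (d : nat).

(* Polynomials of total degree at most p in d variables; alpha ranges over the
   multi-indices with entries at most p. *)
Definition polyP (p : nat) (P : 'rV[R]_d -> R) : Prop :=
  exists a : {ffun 'I_d -> 'I_p.+1} -> R, forall x,
    P x = \sum_(alpha : {ffun 'I_d -> 'I_p.+1} | (\sum_i alpha i <= p)%N)
            a alpha * \prod_i x ord0 i ^+ alpha i.

(* Elements of the finite element space are identified with their continuous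
   representatives: they are polynomials on closed simplices. *)
Definition Vh (Om : set 'rV[R]_d) (m : nat) (K : 'I_m -> 'M[R]_(d.+1, d))
    (p : nat) (v : 'rV[R]_d -> R) : Prop :=
  H10 Om v /\
  forall i, exists P, polyP p P /\ forall x, simplex (K i) x -> v x = P x.

Definition time_partition (T : R) (N : nat) (t : nat -> R) : Prop :=
  [/\ (0 < N)%N, t 0%N = 0, t N = T &
      forall n, (n < N)%N -> t n < t n.+1].

Definition max_step (N : nat) (t : nat -> R) : R :=
  \big[Num.max/0]_(n < N) (t n.+1 - t n).

(* I_(n+1) is the open interval ]t n, t n.+1[, and u s x has time first. *)
Definition Vdisc (Om : set 'rV[R]_d) (m : nat) (K : 'I_m -> 'M[R]_(d.+1, d))
    (N : nat) (t : nat -> R) (p q : nat) (u : R -> 'rV[R]_d -> R) : Prop :=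
  forall n, (n < N)%N -> exists v : 'I_q.+1 -> 'rV[R]_d -> R,
    (forall j, Vh Om K p (v j)) /\
    forall s x, t n < s < t n.+1 -> Om x -> u s x = \sum_(j < q.+1) s ^+ j * v j x.

End discrete_spaces.

(** * The DG-in-time scheme *)

Section scheme.
Variables (R : realType) (d : nat) (Om : set 'rV[R]_d).
Variables (N : nat) (t : nat -> R) (c : R).
Implicit Types (u w f : R -> 'rV[R]_d -> R).

(* Only meaningful inside the intervals of the partition, where it is the broken
   time derivative; at the nodes one-sided traces are used. *)
Definition dt u : R -> 'rV[R]_d -> R := fun s x => derive1 (fun r => u r x) s.

Definition rtrace u (s : R) : 'rV[R]_d -> R := fun x => lim (u r x @[r --> s^'+]).

Definition ltrace u (s : R) : 'rV[R]_d -> R := fun x => lim (u r x @[r --> s^'-]).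

Definition jump u (s : R) : 'rV[R]_d -> R := fun x => rtrace u s x - ltrace u s x.

Definition gjump u (s : R) : 'rV[R]_d -> 'rV[R]_d :=
  fun x => grad Om (rtrace u s) x - grad Om (ltrace u s) x.

(* Inner products of L^2(Om x ]a, b[), integrating first in space. *)
Definition ipQ (a b : R) u w : R :=
  \int[@lebesgue_measure R]_(s in `]a, b[) ip Om (u s) (w s).

Definition gipQ (a b : R) u w : R :=
  \int[@lebesgue_measure R]_(s in `]a, b[)
     ipv Om (grad Om (u s)) (grad Om (w s)).

Definition Bform u w : R :=
  \sum_(0 <= n < N) ipQ (t n) (t n.+1) (dt (dt u)) (dt w)
  + \sum_(1 <= n < N) ip Om (jump (dt u) (t n)) (rtrace (dt w) (t n))
  + ip Om (rtrace (dt u) 0) (rtrace (dt w) 0)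
  + c ^+ 2 * (\sum_(0 <= n < N) gipQ (t n) (t n.+1) u (dt w))
  + c ^+ 2 * (\sum_(1 <= n < N) ipv Om (gjump u (t n)) (grad Om (rtrace w (t n))))
  + c ^+ 2 * ipv Om (grad Om (rtrace u 0)) (grad Om (rtrace w 0)).

Definition lform f (u0 v0 : 'rV[R]_d -> R) w : R :=
  \sum_(0 <= n < N) ipQ (t n) (t n.+1) f (dt w)
  + ip Om v0 (rtrace (dt w) 0)
  + c ^+ 2 * ipv Om (grad Om u0) (grad Om (rtrace w 0)).

(* Squared jump seminorms |u|_J^2 and |grad u|_J^2; t N is the final time. *)
Definition Jsq u : \bar R :=
  (L2norm Om (ltrace u (t N)) ^+ 2
   + \sum_(1 <= n < N) L2norm Om (jump u (t n)) ^+ 2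
   + L2norm Om (rtrace u 0) ^+ 2)%E.

Definition gJsq u : \bar R :=
  (L2normv Om (grad Om (ltrace u (t N))) ^+ 2
   + \sum_(1 <= n < N) L2normv Om (gjump u (t n)) ^+ 2
   + L2normv Om (grad Om (rtrace u 0)) ^+ 2)%E.

End scheme.

(* Main.v *)
Require Import Defs.
From mathcomp Require Import all_boot all_order all_algebra.
From mathcomp Require Import polyrcf ring lra.
From mathcomp Require Import all_classical all_reals all_analysis.
From mathcomp Require Import measurable_realfun ess_sup_inf.

(** Testing with [w = u] up to the n-th slab bounds the nodal energies and all
    the jumps by [F sup |u_t| + data], where [F] is the L^1(L^2) norm of [f]. To
    control the supremum inside a slab, rescaled to theta in [0, 1], one tests
    with the [w] such that [w(0) = 0] and [w'] is the L^2(0,1) projection of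
    [(1 - theta) u'] onto polynomials of degree less than q. The projection is
    invisible to [u''], and in the stiffness term it costs a multiple of minus
    the squared leading coefficient of [u], which has the good sign. Hence the
    slab integrals of [|u_t|^2] and [c^2 |grad u|^2] are bounded by the energy at
    the left node, the jump there and the data, with constants depending only on
    q; on polynomials of degree q in time these integrals control the suprema,
    and Young's inequality absorbs [F sup |u_t|].

    The weak gradient in the definitions is an arbitrary representative, so its
    linearity rests on uniqueness almost everywhere (du Bois-Reymond), and that
    of H^1_0 also needs integration by parts between test functions. *)

Set Implicit Arguments.
Unset Strict Implicit.
Unset Printing Implicit Defensive.

Import Order.TTheory GRing.Theory Num.Theory.
Import numFieldNormedType.Exports.

Local Open Scope classical_set_scope.
Local Open Scope ring_scope.

(** * Measurability and boxes in R^d *)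

(** The estimates are made on coefficients. On each slab [u] is a polynomial in time with values in
    the span of finitely many finite element functions, and every test function used lies in the
    same span. The mass and stiffness inner products become Gram matrices, known only to be
    symmetric and positive semidefinite. The constants therefore cannot see the mesh, [p] or [d]:
    they come from polynomials on [0, 1], through the Riesz representatives of the coefficient
    functionals.

    The obstacle is that the weight 1 - theta raises the degree of u' to q, so that the primitive of
    (1 - theta) u' has degree q + 1 and is not admissible. The correction goes along the
    representative d of the coefficient of theta^q, which is orthogonal to all lower degrees. As (1
    - theta) u' has leading coefficient -q u_q, the multiple to add is q u_q / |d|^2, and pairing it
    with u gives q |u_q|^2 / |d|^2: this is where the good sign comes from. The condition w(0) = 0
    removes the jump of the displacement, which is paired with w(0); the jump of the velocity stays
    and is handled by Young's inequality. *)

Section boxes.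
Variables (R : realType) (d : nat).
Implicit Types (a b x : 'rV[R]_d).

Definition obox a b : set 'rV[R]_d :=
  [set x | forall i, a ord0 i < x ord0 i < b ord0 i].

Definition cbox a b : set 'rV[R]_d :=
  [set x | forall i, a ord0 i <= x ord0 i <= b ord0 i].

Lemma measurable_coords (A : 'I_d -> set R) : (forall i, measurable (A i)) ->
  measurable [set x : 'rV[R]_d | forall i, A i (x ord0 i)].
Proof.
move=> mA; rewrite [X in measurable X](_ : _ = \bigcap_i
    ((fun x : 'rV[R]_d => x ord0 i) @^-1` A i)).
  apply: fin_bigcap_measurable => // i _.
  by rewrite -[X in measurable X]setTI; exact: measurable_fun_coord.
by apply/seteqP; split=> x /= h i; [move=> _; exact: h|exact: (h i I)].
Qed.

Lemma measurable_obox a b : measurable (obox a b).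
Proof.
have := @measurable_coords (fun i => `]a ord0 i, b ord0 i[%classic).
by apply=> i; exact: measurable_itv.
Qed.

(** Boxes with rational centre and half-width 1/(k+1) are countably many, so they link the topology
    with the sigma-algebra generated by the coordinates. The closed boxes are kept inside [U] so
    that bumps carried by them are test functions on [U]. *)
Lemma open_bigcup_obox (U : set 'rV[R]_d) : open U ->
  exists (D : set nat) (a b : nat -> 'rV[R]_d),
    U = \bigcup_(n in D) obox (a n) (b n) /\
    forall n, D n -> cbox (a n) (b n) `<=` U.
Proof.
move=> oU; pose T := ('rV[rat]_d * nat)%type.
pose ctr (p : T) : 'rV[R]_d := map_mx ratr p.1.
pose rad (p : T) : R := p.2.+1%:R^-1.
pose a (p : T) : 'rV[R]_d := \row_i (ctr p ord0 i - rad p).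
pose b (p : T) : 'rV[R]_d := \row_i (ctr p ord0 i + rad p).
(* A number that codes no box is read as [p0], which only repeats a box. *)
pose p0 : T := (0, 0%N); pose dec n := odflt p0 (unpickle n).
exists [set n | cbox (a (dec n)) (b (dec n)) `<=` U], (a \o dec), (b \o dec).
split; last by move=> n.
apply/seteqP; split => [x Ux|x [n /= nU] h]; last first.
  by apply: nU => i; have /andP[/ltW -> /ltW ->] := h i.
have /nbhs_ballP[e /= e0 xeU] : nbhs x U by exact: open_nbhs_nbhs.
(* The centre will be within r = 1/(k+1) of [x], so the closed box stays within 2r < e of [x]. *)
have [k k_lt] : exists k : nat, k.+1%:R^-1 < e / 2.
  have [k _ hk] := near_infty_natSinv_lt (PosNum (divr_gt0 e0 (ltr0Sn R 1))).
  by exists k; exact: (hk k (leqnn k)).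
have r0 : 0 < k.+1%:R^-1 :> R by rewrite invr_gt0.
have /choice[c cP] : forall i : 'I_d, exists c : rat,
    x ord0 i - k.+1%:R^-1 < ratr c < x ord0 i + k.+1%:R^-1.
  move=> i; have /rat_in_itvoo[c] : x ord0 i - k.+1%:R^-1 < x ord0 i + k.+1%:R^-1.
    by move: (k.+1%:R^-1) r0 => r r0; lra.
  by rewrite in_itv/= => ?; exists c.
pose p : T := (\row_i c i, k).
have decp : dec (pickle p) = p by rewrite /dec pickleK.
have cE i : ctr p ord0 i = ratr (c i) by rewrite !mxE.
exists (pickle p) => /=; rewrite decp.
  move=> y hy; apply: xeU; split => // i j; rewrite (ord1 i).
  have /andP[] := hy j; rewrite !mxE /rad /= => h1 h2.
  have /andP[h3 h4] := cP j.
  move: (_^-1) k_lt r0 h1 h2 h3 h4 => r k_lt r0 h1 h2 h3 h4.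
  by rewrite /ball/= ltr_norml; apply/andP; split; lra.
move=> i; rewrite !mxE /rad/=; have /andP[] := cP i.
by move: (k.+1%:R^-1) r0 => r r0 h3 h4; apply/andP; split; lra.
Qed.

Lemma open_measurable_rV (U : set 'rV[R]_d) : open U -> measurable U.
Proof.
move=> /open_bigcup_obox[D [a [b [-> _]]]].
by apply: bigcup_measurable => n _; exact: measurable_obox.
Qed.

Lemma continuous_measurable_rV (f : 'rV[R]_d -> R) :
  continuous f -> measurable_fun [set: 'rV[R]_d] f.
Proof.
move=> /continuousP cf; apply: (measurability _ (RGenOpens.measurableE R)).
move=> _ [_ [x [y ->]] <-]; rewrite setTI.
by apply: open_measurable_rV; apply: cf; exact: interval_open.
Qed.

Lemma lebesgue_rV_bounded (U : set 'rV[R]_d) (m : R) : measurable U ->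
  (forall x, U x -> forall i, `|x ord0 i| <= m) ->
  (lebesgue_rV R d U < +oo)%E.
Proof.
move=> mU Um; pose B := [set x : 'rV[R]_d | forall i, `[- m, m]%classic (x ord0 i)].
have mB : measurable B by exact: (measurable_coords (fun i => measurable_itv _)).
apply: (@le_lt_trans _ _ (lebesgue_rV R d B)).
  apply: le_measure; rewrite ?inE// => x Ux i.
  by rewrite /= in_itv/= -ler_norml Um.
rewrite (@lebesgue_rV_box R d (fun=> `[- m, m]%classic)); last first.
  by move=> i; exact: measurable_itv.
set L := lebesgue_measure _.
suff: ((0 <= \prod_(i < d) L) && (\prod_(i < d) L < +oo))%E by case/andP.
apply: (big_ind (fun x : \bar R => (0 <= x) && (x < +oo))%E) => [|x y /andP[x0 xy] /andP[y0 yy]|i _].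
- by rewrite ltry lee01.
- by rewrite mule_ge0// lte_mul_pinfty// ge0_fin_numE.
- rewrite /L measure_ge0/= lebesgue_measure_itv/=; case: ifP => // _.
  by rewrite -EFinB ltry.
Qed.

End boxes.

(** * Smooth bump functions *)

Section bump.
Variables (R : realType) (a b e : R).
Hypothesis e_gt0 : 0 < e.

Let Y : {poly R} := ('X - a%:P) * (b%:P - 'X).

Let YE t : Y.[t] = (t - a) * (b - t).
Proof. by rewrite hornerM !hornerD !hornerN !hornerX !hornerC. Qed.

(* The family is closed under differentiation. *)
Definition bump (Q : {poly R}) n (t : R) : R :=
  if a < t < b then Q.[t] * Y.[t]^-1 ^+ n * expR (- e * Y.[t]^-1) else 0.

Let Y_gt0 t : a < t < b -> 0 < Y.[t].
Proof. by move=> /andP[h1 h2]; rewrite YE mulr_gt0// subr_gt0. Qed.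

(** Quadratic decay towards any point outside the interval, which forces the derivative there to be
    0. The exponential beats every power of 1/Y, and Y(s) is at most (b - a)|s - t| because an
    endpoint lies between [s] and [t]. *)
Lemma bump_bound Q n : exists C, forall t s, ~~ (a < t < b) ->
  `|bump Q n s| <= C * `|s - t| ^+ 2.
Proof.
pose m := `|a| + `|b|; pose q := \sum_(i < size Q) `|Q`_i| * m ^+ i.
pose k := n.+2`!%:R / e ^+ n.+2.
have q0 : 0 <= q by apply: sumr_ge0 => i _; rewrite mulr_ge0// exprn_ge0// addr_ge0.
have k0 : 0 <= k by rewrite divr_ge0 ?ler0n// exprn_ge0// ltW.
exists (q * k * (b - a) ^+ 2) => t s tab; rewrite /bump.
case: ifPn => sab; last first.
  rewrite normr0.
  exact: mulr_ge0 (mulr_ge0 (mulr_ge0 q0 k0) (sqr_ge0 _)) (sqr_ge0 _).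
have Ys := Y_gt0 sab; have [a_s s_b] := andP sab.
have Qs : `|Q.[s]| <= q.
  rewrite horner_coef (le_trans (ler_norm_sum _ _ _))//; apply: ler_sum => i _.
  rewrite normrM ler_wpM2l// normrX lerXn2r ?nnegrE ?addr_ge0// /m.
  have := ler_norm b; have := lerNnormlW (lexx `|a|).
  have := normr_ge0 a; have := normr_ge0 b => ? ? ? ?.
  by rewrite ler_norml; apply/andP; split; lra.
have ek : Y.[s]^-1 ^+ n * expR (- e * Y.[s]^-1) <= k * Y.[s] ^+ 2.
  rewrite mulNr expRN.
  have eY0 : 0 < e * Y.[s]^-1 by rewrite mulr_gt0// invr_gt0.
  (* The term of order n + 2 of the exponential series absorbs Y^-n and leaves Y^2. *)
  have := expR_ge1Dxn n.+1 (ltW eY0).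
  set z := (e * _) ^+ n.+2 / _ => hz.
  have z0 : 0 < z by rewrite divr_gt0 ?exprn_gt0// ltr0n fact_gt0.
  have : (expR (e / Y.[s]))^-1 <= z^-1.
    by rewrite lef_pV2 ?posrE ?expR_gt0//; lra.
  move=> /(ler_wpM2l (exprn_ge0 n (ltW _ : 0 <= Y.[s]^-1))); rewrite invr_gt0 => /(_ Ys).
  move=> /le_trans; apply; rewrite /z /k exprMn !exprVn (exprS Y.[s] n.+1) (exprS Y.[s] n).
  have u0 : Y.[s] ^+ n != 0 by rewrite expf_neq0// gt_eqF.
  have w0 : e ^+ n.+2 != 0 by rewrite expf_neq0// gt_eqF.
  have f0 : n.+2`!%:R != 0 :> R by rewrite pnatr_eq0 -lt0n fact_gt0.
  rewrite le_eqVlt; apply/orP; left; apply/eqP.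
  move: (Y.[s] ^+ n) (e ^+ n.+2) (n.+2`!%:R) u0 w0 f0 => u w f u0 w0 f0.
  by field; rewrite u0 w0 f0 !gt_eqF.
have Yst : Y.[s] <= (b - a) * `|s - t|.
  rewrite YE; move: tab; rewrite negb_and -!leNgt => /orP[ta|bt].
    rewrite ger0_norm; last by lra.
    by nra.
  rewrite ler0_norm; last by lra.
  by nra.
rewrite -mulrA normrM -[leRHS]mulrA -[leRHS]mulrA ler_pM// ger0_norm; last first.
  by rewrite mulr_ge0 ?expR_ge0// exprn_ge0// invr_ge0 ltW.
rewrite (le_trans ek)// ler_wpM2l// -exprMn lerXn2r ?nnegrE ?(ltW Ys)//.
by rewrite mulr_ge0//; lra.
Qed.

(** Inside the interval this is the product rule with Y^-(n+2) factored out. Outside it the slope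
    function is continuous with value 0 by [bump_bound], which is Caratheodory's criterion. *)
Lemma is_derive_bump Q n t : is_derive t (1 : R) (bump Q n)
  (bump (Q^`() * Y ^+ 2 - n%:R *: (Q * Y^`() * Y) + e *: (Q * Y^`())) n.+2 t).
Proof.
have [tab|tab] := boolP (a < t < b); last first.
  rewrite {2}/bump (negbTE tab); apply/is_derive1_caratheodory.
  have [C hC] := bump_bound Q n.
  have Ft : bump Q n t = 0 by rewrite /bump (negbTE tab).
  exists (fun z => bump Q n z / (z - t)); split.
  - move=> z; rewrite Ft subr0; have [->|zt] := eqVneq z t.
      by rewrite Ft !mul0r.
    by rewrite /= mulfVK// subr_eq0.
  - rewrite /prop_for /continuous_at /= Ft mul0r; apply/cvgr0Pnorm_lt => r r0.
    have C1 : 0 < `|C| + 1 by rewrite ltr_wpDl.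
    near=> z; have := hC t z tab.
    have [->|zt] := eqVneq z t; first by rewrite Ft mul0r normr0.
    have zt0 : 0 < `|z - t| by rewrite normr_gt0 subr_eq0.
    rewrite normrM normfV ltr_pdivrMr// => /le_lt_trans; apply.
    rewrite expr2 mulrA ltr_pM2r//.
    have : `|z - t| < r / (`|C| + 1).
      rewrite distrC; near: z; apply: cvgr_dist_lt; first exact: cvg_id.
      by rewrite divr_gt0.
    rewrite ltr_pdivlMr// => h; have := ler_norm C; nra.
  - by rewrite /= Ft mul0r.
have Yt := Y_gt0 tab.
apply: (@near_eq_is_derive _ _ _ (fun s => Q.[s] * Y.[s]^-1 ^+ n * expR (- e * Y.[s]^-1))).
- near=> s; rewrite /bump ifT//; apply/andP; split; near: s.
    by apply: lt_nbhsr; case/andP: tab.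
  by apply: lt_nbhsl; case/andP: tab.
have Y0 : Y.[t] != 0 by rewrite gt_eqF.
have dV : is_derive t (1 : R) (fun s => Y.[s]^-1) (- Y.[t] ^- 2 *: Y^`().[t]).
  exact: is_deriveV.
have dQ := is_derive_poly Q t.
have dE : is_derive t (1 : R) (fun s => expR (- e * Y.[s]^-1))
   (expR (- e * Y.[t]^-1) * (- e * (- Y.[t] ^- 2 *: Y^`().[t]))).
  exact: (@is_derive1_comp _ expR (fun s => - e * Y.[s]^-1)).
have h := is_deriveM (is_deriveM dQ (is_deriveX n dV)) dE.
rewrite (_ : (fun s : R => _) =
    horner Q * (fun s => Y.[s]^-1) ^+ n * (fun s => expR (- e * Y.[s]^-1))).
  apply: (is_derive_eq h); rewrite !fctE /bump tab /GRing.scale/=.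
  have hor (Z : {poly R}) : (Q^`() * Z ^+ 2 - n%:R *: (Q * Z^`() * Z) +
      e *: (Q * Z^`())).[t] = Q^`().[t] * Z.[t] ^+ 2 -
      n%:R * (Q.[t] * Z^`().[t] * Z.[t]) + e * (Q.[t] * Z^`().[t]).
    by rewrite !(hornerD, hornerN, hornerZ, hornerM, horner_exp).
  rewrite hor; move: (expR _) => E; move: (Y.[t]) Y0 (Y^`().[t]) => y y0 y'.
  case: n {h hor} => [|k]; first by rewrite expr0 mul0r; field.
  rewrite -[k.+1.-1]/k (exprS _ k.+2) (exprS _ k.+1) (exprS _ k).
  by move: (_ ^+ k) => u; field.
by apply/funext => s; rewrite !fctE.
Unshelve. all: by end_near. Qed.

Lemma continuous_bump Q n : continuous (bump Q n).
Proof.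
move=> t; have [h _] := is_derive_bump Q n t.
exact/differentiable_continuous/derivable1_diffP.
Qed.

Lemma bump_out Q n t : ~~ (a < t < b) -> bump Q n t = 0.
Proof. by rewrite /bump => /negbTE ->. Qed.

Lemma bump1_ge0 t : 0 <= bump 1 0 t.
Proof.
by rewrite /bump; case: ifP => // _; rewrite expr0 hornerC !mul1r expR_ge0.
Qed.

Lemma bump1_le1 t : bump 1 0 t <= 1.
Proof.
rewrite /bump; case: ifP => // tab; rewrite expr0 hornerC !mul1r -expR0.
by rewrite ler_expR mulNr oppr_le0 mulr_ge0 ?ltW// invr_gt0 Y_gt0.
Qed.

End bump.

(** Letting [e] tend to 0 flattens the bump to the indicator of the open interval; products of such
    bumps approximate the indicator of a box. *)
Lemma cvg_bump (R : realType) (a b t : R) : a < t < b ->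
  bump a b n.+1%:R^-1 1 0 t @[n --> \oo] --> (1 : R).
Proof.
move=> tab; rewrite /bump tab.
under eq_fun do rewrite expr0 hornerC !mul1r.
set y := _^-1 : R.
have : expR (- n.+1%:R^-1 * y) @[n --> \oo] --> expR (- 0 * y).
  apply: continuous_cvg; first exact: continuous_expR.
  by apply: cvgMl; apply: cvgN; exact: cvg_harmonic.
by rewrite oppr0 mul0r expR0.
Qed.

(** The difference quotients of [f] along [v] and of [phi] at 0 are the same function, so
    directional derivatives reduce to one variable. *)
Lemma is_derive_line (R : realType) (V : normedModType R) (f : V -> R) x v
    (phi : R -> R) l :
  (forall h, f (h *: v + x) = phi h) ->
  is_derive (0 : R) (1 : R) phi l <-> is_derive x v f l.
Proof.
move=> fphi; have e : (fun h => h^-1 *: ((f \o shift x) (h *: v) - f x)) =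
    (fun h => h^-1 *: ((phi \o shift 0) (h *: (1 : R)) - phi 0)).
  apply/funext => h; rewrite /= addr0 [h *: 1]mulr1 -!fphi scale0r add0r.
  by [].
split=> -[h1 h2].
  by split; [rewrite /derivable e|rewrite /derive e].
by split; [rewrite /derivable -e|rewrite /derive -e].
Qed.

Section prod_bump.
Variables (R : realType) (d : nat) (a b : 'rV[R]_d) (e : R).
Hypothesis e_gt0 : 0 < e.

Definition prod_bump (Q : 'I_d -> {poly R}) (n : 'I_d -> nat) (x : 'rV[R]_d) : R :=
  \prod_i bump (a ord0 i) (b ord0 i) e (Q i) (n i) (x ord0 i).

Lemma continuous_prod_bump Q n : continuous (prod_bump Q n).
Proof.
have h (s : seq 'I_d) : continuous (fun x : 'rV[R]_d =>
    \prod_(i <- s) bump (a ord0 i) (b ord0 i) e (Q i) (n i) (x ord0 i)).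
  elim: s => [|i s IH] x.
    by rewrite (_ : (fun x : 'rV[R]_d => _) = cst 1);
      [exact: cst_continuous|apply/funext => y; rewrite big_nil].
  rewrite (_ : (fun x : 'rV[R]_d => _) =
    (bump (a ord0 i) (b ord0 i) e (Q i) (n i) \o (fun x : 'rV[R]_d => x ord0 i)) *
    (fun x : 'rV[R]_d => \prod_(i <- s)
      bump (a ord0 i) (b ord0 i) e (Q i) (n i) (x ord0 i))); last first.
    by apply/funext => y; rewrite big_cons.
  apply: (@continuousM R _ (_ \o _) _ x); last exact: IH.
  by apply: continuous_comp; [exact: coord_continuous|exact: continuous_bump].
exact: h.
Qed.

(** Only the [i]-th factor varies along the direction, and its derivative is again a bump.
    Smoothness of all orders then follows by induction. *)
Lemma is_derive_prod_bump Q n i : exists Q' n', forall x,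
  is_derive x (delta_mx ord0 i) (prod_bump Q n) (prod_bump Q' n' x).
Proof.
pose A := a ord0 i; pose B := b ord0 i.
have [Qi [ni hi]] : exists Qi ni, forall t,
    is_derive t (1 : R) (bump A B e (Q i) (n i)) (bump A B e Qi ni t).
  by eexists; eexists => t; exact: is_derive_bump.
exists (fun j => if j == i then Qi else Q j), (fun j => if j == i then ni else n j).
move=> x; pose c := \prod_(j | j != i) bump (a ord0 j) (b ord0 j) e (Q j) (n j) (x ord0 j).
apply/(@is_derive_line _ _ _ _ _
  (c \*: (bump A B e (Q i) (n i) \o (fun h => h + x ord0 i)))) => [h|].
  rewrite /prod_bump (bigD1 i)//= mulrC; congr (_ * _).
    by apply: eq_bigr => j ji; rewrite !mxE eqxx (negbTE ji) mulr0 add0r.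
  by rewrite !mxE !eqxx mulr1.
rewrite [X in is_derive _ _ _ X](_ : _ = c *: bump A B e Qi ni (0 + x ord0 i)); last first.
  rewrite /prod_bump (bigD1 i)//= eqxx mulrC add0r; congr (_ * _).
  by apply: eq_bigr => j ji; rewrite (negbTE ji).
apply: is_deriveZ; rewrite -[X in is_derive _ _ _ X]mulr1.
apply: is_derive1_comp.
rewrite -[X in is_derive _ _ _ X]addr0; apply: is_deriveD.
Qed.

Lemma Ck_prod_bump k Q n : Ck k (prod_bump Q n).
Proof.
elim: k Q n => [|k IH] Q n /=; split => //; try exact: continuous_prod_bump.
move=> i; have [Q' [n' h]] := is_derive_prod_bump Q n i; split.
  by move=> x; have [] := h x.
rewrite (_ : partial i _ = prod_bump Q' n'); first exact: IH.
by apply/funext => x; have [_] := h x.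
Qed.

Lemma closed_cbox : closed (cbox a b).
Proof.
rewrite (_ : cbox a b = \bigcap_i ((fun x : 'rV[R]_d => x ord0 i) @^-1`
    `[a ord0 i, b ord0 i])).
  apply: closed_bigI => i _; apply: closed_comp => [x _|].
    exact: coord_continuous.
  exact: interval_closed.
apply/seteqP; split => x h i; first by move=> _; rewrite /= in_itv; exact: h.
by have := h i I; rewrite /= in_itv.
Qed.

Lemma compact_cbox : compact (cbox a b).
Proof.
rewrite (_ : cbox a b = [set v : 'rV[R]_d |
    forall i, `[a ord0 i, b ord0 i]%classic (v ord0 i)]).
  by apply: (@rV_compact R d (fun i => `[a ord0 i, b ord0 i]%classic)) => i; exact: segment_compact.
by apply/seteqP; split => x h i; have := h i; rewrite /= in_itv.
Qed.

Lemma prod_bump_out Q n x : ~ obox a b x -> prod_bump Q n x = 0.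
Proof.
move=> /existsNP[i /negP hi]; rewrite /prod_bump (bigD1 i)//= bump_out//.
by rewrite mul0r.
Qed.

Lemma test_function_prod_bump U Q n : cbox a b `<=` U ->
  test_function U (prod_bump Q n).
Proof.
move=> abU; have sub : closure [set x | prod_bump Q n x != 0] `<=` cbox a b.
  rewrite (closure_id (cbox a b)).1; last exact: closed_cbox.
  apply: closure_subset => x /= /eqP h i.
  have : obox a b x by apply: contrapT => /prod_bump_out/h.
  by move=> /(_ i)/andP[/ltW -> /ltW ->].
split; first by move=> k; exact: Ck_prod_bump.
- apply: (subclosed_compact _ compact_cbox sub); exact: closed_closure.
- exact: subset_trans sub abU.
Qed.

End prod_bump.

(** * The fundamental lemma of the calculus of variations *)

Section fundamental_lemma.
Variables (R : realType) (d : nat).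
Local Notation mu := (lebesgue_rV R d).

Definition oboxes : set (set 'rV[R]_d) :=
  [set B | exists a b, B = obox a b].

Lemma oboxI (a b a' b' : 'rV[R]_d) : obox a b `&` obox a' b' =
  obox (\row_i Num.max (a ord0 i) (a' ord0 i))
       (\row_i Num.min (b ord0 i) (b' ord0 i)).
Proof.
apply/seteqP; split => x /=.
  move=> [h h'] i; rewrite !mxE gt_max lt_min.
  by have /andP[-> ->] := h i; have /andP[-> ->] := h' i.
move=> h; split => i; have := h i; rewrite !mxE gt_max lt_min;
  by move=> /andP[/andP[h1 h2] /andP[h3 h4]]; apply/andP; split.
Qed.

(** Prepares the pi-lambda argument, since boxes are stable under intersection. A strip in one
    coordinate is the increasing union of the boxes whose other sides are ]-n, n[. *)
Lemma measurable_rVE : @measurable _ 'rV[R]_d = <<s oboxes >>.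
Proof.
apply/seteqP; split; last first.
  apply: smallest_sub; first exact: sigma_algebra_measurable.
  by move=> _ [a [b ->]]; exact: measurable_obox.
pose T := g_sigma_algebraType oboxes.
have mc (i : 'I_d) : measurable_fun [set: T] (fun x : T => (x : 'rV[R]_d) ord0 i).
  apply: (measurability _ (RGenOpens.measurableE R)) => _ [_ [x [y ->]] <-].
  rewrite setTI.
  rewrite (_ : _ @^-1` _ = \bigcup_(n : nat)
     obox (\row_j if j == i then x else - n%:R)
          (\row_j if j == i then y else n%:R)).
    by apply: bigcupT_measurable => n; apply: sub_sigma_algebra; eexists; eexists.
  apply/seteqP; split => z /=; rewrite in_itv/=.
    move=> zi; pose m := \sum_j `|z ord0 j|.
    exists (Num.truncn m).+1 => // j; rewrite !mxE; case: ifPn => [/eqP ->//|_].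
    rewrite -ltr_norml (le_lt_trans _ (truncnS_gt m))//.
    by rewrite /m (bigD1 j)//= lerDl sumr_ge0.
  by move=> [n _ /(_ i)]; rewrite !mxE eqxx.
apply: smallest_sub; first exact: smallest_sigma_algebra.
move=> A; rewrite -bigcup_seq => -[i _ [C mC <-]].
exact: (mc i measurableT C mC).
Qed.

Variables (U : set 'rV[R]_d) (g : 'rV[R]_d -> R).
Hypothesis oU : open U.
Hypothesis ig : mu.-integrable U (EFin \o g).
Hypothesis g_test : forall phi, test_function U phi ->
  \int[mu]_(x in U) (g x * phi x) = 0.

Let mU : measurable U := open_measurable_rV oU.

Let mg : measurable_fun U g.
Proof. by apply/measurable_EFinP; have /integrableP[] := ig. Qed.

(** Dominated convergence: product bumps with e = 1/(n+1) are test functions bounded by 1 that tend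
    to the indicator of the box. *)
Lemma integral_obox_eq0 a b : cbox a b `<=` U ->
  (\int[mu]_(x in obox a b) (g x)%:E = 0)%E.
Proof.
move=> abU; pose phi n := prod_bump a b n.+1%:R^-1 (fun=> 1) (fun=> 0%N).
have n0 n : 0 < n.+1%:R^-1 :> R by rewrite invr_gt0.
have phi_test n : test_function U (phi n) by exact: test_function_prod_bump.
have mphi n : measurable_fun U (phi n).
  by apply: measurable_funTS; apply: continuous_measurable_rV; exact: continuous_prod_bump.
have phi_le n x : `|phi n x| <= 1.
  rewrite /phi /prod_bump normr_prod; apply: prodr_ile1 => i _.
  by rewrite normr_ge0/= ger0_norm ?bump1_ge0// bump1_le1.
have abU' : obox a b `<=` U.
  by move=> x h; apply: abU => i; have /andP[/ltW -> /ltW ->] := h i.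
pose f_ n x := (g x * phi n x)%:E.
pose f := (EFin \o g) \_ (obox a b).
have mf : measurable_fun U f.
  by apply/measurable_restrict => //; [exact: measurable_obox|apply: measurable_funS mU _ (measurable_int _ ig); exact: subIsetl].
have := @dominated_convergence _ _ _ mu U mU f_ f (fun x => `|g x|%:E).
case.
- by move=> n; apply/measurable_EFinP; apply: measurable_funM.
- exact: mf.
- apply: aeW => x Ux; rewrite /f_ /f patchE.
  have [xab|xab] := pselect (obox a b x); [rewrite mem_set//|rewrite memNset//]; last first.
    rewrite (_ : (fun n => _) = cst 0%E); first exact: cvg_cst.
    by apply/funext => n; rewrite /phi prod_bump_out// mulr0.
  apply: cvg_EFin; first by near=> n.
  rewrite -[X in _ --> X]mulr1; apply: cvgMr.
  rewrite /phi /prod_bump.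
  have h (s : seq 'I_d) : \prod_(i <- s) bump (a ord0 i) (b ord0 i) n.+1%:R^-1 1 0
      (x ord0 i) @[n --> \oo] --> (1 : R).
    elim: s => [|i s IH].
      by under eq_fun do rewrite big_nil; exact: cvg_cst.
    under eq_fun do rewrite big_cons.
    by have := cvgM (cvg_bump (xab i)) IH; rewrite mulr1; apply; exact: eventually_filter.
  exact: h.
- by apply: integrable_norm.
- apply: aeW => x n Ux; rewrite /f_ lee_fin normrM ler_piMr//.
move=> _ _; rewrite /f -integral_mkcondr setIidr// => h.
have e : (fun n => (\int[mu]_(x in U) f_ n x)%E) = cst 0%E.
  apply/funext => n; rewrite /f_ /=; apply: etrans (congr1 EFin (g_test (phi_test n))).
  rewrite /Rintegral fineK//.
  apply: integrable_fin_num => //.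
  apply: (le_integrable mU _ _ (integrable_norm ig)).
    by apply/measurable_EFinP; apply: measurable_funM.
  by move=> x Ux; rewrite /= lee_fin normrM normr_id ler_piMr.
move: h; rewrite e => h; rewrite -(cvg_lim _ h)//; exact: lim_cst.
Unshelve. all: by end_near. Qed.

(** The measurable sets [S] for which [g] integrates to 0 over [B] and [S] together form a Dynkin
    class that contains the boxes, hence every measurable set; a function with all integrals 0
    vanishes almost everywhere. *)
Lemma fundamental_lemma_obox a b : cbox a b `<=` U ->
  ae_eq mu (obox a b) (EFin \o g) (cst 0%E).
Proof.
move=> abU; set B := obox a b.
have BU : B `<=` U.
  by move=> x h; apply: abU => i; have /andP[/ltW -> /ltW ->] := h i.
have mB : measurable B by exact: measurable_obox.
have iB : mu.-integrable B (EFin \o g) by exact: integrableS ig.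
apply: integral_ae_eq => // E EB mE; rewrite integral0 -(setIidr EB).
pose P S := (\int[mu]_(x in B `&` S) (g x)%:E = 0)%E.
have mgS S : measurable S -> measurable_fun (B `&` S) (EFin \o g).
  move=> mS; apply: measurable_funS mB _ (measurable_int _ iB); exact: subIsetl.
have PT : P setT by rewrite /P setIT; exact: integral_obox_eq0.
apply: (@dynkin_induction _ 'rV[R]_d oboxes P measurable_rVE).
- move=> _ _ [a1 [b1 ->]] [a2 [b2 ->]]; rewrite oboxI.
  by eexists; eexists.
- exact: PT.
- move=> _ [a' [b' ->]]; rewrite /P oboxI; set a1 := \row__ _; set b1 := \row__ _.
  apply: integral_obox_eq0 => x h; apply: abU => i.
  have := h i; rewrite !mxE ge_max le_min.
  by move=> /andP[/andP[-> _] /andP[-> _]].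
- move=> S mS PS; rewrite /P.
  have := PT; rewrite /P setIT.
  rewrite (_ : B = (B `&` S) `|` (B `&` ~` S)); last by rewrite -setIUr setUv setIT.
  have mBS : measurable (B `&` S) by exact: measurableI.
  have mBCS : measurable (B `&` ~` S) by apply: measurableI => //; exact: measurableC.
  rewrite integral_setU//; last first.
  + by apply/disj_setPS => x [[_ ?] [_ ?]].
  + by rewrite -setIUr setUv; exact: mgS.
  by rewrite PS add0e -setIUr setUv setIT.
- move=> F mF tF PF; rewrite /P setI_bigcupr integral_bigcup//.
  + by rewrite eseries0// => n _ _; exact: PF.
  + by apply: trivIset_setIl.
  + by move=> n; exact: measurableI.
  + apply: integrableS iB => //; first by apply: bigcup_measurable => n _; exact: measurableI.
    by apply: bigcup_sub => n _; exact: subIsetl.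
- by rewrite -measurable_rVE.
Qed.

Lemma fundamental_lemma : {ae mu, forall x, U x -> g x = 0}.
Proof.
have [D [a [b [UE abU]]]] := open_bigcup_obox oU.
have neg n : mu.-negligible (if n \in D then
    ~` [set x | obox (a n) (b n) x -> g x = 0] else set0).
  case: ifPn => [/set_mem Dn|_]; last exact: negligible_set0.
  have : {ae mu, forall x, obox (a n) (b n) x -> g x = 0}.
    have := fundamental_lemma_obox (abU n Dn).
    by apply: filterS => x /= h /h [].
  by [].
apply: (@negligibleS _ _ _ _ _ _ _ (negligible_bigcup neg)) => x /= /not_implyP[Ux gx].
move: Ux; rewrite UE => -[n Dn abx]; exists n => //; rewrite mem_set//=.
by apply/not_implyP; split.
Qed.

End fundamental_lemma.

(** * Integration by parts *)

Definition bounded_support (R : realType) d (m : R) (f : 'rV[R]_d -> R) :=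
  forall (x : 'rV[R]_d) i, m < `|x ord0 i| -> f x = 0.

Lemma continuous_compact_bounded (R : realType) d (f : 'rV[R]_d -> R) K :
  continuous f -> compact K -> (forall x, ~ K x -> f x = 0) ->
  exists C, forall x, `|f x| <= C.
Proof.
move=> cf cK f0.
have /compact_bounded[C [_ hC]] : compact (f @` K).
  by apply: continuous_compact => //; exact: continuous_subspaceT.
exists (`|C| + 1) => x; have [Kx|Kx] := pselect (K x); last first.
  by rewrite f0// normr0 addr_ge0.
apply: hC; last by exists x.
by rewrite (le_lt_trans (ler_norm C))// ltrDl.
Qed.

Lemma integrable_bounded_support (R : realType) d m (f : 'rV[R]_d -> R) :
  continuous f -> bounded_support m f ->
  (lebesgue_rV R d).-integrable [set: 'rV[R]_d] (EFin \o f).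
Proof.
move=> cf fm; pose K : set 'rV[R]_d := cbox (const_mx (- m)) (const_mx m).
have f0 x : ~ K x -> f x = 0.
  move=> /existsNP[i]; rewrite !mxE => /negP; rewrite -ler_norml -ltNge.
  exact: fm.
have [C fC] := continuous_compact_bounded cf (@compact_cbox _ _ _ _) f0.
have mK : measurable K.
  rewrite (_ : K = [set x | forall i, `[- m, m]%classic (x ord0 i)]).
    exact: (measurable_coords (fun i => measurable_itv _)).
  by apply/seteqP; split => x h i; have := h i; rewrite /= !mxE in_itv/=.
have Kfin : (lebesgue_rV R d K < +oo)%E.
  apply: (@lebesgue_rV_bounded _ _ _ m) => // x Kx i.
  by have := Kx i; rewrite !mxE ler_norml.
have : (lebesgue_rV R d).-integrable K (EFin \o f).
  apply: measurable_bounded_integrable => //.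
    by apply: measurable_funTS; exact: continuous_measurable_rV.
  exists C; split; first exact: num_real.
  by move=> r Cr x _; apply: (le_trans (fC x)); exact: ltW.
move=> /(integrable_mkcond _ mK); congr (_.-integrable _ _).
apply/funext => x; rewrite patchE; case: ifPn => // /negP xK.
by rewrite /= f0// => Kx; apply: xK; rewrite inE.
Qed.

Lemma integral_deriv_bounded_support (R : realType) (m : R) (r r' : R -> R) :
  (forall a, is_derive a (1 : R) r (r' a)) -> continuous r' ->
  (forall a, m < `|a| -> r a = 0) -> (forall a, m < `|a| -> r' a = 0) ->
  (\int[@lebesgue_measure R]_a (r' a)%:E = 0)%E.
Proof.
(* Adding 1 to the absolute value makes [M] positive and larger than [m] whatever the sign of [m],
   so [r] vanishes at both endpoints. *)
move=> dr cr' r0 r'0; pose M : R := `|m| + 1.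
have mM : m < M by rewrite /M (le_lt_trans (ler_norm m))// ltrDl.
have M0 : 0 < M by rewrite /M ltr_wpDl.
have -> : (\int[@lebesgue_measure R]_a (r' a)%:E =
    \int[@lebesgue_measure R]_(a in `[(- M)%R, M]) (r' a)%:E)%E.
  rewrite [RHS]integral_mkcond; apply: eq_integral => a _; rewrite patchE.
  case: ifPn => // /negP; rewrite inE /= in_itv/= -ler_norml => /negP.
  by rewrite -ltNge => Ma; rewrite r'0// (lt_trans mM).
have cr : continuous r.
  by move=> a; apply/differentiable_continuous/derivable1_diffP; have [] := dr a.
rewrite (@continuous_FTC2 _ r' r); last first.
- by move=> a _; rewrite derive1E; have [_ ->] := dr a.
- split; first by move=> a _; have [] := dr a.
    by apply: cvg_at_right_filter; exact: cr.
  by apply: cvg_at_left_filter; exact: cr.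
- exact: continuous_subspaceT.
- by rewrite gtrN.
by rewrite !r0 ?subee// ?normrN gtr0_norm.
Qed.

Section cons_rV_continuity.
Variables (R : realType) (d : nat).

Lemma continuous_cons_rVr (a : R) : continuous (fun x : 'rV[R]_d => cons_rV (a, x)).
Proof.
move=> x A /nbhs_ballP[e e0 eA]; apply/nbhs_ballP; exists e => // y [_ hy].
apply: eA; split => // i j; rewrite !mxE; case: unliftP => [k _|_].
  exact: hy.
exact: ballxx.
Qed.

Lemma continuous_cons_rVl (x : 'rV[R]_d) : continuous (fun a : R => cons_rV (a, x)).
Proof.
move=> a A /nbhs_ballP[e e0 eA]; apply/nbhs_ballP; exists e => // b hb.
apply: eA; split => // i j; rewrite !mxE; case: unliftP => [k _|_].
  exact: ballxx.
exact: hb.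
Qed.

Lemma cons_rV0 (a : R) (x : 'rV[R]_d) : cons_rV (a, x) ord0 ord0 = a.
Proof. by rewrite mxE unlift_none. Qed.

Lemma cons_rVS (a : R) (x : 'rV[R]_d) i : cons_rV (a, x) ord0 (lift ord0 i) = x ord0 i.
Proof. by rewrite mxE liftK. Qed.

Lemma cons_rV_line0 (a h : R) (x : 'rV[R]_d) :
  h *: delta_mx ord0 ord0 + cons_rV (a, x) = cons_rV (h + a, x).
Proof.
apply/rowP => i; rewrite !mxE; case: unliftP => [j ->|->].
  by rewrite eqxx/= mulr0 add0r.
by rewrite !eqxx mulr1.
Qed.

Lemma cons_rV_lineS (a h : R) (x : 'rV[R]_d) i :
  h *: delta_mx ord0 (lift ord0 i) + cons_rV (a, x) =
  cons_rV (a, h *: delta_mx ord0 i + x).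
Proof.
apply/rowP => j; rewrite !mxE; case: unliftP => [k ->|->].
  by rewrite !mxE !eqxx (inj_eq lift_inj).
by rewrite eqxx/= mulr0 add0r.
Qed.

End cons_rV_continuity.

(** Fubini, with induction on the dimension. For the first coordinate the inner integral is the
    one-dimensional case; for any other one the slices at a fixed first coordinate satisfy the
    induction hypothesis. *)
Lemma integral_partial_eq0 (R : realType) d (m : R) i (f g : 'rV[R]_d -> R) :
  (forall x, is_derive x (delta_mx ord0 i) f (g x)) -> continuous g ->
  bounded_support m f -> bounded_support m g ->
  (\int[lebesgue_rV R d]_x (g x)%:E = 0)%E.
Proof.
elim: d i f g => [|d IH] i f g df cg fm gm; first by case: i {df}.
have mg : measurable_fun [set: 'rV[R]_d.+1] (EFin \o g).
  by apply/measurable_EFinP; exact: continuous_measurable_rV.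
pose h := (EFin \o g) \o (@cons_rV R d).
have mh : measurable_fun [set: (measurableTypeR R * 'rV[R]_d)%type] h.
  by apply: measurableT_comp => //; exact: measurable_cons_rV.
have ih : (@lebesgue_measure R \x lebesgue_rV R d)%E.-integrable setT h.
  apply/integrableP; split => //.
  have /integrableP[_] := integrable_bounded_support cg gm.
  rewrite /= (ge0_integral_pushforward (@measurable_cons_rV R d))//.
  apply/measurable_EFinP; apply: measurableT_comp => //.
  exact: continuous_measurable_rV.
have -> : (\int[lebesgue_rV R d.+1]_x (g x)%:E =
    \int[@lebesgue_measure R \x lebesgue_rV R d]_z h z)%E.
  by rewrite /= (integral_pushforward (@measurable_cons_rV R d)).
case: (unliftP ord0 i) => [j ij|i0].
  rewrite -integral12_prod_meas1//; apply: integral0_eq => a _.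
  rewrite /fubini_F /h /=; apply: (IH j (fun x => f (cons_rV (a, x)))).
  - move=> x; pose phi r := f (r *: delta_mx ord0 i + cons_rV (a, x)).
    apply: (@is_derive_line _ _ _ _ _ phi _ _).1.
      by move=> r; rewrite /phi ij cons_rV_lineS.
    exact: (@is_derive_line _ _ f _ _ phi _ (fun=> erefl)).2.
  - move=> x; apply: (@continuous_comp _ _ _ (fun x => cons_rV (a, x)) g).
      exact: continuous_cons_rVr.
    exact: cg.
  - by move=> x k xk; apply: (fm _ (lift ord0 k)); rewrite cons_rVS.
  - by move=> x k xk; apply: (gm _ (lift ord0 k)); rewrite cons_rVS.
rewrite -integral21_prod_meas1//; apply: integral0_eq => x _.
rewrite /fubini_G /h /=.
apply: (@integral_deriv_bounded_support _ m (fun a => f (cons_rV (a, x)))).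
- move=> a; pose phi r := f (r *: delta_mx ord0 i + cons_rV (a, x)).
  apply: (@is_derive_line _ _ _ _ _ phi _ _).1.
    by move=> r; rewrite /phi i0 cons_rV_line0 [r *: 1]mulr1.
  exact: (@is_derive_line _ _ f _ _ phi _ (fun=> erefl)).2.
- move=> a; apply: (@continuous_comp _ _ _ (fun a => cons_rV (a, x)) g).
    exact: continuous_cons_rVl.
  exact: cg.
- by move=> a ma; apply: (fm _ ord0); rewrite cons_rV0.
- by move=> a ma; apply: (gm _ ord0); rewrite cons_rV0.
Qed.

(** * L^2 inner products *)

Lemma sqre_poweR (R : realType) (x : \bar R) : (0 <= x)%E -> (x ^+ 2 = x `^ 2)%E.
Proof.
case: x => [r| |]//=; last by rewrite pnatr_eq0.
by rewrite lee_fin => r0; rewrite powR_mulrn.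
Qed.

Section L2.
Variables (R : realType) (d : nat) (Om : set 'rV[R]_d).
Hypothesis mOm : measurable Om.
Local Notation mu := (lebesgue_rV R d).
Implicit Types (v w z : 'rV[R]_d -> R) (G H K : 'rV[R]_d -> 'rV[R]_d).

Lemma L2norm_ge0 v : (0 <= L2norm Om v)%E.
Proof. exact: Lnorm_ge0. Qed.

Lemma L2norm_sqr v : (L2norm Om v ^+ 2 = \int[mu]_(x in Om) (v x ^+ 2)%:E)%E.
Proof.
rewrite sqre_poweR ?L2norm_ge0// /L2norm poweR_Lnorm ?pnatr_eq0//.
rewrite [RHS]integral_mkcond; apply: eq_integral => x _ /=.
rewrite !patchE; case: ifPn => _; last by rewrite normr0 powR0 ?pnatr_eq0.
by rewrite powR_mulrn// real_normK ?num_real.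
Qed.

Lemma eq_L2norm v w : (forall x, Om x -> v x = w x) -> L2norm Om v = L2norm Om w.
Proof.
move=> vw; congr Lnorm; apply/funext => x /=; rewrite !patchE.
by case: ifPn => // /set_mem /vw ->.
Qed.

Lemma eq_ip v v' w w' : (forall x, Om x -> v x = v' x) ->
  (forall x, Om x -> w x = w' x) -> ip Om v w = ip Om v' w'.
Proof.
by move=> vv' ww'; apply: eq_Rintegral => x /set_mem Ox; rewrite vv'// ww'.
Qed.

Lemma L2funP v : L2fun Om v <->
  measurable_fun Om v /\ mu.-integrable Om (EFin \o (fun x => v x ^+ 2)).
Proof.
have fin : (L2norm Om v < +oo)%E <-> (L2norm Om v ^+ 2 < +oo)%E.
  have := L2norm_ge0 v; case: (L2norm Om v) => [r| |]// _.
  by split=> _; rewrite -?EFin_expe ltry.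
split=> -[mv h]; split => //.
  apply/integrableP; split.
    by apply/measurable_EFinP; exact: measurable_funX.
  rewrite [X in (X < _)%E](_ : _ = L2norm Om v ^+ 2)%E ?(fin.1 h)//.
  rewrite L2norm_sqr; apply: eq_integral => x _ /=.
  by rewrite ger0_norm ?sqr_ge0.
apply/fin; rewrite L2norm_sqr; have /integrableP[_] := h.
by under eq_integral do rewrite /= ger0_norm ?sqr_ge0//.
Qed.

Lemma L2_integrableM v w : L2fun Om v -> L2fun Om w ->
  mu.-integrable Om (EFin \o (fun x => v x * w x)).
Proof.
move=> /L2funP[mv iv] /L2funP[mw iw].
apply: (le_integrable mOm _ _ (integrableD mOm iv iw)).
  by apply/measurable_EFinP; exact: measurable_funM.
move=> x Ox /=; rewrite lee_fin normrM.
rewrite [leRHS]ger0_norm ?addr_ge0 ?sqr_ge0//.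
rewrite -[X in _ <= X + _]real_normK ?num_real// -[X in _ <= _ + X]real_normK ?num_real//.
have := sqr_ge0 (`|v x| - `|w x|); have := normr_ge0 (v x); have := normr_ge0 (w x).
by nra.
Qed.

Lemma L2fun_lin a v w : L2fun Om v -> L2fun Om w ->
  L2fun Om (fun x => a * v x + w x).
Proof.
move=> v2 w2; have /L2funP[mv iv] := v2; have /L2funP[mw iw] := w2.
have ivw := L2_integrableM v2 w2.
have m : measurable_fun Om (fun x => a * v x + w x).
  by apply: measurable_funD => //; apply: measurable_funM.
apply/L2funP; split => //.
have iD := integrableD mOm (integrableD mOm (integrableZl mOm (a ^+ 2) iv)
  (integrableZl mOm (2 * a) ivw)) iw.
apply: eq_integrable iD => // x _ /=.
by rewrite -!EFinM -!EFinD; congr EFin; ring.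
Qed.

Lemma ipC v w : ip Om v w = ip Om w v.
Proof. by apply: eq_Rintegral => x _; rewrite mulrC. Qed.

Lemma ip_linl a v w z : L2fun Om v -> L2fun Om w -> L2fun Om z ->
  ip Om (fun x => a * v x + w x) z = a * ip Om v z + ip Om w z.
Proof.
move=> v2 w2 z2; have iv := L2_integrableM v2 z2; have iw := L2_integrableM w2 z2.
rewrite /ip -RintegralZl// -RintegralD//.
  by apply: eq_Rintegral => x _; ring.
by apply: eq_integrable (integrableZl mOm a iv) => // x _ /=.
Qed.

Lemma ip_ge0 v : 0 <= ip Om v v.
Proof. by apply: Rintegral_ge0 => x _; rewrite -expr2 sqr_ge0. Qed.

Lemma L2norm_ip v : L2fun Om v -> (L2norm Om v ^+ 2 = (ip Om v v)%:E)%E.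
Proof.
move=> v2; rewrite L2norm_sqr /ip /Rintegral fineK//.
by apply: integrable_fin_num => //; exact: L2_integrableM.
Qed.

Lemma L2norm_le v (s : R) : 0 <= s -> L2fun Om v -> ip Om v v <= s ^+ 2 ->
  (L2norm Om v <= s%:E)%E.
Proof.
move=> s0 v2 vs; have := L2norm_ip v2; have := L2norm_ge0 v; have [_] := v2.
case: (L2norm Om v) => [r| |]//= _; rewrite lee_fin => r0.
move=> /(congr1 fine)/=; rewrite -expr2 => e.
by rewrite lee_fin -(@ler_pXn2r _ 2)// ?nnegrE// e.
Qed.

Lemma ip_ae_eq v v' w : L2fun Om v -> L2fun Om v' -> L2fun Om w ->
  {ae mu, forall x, Om x -> v x = v' x} -> ip Om v w = ip Om v' w.
Proof.
move=> v2 v'2 w2 vv'; rewrite /ip /Rintegral; congr fine.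
apply: ae_eq_integral => //.
- by apply/measurable_EFinP; apply: measurable_funM; [exact: v2.1|exact: w2.1].
- by apply/measurable_EFinP; apply: measurable_funM; [exact: v'2.1|exact: w2.1].
- by apply: filterS vv' => x h Ox /=; rewrite h.
Qed.

(* Cauchy-Schwarz, also when one of the norms is infinite *)
Lemma ip_CS v w : measurable_fun Om v -> measurable_fun Om w ->
  (`|ip Om v w|%:E <= L2norm Om v * L2norm Om w)%E.
Proof.
move=> mv mw.
have mv' : measurable_fun setT (v \_ Om) by exact: (measurable_restrictT v mOm).1 mv.
have mw' : measurable_fun setT (w \_ Om) by exact: (measurable_restrictT w mOm).1 mw.
have half : 2^-1 + 2^-1 = 1 :> R by lra.
apply: le_trans (hoelder mu mv' mw' (ltr0Sn R 1) (ltr0Sn R 1) half).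
rewrite Lnorm1 /ip /Rintegral.
have e : (\int[mu]_x `|(EFin \o ((v \_ Om) \* (w \_ Om))%R) x| =
   \int[mu]_(x in Om) `|(v x * w x)%:E|)%E.
  rewrite [RHS]integral_mkcond; apply: eq_integral => x _ /=.
  by rewrite !patchE; case: ifPn => // _; rewrite mul0r normr0.
rewrite e; apply: le_trans (le_abse_integral mu mOm _); last first.
  by apply/measurable_EFinP; exact: measurable_funM.
(* [fine] sends an infinite integral to 0, which only decreases the left-hand side. *)
by case: (\int[mu]_(x in Om) _)%E => [r| |] /=; rewrite ?normr0 ?leey ?lexx.
Qed.

End L2.

Lemma Rintegral_sum d (T : measurableType d) (R : realType)
    (mu : {measure set T -> \bar R}) (D : set T) (I : Type) (s : seq I)
    (F : I -> T -> R) : measurable D ->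
  (forall i, mu.-integrable D (EFin \o F i)) ->
  mu.-integrable D (EFin \o (fun x => \sum_(i <- s) F i x)) /\
  \int[mu]_(x in D) (\sum_(i <- s) F i x) =
  \sum_(i <- s) \int[mu]_(x in D) F i x.
Proof.
move=> mD iF; elim: s => [|i s [IH1 IH2]].
  have e : (fun x => \sum_(i <- [::]) F i x) = cst 0.
    by apply/funext => x; rewrite big_nil.
  rewrite e big_nil; split; first exact: integrable0.
  by rewrite /Rintegral integral0.
have e : (fun x => \sum_(i <- i :: s) F i x) =
    fun x => F i x + \sum_(i <- s) F i x.
  by apply/funext => x; rewrite big_cons.
rewrite e big_cons -IH2 RintegralD//; split => //.
by have := integrableD mD (iF i) IH1; apply: eq_integrable.
Qed.

(** For p > 0 evaluate at the minimiser -x/p. For p = 0 and x nonzero the value at -(r + 1)/(2x)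
    would be -1. *)
Lemma discr_le (R : realFieldType) (p x r : R) : 0 <= p ->
  (forall t, 0 <= p * t ^+ 2 + (2 * x) * t + r) -> x ^+ 2 <= p * r.
Proof.
rewrite le_eqVlt => /predU1P[<-|p0] h.
  rewrite mul0r; have [->|x0] := eqVneq x 0; first by rewrite expr0n.
  have := h (- (r + 1) / (2 * x)).
  by rewrite mul0r add0r mulrC divfK ?mulf_neq0// opprD addrAC addNr sub0r ler0N1.
have := h (- x / p); rewrite (_ : _ + _ = r - x ^+ 2 / p); last by field; rewrite gt_eqF.
by rewrite subr_ge0 ler_pdivrMr// mulrC.
Qed.

Section L2v.
Variables (R : realType) (d : nat) (Om : set 'rV[R]_d).
Hypothesis mOm : measurable Om.
Local Notation mu := (lebesgue_rV R d).
Implicit Types (v w z : 'rV[R]_d -> R) (G H K : 'rV[R]_d -> 'rV[R]_d).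

Lemma dotv_integrable G H : L2funv Om G -> L2funv Om H ->
  mu.-integrable Om (EFin \o (fun x => dotv (G x) (H x))).
Proof.
move=> G2 H2; have [] := @Rintegral_sum _ _ _ mu Om _ (index_enum 'I_d)
  (fun i x => G x ord0 i * H x ord0 i) mOm => //.
by move=> i; apply: L2_integrableM.
Qed.

Lemma ipvE G H : L2funv Om G -> L2funv Om H ->
  ipv Om G H = \sum_i ip Om (fun x => G x ord0 i) (fun x => H x ord0 i).
Proof.
move=> G2 H2; have [] := @Rintegral_sum _ _ _ mu Om _ (index_enum 'I_d)
  (fun i x => G x ord0 i * H x ord0 i) mOm => //.
by move=> i; apply: L2_integrableM.
Qed.

Lemma dotv_ge0 (x : 'rV[R]_d) : 0 <= dotv x x.
Proof. by apply: sumr_ge0 => i _; rewrite -expr2 sqr_ge0. Qed.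

Lemma ipv_ge0 G : 0 <= ipv Om G G.
Proof. by apply: Rintegral_ge0 => x _; exact: dotv_ge0. Qed.

Lemma ipvC G H : ipv Om G H = ipv Om H G.
Proof.
by apply: eq_Rintegral => x _; apply: eq_bigr => i _; rewrite mulrC.
Qed.

Lemma L2normv_ipv G : L2funv Om G -> (L2normv Om G ^+ 2 = (ipv Om G G)%:E)%E.
Proof.
move=> G2; rewrite /L2normv L2norm_sqr /ipv /Rintegral fineK; last first.
  by apply: integrable_fin_num => //; exact: dotv_integrable.
by apply: eq_integral => x _ /=; rewrite sqr_sqrtr ?dotv_ge0.
Qed.

Lemma L2normv_ge0 G : (0 <= L2normv Om G)%E.
Proof. exact: L2norm_ge0. Qed.

Lemma L2normv_le G (s : R) : 0 <= s -> L2funv Om G -> ipv Om G G <= s ^+ 2 ->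
  (L2normv Om G <= s%:E)%E.
Proof.
move=> s0 v2 vs; have := L2normv_ipv v2; have := L2normv_ge0 G.
case: (L2normv Om G) => [r| |]//=; rewrite lee_fin => r0.
move=> /(congr1 fine)/=; rewrite -expr2 => e.
by rewrite lee_fin -(@ler_pXn2r _ 2)// ?nnegrE// e.
Qed.

Lemma L2funv_lin a G H : L2funv Om G -> L2funv Om H ->
  L2funv Om (fun x => a *: G x + H x).
Proof.
move=> G2 H2 i; rewrite (_ : (fun x => _) = fun x => a * G x ord0 i + H x ord0 i).
  exact: L2fun_lin.
by apply/funext => x; rewrite !mxE.
Qed.

Lemma ipv_linl a G H K : L2funv Om G -> L2funv Om H -> L2funv Om K ->
  ipv Om (fun x => a *: G x + H x) K = a * ipv Om G K + ipv Om H K.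
Proof.
move=> G2 H2 K2; rewrite !ipvE//; last exact: L2funv_lin.
rewrite mulr_sumr -big_split; apply: eq_bigr => i _ /=.
rewrite -ip_linl//; apply: eq_ip => // x _.
by rewrite !mxE.
Qed.

Lemma ipv_ae_eq G G' H : L2funv Om G -> L2funv Om G' -> L2funv Om H ->
  (forall i, {ae mu, forall x, Om x -> G x ord0 i = G' x ord0 i}) ->
  ipv Om G H = ipv Om G' H.
Proof.
move=> G2 G'2 H2 GG'; rewrite !ipvE//; apply: eq_bigr => i _.
exact: ip_ae_eq.
Qed.

Lemma ipv_CS G H (P S : R) : 0 <= P -> 0 <= S -> L2funv Om G -> L2funv Om H ->
  ipv Om G G <= P ^+ 2 -> ipv Om H H <= S ^+ 2 -> ipv Om G H <= P * S.
Proof.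
move=> P0 S0 G2 H2 GP HS.
have h t : 0 <= ipv Om G G * t ^+ 2 + (2 * ipv Om G H) * t + ipv Om H H.
  have := ipv_ge0 (fun x => t *: G x + H x).
  rewrite ipv_linl//; last exact: L2funv_lin.
  rewrite ![ipv Om _ (fun x => t *: _ + _)]ipvC !ipv_linl// (ipvC H G).
  by move=> /le_trans; apply; rewrite le_eqVlt; apply/orP; left; apply/eqP; ring.
have h2 := discr_le (ipv_ge0 G) h.
have [|/ltW GH0] := leP (ipv Om G H) 0; first by move=> /le_trans; apply; rewrite mulr_ge0.
rewrite -(@ler_pXn2r _ 2)// ?nnegrE ?mulr_ge0// exprMn.
have := ler_pM (ipv_ge0 G) (ipv_ge0 H) GP HS.
exact: le_trans h2.
Qed.

End L2v.

(** * Test functions *)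

Section test_functions.
Variables (R : realType) (d : nat).
Implicit Types (phi psi : 'rV[R]_d -> R) (Om : set 'rV[R]_d).

Lemma continuous_lin a phi psi : continuous phi -> continuous psi ->
  continuous (fun x => a * phi x + psi x).
Proof.
move=> cphi cpsi x; apply: (@continuousD _ R^o _ (a \*: phi) psi x); last exact: cpsi.
by apply: continuousZr; exact: cphi.
Qed.

Lemma Ck_lin k a phi psi : Ck k phi -> Ck k psi ->
  Ck k (fun x => a * phi x + psi x).
Proof.
elim: k phi psi => [|k IH] phi psi /= [cphi dphi] [cpsi dpsi].
  by split => //; exact: continuous_lin.
split; first exact: continuous_lin.
move=> i; have [dphi1 dphi2] := dphi i; have [dpsi1 dpsi2] := dpsi i.
have e : (fun x => a * phi x + psi x) = (a \*: phi) + psi by [].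
split.
  by move=> x; rewrite e; apply: derivableD => //; exact: derivableZ.
rewrite (_ : partial i _ = fun x => a * partial i phi x + partial i psi x).
  exact: IH.
apply/funext => x; rewrite /partial e deriveD//; last exact: derivableZ.
by rewrite deriveZ.
Qed.

Lemma test_function_lin Om a phi psi : test_function Om phi ->
  test_function Om psi -> test_function Om (fun x => a * phi x + psi x).
Proof.
move=> [c1 k1 s1] [c2 k2 s2].
have sub : closure [set x | a * phi x + psi x != 0] `<=`
    closure [set x | phi x != 0] `|` closure [set x | psi x != 0].
  rewrite -closureU; apply: closure_subset => x /=.
  have [->|] := eqVneq (phi x) 0; last by left.
  by rewrite mulr0 add0r; right.
split.
- by move=> k; exact: Ck_lin.
- apply: (subclosed_compact _ (compactU k1 k2) sub); exact: closed_closure.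
- by move=> x /sub[/s1|/s2].
Qed.

Lemma test_function0 Om : test_function Om (fun=> 0).
Proof.
have Ck0 k : Ck k (fun=> 0 : R) (d := d).
  elim: k => [|k IH] /=; split => //; try exact: cst_continuous.
  move=> i; split; first by move=> x; exact: derivable_cst.
  rewrite (_ : partial i _ = fun=> 0)//; apply/funext => x.
  exact: derive_cst.
have e : [set x : 'rV[R]_d | (0 : R) != 0] = set0.
  by apply/seteqP; split => x //=; rewrite eqxx.
by split; rewrite ?e ?closure0//; exact: compact0.
Qed.

Variable Om : set 'rV[R]_d.

Lemma test_function_continuous phi : test_function Om phi -> continuous phi.
Proof. by move=> [/(_ 0%N)[]]. Qed.

Lemma test_function_partial phi i : test_function Om phi ->
  (forall x, is_derive x (delta_mx ord0 i) phi (partial i phi x)) /\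
  continuous (partial i phi).
Proof.
move=> [/(_ 1%N)[_ /(_ i)[h1 [h2 _]]] _ _]; split => // x.
Qed.

Lemma test_function_out phi x : test_function Om phi ->
  ~ closure [set x | phi x != 0] x -> phi x = 0.
Proof.
move=> _ h; apply/eqP; apply: contrapT => /negP phix.
by apply: h; exact: subset_closure.
Qed.

Lemma partial_out phi i x : test_function Om phi ->
  ~ closure [set x | phi x != 0] x -> partial i phi x = 0.
Proof.
move=> tphi xS; rewrite /partial -[RHS](@derive_cst R _ _ (0 : R) x (delta_mx ord0 i)).
apply: near_eq_derive; have : open_nbhs x (~` closure [set x | phi x != 0]).
  by split => //; exact/closed_openC/closed_closure.
move=> /open_nbhs_nbhs; apply: filterS => y; exact: test_function_out.
Qed.

Hypothesis mOm : measurable Om.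
Hypothesis Om_fin : (lebesgue_rV R d Om < +oo)%E.

Lemma L2fun_compact_support K (f : 'rV[R]_d -> R) : continuous f -> compact K ->
  (forall x, ~ K x -> f x = 0) -> L2fun Om f.
Proof.
move=> cf cK fK; have [C fC] := continuous_compact_bounded cf cK fK.
have mf : measurable_fun Om f.
  by apply: measurable_funTS; exact: continuous_measurable_rV.
apply/L2funP; split => //; apply: measurable_bounded_integrable => //.
  exact: measurable_funX.
exists (C ^+ 2); split; first exact: num_real.
move=> r Cr x _ /=; rewrite normrX (le_trans _ (ltW Cr))//.
by rewrite lerXn2r ?nnegrE// (le_trans _ (fC x)).
Qed.

Lemma L2fun_test phi : test_function Om phi -> L2fun Om phi.
Proof.
move=> t; have [_ k _] := t; apply: (L2fun_compact_support _ k).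
  exact: test_function_continuous.
by move=> x; exact: test_function_out.
Qed.

Lemma L2fun_partial phi i : test_function Om phi -> L2fun Om (partial i phi).
Proof.
move=> t; have [_ k _] := t; apply: (L2fun_compact_support _ k).
  by have [] := test_function_partial i t.
by move=> x; exact: partial_out.
Qed.

Variable m : R.
Hypothesis Om_bounded : forall x, Om x -> forall i, `|x ord0 i| <= m.

(** The partial derivative of [phi * psi] integrates to 0 over the whole space, and everything
    vanishes outside [Om]. *)
Lemma test_function_ibp phi psi i : test_function Om phi -> test_function Om psi ->
  \int[lebesgue_rV R d]_(x in Om) (phi x * partial i psi x) =
  - \int[lebesgue_rV R d]_(x in Om) (partial i phi x * psi x).
Proof.
move=> tphi tpsi; have [_ _ sphi] := tphi; have [_ _ spsi] := tpsi.
have [dphi cphi'] := test_function_partial i tphi.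
have [dpsi cpsi'] := test_function_partial i tpsi.
have cphi := test_function_continuous tphi; have cpsi := test_function_continuous tpsi.
have phi0 x : ~ Om x -> phi x = 0.
  by move=> Ox; apply: test_function_out => // /sphi.
have psi0 x : ~ Om x -> psi x = 0.
  by move=> Ox; apply: test_function_out => // /spsi.
pose g x := phi x * partial i psi x + psi x * partial i phi x.
have g0 x : ~ Om x -> g x = 0.
  by move=> Ox; rewrite /g phi0// psi0// !mul0r addr0.
have out (x : 'rV[R]_d) j : m < `|x ord0 j| -> ~ Om x.
  by move=> mx Ox; have := Om_bounded Ox j; rewrite leNgt mx.
have := @integral_partial_eq0 R d m i (phi * psi) g.
have h1 x : is_derive x (delta_mx ord0 i) (phi * psi) (g x) by exact: is_deriveM.
have h2 : continuous g.
  move=> x; apply: (@continuousD _ R^o _ (phi * partial i psi)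
    (psi * partial i phi) x); apply: continuousM.
  - exact: cphi.
  - exact: cpsi'.
  - exact: cpsi.
  - exact: cphi'.
move=> /(_ h1 h2) h; have {}h := h _ _.
apply/eqP; rewrite -subr_eq0 opprK; apply/eqP.
have i1 := L2_integrableM mOm (L2fun_test tphi) (L2fun_partial i tpsi).
have i2 := L2_integrableM mOm (L2fun_partial i tphi) (L2fun_test tpsi).
rewrite -RintegralD//.
have -> : (fun x => phi x * partial i psi x + partial i phi x * psi x) = g.
  by apply/funext => x; rewrite /g [psi x * _]mulrC.
rewrite /Rintegral -[RHS]/(fine 0%E); congr fine; rewrite -[RHS]h.
- rewrite integral_mkcond; apply: eq_integral => x _; rewrite patchE.
  by case: ifPn => // /negP xO; rewrite g0// => Ox; apply: xO; rewrite inE.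
- by move=> x j mx; rewrite /= /GRing.mul /= phi0 ?mul0r//; exact: out mx.
- by move=> x j mx; apply: g0; exact: out mx.
Qed.

End test_functions.

(** * Linearity of the weak gradient and of H^1_0 *)

Section sobolev_lin.
Variables (R : realType) (d : nat) (Om : set 'rV[R]_d) (m : R).
Hypothesis oOm : open Om.
Hypothesis Om_bounded : forall x, Om x -> forall i, `|x ord0 i| <= m.
Local Notation mu := (lebesgue_rV R d).
Implicit Types (v w z : 'rV[R]_d -> R) (G H K : 'rV[R]_d -> 'rV[R]_d).

Let mOm : measurable Om := open_measurable_rV oOm.

Let Om_fin : (mu Om < +oo)%E := lebesgue_rV_bounded mOm Om_bounded.

Lemma weak_gradient_lin a v w G H : L2fun Om v -> L2fun Om w ->
  L2funv Om G -> L2funv Om H ->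
  weak_gradient Om v G -> weak_gradient Om w H ->
  weak_gradient Om (fun x => a * v x + w x) (fun x => a *: G x + H x).
Proof.
move=> v2 w2 G2 H2 vG wH phi tphi i.
have p2 := L2fun_test mOm Om_fin tphi; have d2 := L2fun_partial mOm Om_fin i tphi.
have := ip_linl mOm a v2 w2 d2; rewrite /ip => ->.
rewrite (vG _ tphi) (wH _ tphi) mulrN -opprD; congr (- _).
have := ip_linl mOm a (G2 i) (H2 i) p2; rewrite /ip => <-.
by apply: eq_Rintegral => x _; rewrite !mxE.
Qed.

(** [Om] has finite measure, so the constant 1 is square integrable and each component of G - H is
    integrable; it is orthogonal to all test functions, and the fundamental lemma applies. *)
Lemma weak_gradient_unique v G H : L2funv Om G -> L2funv Om H ->
  weak_gradient Om v G -> weak_gradient Om v H ->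
  forall i, {ae mu, forall x, Om x -> G x ord0 i = H x ord0 i}.
Proof.
move=> G2 H2 vG vH i.
have L2i z : L2fun Om z -> mu.-integrable Om (EFin \o z).
  move=> z2; have one2 : L2fun Om (cst 1).
    apply/L2funP; split; first exact: measurable_cst.
    apply: measurable_bounded_integrable => //; first exact: measurable_funX.
    exists 1; split; first exact: num_real.
    by move=> r r1 x _ /=; rewrite expr1n normr1 ltW.
  by have := L2_integrableM mOm z2 one2; apply: eq_integrable => // x _ /=; rewrite mulr1.
pose g x := (-1) * H x ord0 i + G x ord0 i.
have g2 : L2fun Om g by exact: L2fun_lin.
have : {ae mu, forall x, Om x -> g x = 0}.
  apply: (fundamental_lemma oOm (L2i _ g2)) => phi tphi.
  have p2 := L2fun_test mOm Om_fin tphi.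
  have := ip_linl mOm (-1) (H2 i) (G2 i) p2; rewrite /ip => ->.
  have := vG _ tphi i; rewrite (vH _ tphi i) => /oppr_inj ->.
  by rewrite mulN1r addNr.
by apply: filterS => x h Ox; have := h Ox; rewrite /g; lra.
Qed.

Lemma gradP v : H1 Om v -> L2funv Om (grad Om v) /\ weak_gradient Om v (grad Om v).
Proof.
move=> [_ [G hG]].
exact: (@xgetPex _ (fun=> 0) [set G | L2funv Om G /\ weak_gradient Om v G]
  (ex_intro _ G hG)).
Qed.

Lemma H1_lin a v w : H1 Om v -> H1 Om w -> H1 Om (fun x => a * v x + w x).
Proof.
move=> v1 w1; have [G2 vG] := gradP v1; have [H2 wH] := gradP w1.
have [v2 _] := v1; have [w2 _] := w1.
split; first exact: L2fun_lin.
exists (fun x => a *: grad Om v x + grad Om w x); split; first exact: L2funv_lin.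
exact: weak_gradient_lin.
Qed.

Lemma grad_lin a v w : H1 Om v -> H1 Om w -> forall i,
  {ae mu, forall x, Om x -> grad Om (fun x => a * v x + w x) x ord0 i =
     (a *: grad Om v x + grad Om w x) ord0 i}.
Proof.
move=> v1 w1; have [G2 vG] := gradP v1; have [H2 wH] := gradP w1.
have [v2 _] := v1; have [w2 _] := w1.
have [K2 zK] := gradP (H1_lin a v1 w1).
apply: weak_gradient_unique zK _ => //; first exact: L2funv_lin.
exact: weak_gradient_lin.
Qed.

Lemma ipv_grad_linl a v w G : H1 Om v -> H1 Om w -> L2funv Om G ->
  ipv Om (grad Om (fun x => a * v x + w x)) G =
  a * ipv Om (grad Om v) G + ipv Om (grad Om w) G.
Proof.
move=> v1 w1 G2; have [Gv _] := gradP v1; have [Gw _] := gradP w1.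
rewrite -ipv_linl//; apply: ipv_ae_eq => //.
- by have [] := gradP (H1_lin a v1 w1).
- exact: L2funv_lin.
- exact: grad_lin.
Qed.

Lemma H1_test phi : test_function Om phi -> H1 Om phi.
Proof.
move=> tphi; split; first exact: L2fun_test.
exists (fun x => \row_i partial i phi x); split.
  move=> i; rewrite (_ : (fun x => _) = partial i phi); first exact: L2fun_partial.
  by apply/funext => x; rewrite mxE.
move=> psi tpsi i; rewrite (test_function_ibp mOm Om_fin Om_bounded)//.
by congr (- _); apply: eq_Rintegral => x _; rewrite mxE.
Qed.

Definition H1sq v : R := ip Om v v + ipv Om (grad Om v) (grad Om v).

Lemma H1norm_lt v (e : R) : H1 Om v -> 0 < e ->
  (H1norm Om v < e%:E)%E = (H1sq v < e ^+ 2).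
Proof.
move=> v1 e0; have [v2 _] := v1; have [G2 _] := gradP v1.
rewrite /H1norm (L2norm_ip mOm v2) (L2normv_ipv mOm G2) -EFinD poweR_EFin lte_fin.
have q0 : 0 <= ip Om v v + ipv Om (grad Om v) (grad Om v).
  by rewrite addr_ge0 ?ip_ge0 ?ipv_ge0.
rewrite powR12_sqrt// -/(H1sq v) -[in RHS](@sqr_sqrtr _ (H1sq v))//.
by rewrite ltr_pXn2r// nnegrE ?sqrtr_ge0// ltW.
Qed.

Lemma H1sq_lin a v w : H1 Om v -> H1 Om w ->
  H1sq (fun x => a * v x + w x) <= 2 * a ^+ 2 * H1sq v + 2 * H1sq w.
Proof.
move=> v1 w1; have [v2 _] := v1; have [G2 _] := gradP v1.
have [w2 _] := w1; have [H2 _] := gradP w1.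
have expand b : H1sq (fun x => b * v x + w x) =
    b ^+ 2 * H1sq v + 2 * b * (ip Om v w + ipv Om (grad Om v) (grad Om w)) + H1sq w.
  have z1 := H1_lin b v1 w1; have [z2 _] := z1; have [K2 _] := gradP z1.
  set z := fun x => b * v x + w x.
  have e1 : ip Om v z = b * ip Om v v + ip Om w v.
    by rewrite ipC; exact: ip_linl.
  have e2 : ip Om w z = b * ip Om v w + ip Om w w.
    by rewrite ipC; exact: ip_linl.
  have e3 : ipv Om (grad Om v) (grad Om z) = b * ipv Om (grad Om v) (grad Om v) +
    ipv Om (grad Om w) (grad Om v).
    by rewrite ipvC; exact: ipv_grad_linl.
  have e4 : ipv Om (grad Om w) (grad Om z) = b * ipv Om (grad Om v) (grad Om w) +
    ipv Om (grad Om w) (grad Om w).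
    by rewrite ipvC; exact: ipv_grad_linl.
  rewrite /H1sq (ip_linl mOm b v2 w2 z2) (ipv_grad_linl b v1 w1 K2) e1 e2 e3 e4.
  rewrite (ipC Om w v) (ipvC Om (grad Om w) (grad Om v)).
  move: (ip Om v v) (ip Om v w) (ip Om w w) (ipv Om _ _) (ipv Om (grad Om v) (grad Om w)).
  by move: (ipv Om (grad Om w) _) => *; ring.
(* Adding the expansions at [a] and [- a] cancels the cross terms. *)
have : 0 <= H1sq (fun x => (- a) * v x + w x).
  by rewrite addr_ge0 ?ip_ge0 ?ipv_ge0.
rewrite !expand; move: (H1sq v) (H1sq w) (_ + ipv _ _ _) => *; lra.
Qed.

Lemma H10_lin a v w : H10 Om v -> H10 Om w -> H10 Om (fun x => a * v x + w x).
Proof.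
move=> [v1 hv] [w1 hw]; split; first exact: H1_lin.
(* Chosen so that 2 a^2 + 2 is at most s^2, to match the factors in [H1sq_lin]. *)
move=> e e0; pose s := 2 * (`|a| + 1).
have s0 : 0 < s by rewrite mulr_gt0// ltr_wpDl.
have es0 : 0 < e / s by rewrite divr_gt0.
have [phi [tphi hphi]] := hv _ es0; have [psi [tpsi hpsi]] := hw _ es0.
exists (fun x => a * phi x + psi x); split; first exact: test_function_lin.
have sub1 z chi : H1 Om z -> test_function Om chi -> H1 Om (fun x => z x - chi x).
  move=> z1 tchi; have := H1_lin (-1) (H1_test tchi) z1.
  by congr H1; apply/funext => x; rewrite mulN1r addrC.
have v'1 := sub1 _ _ v1 tphi; have w'1 := sub1 _ _ w1 tpsi.
have {}hphi := etrans (esym (H1norm_lt v'1 es0)) hphi.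
have {}hpsi := etrans (esym (H1norm_lt w'1 es0)) hpsi.
have eq_f : (fun x => a * v x + w x - (a * phi x + psi x)) =
    fun x => a * (v x - phi x) + (w x - psi x) by apply/funext => x; ring.
rewrite eq_f; apply: etrans (H1norm_lt (H1_lin a v'1 w'1) e0) _.
apply: le_lt_trans (H1sq_lin a v'1 w'1) _.
have -> : e ^+ 2 = s ^+ 2 * (e / s) ^+ 2 by field; rewrite gt_eqF.
have A0 : 0 <= H1sq (fun x => v x - phi x) by rewrite addr_ge0 ?ip_ge0 ?ipv_ge0.
move: (H1sq _) (H1sq (fun x => w x - psi x)) ((e / s) ^+ 2) A0 hphi hpsi => A B t A0 h1 h2.
have t0 : 0 < t by exact: le_lt_trans A0 h1.
rewrite /s -[a ^+ 2]real_normK ?num_real//; have := normr_ge0 a.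
move: `|a| => b b0.
have : 2 * b ^+ 2 * A <= 2 * b ^+ 2 * t.
  by rewrite ler_wpM2l ?mulr_ge0 ?sqr_ge0// ltW.
have := mulr_ge0 b0 (ltW t0); have := mulr_ge0 (mulr_ge0 b0 b0) (ltW t0).
by move: h2; rewrite !expr2; lra.
Qed.

Lemma H10_0 : H10 Om (fun=> 0).
Proof.
have z1 : H1 Om (fun=> 0) by apply: H1_test; exact: test_function0.
split => // e e0; exists (fun=> 0); split; first exact: test_function0.
rewrite (_ : (fun x => 0 - 0) = fun=> 0); last by apply/funext => x; rewrite subr0.
rewrite H1norm_lt//; apply: (@le_lt_trans _ _ 0); last by rewrite exprn_gt0.
have [z2 _] := z1; have [G2 _] := gradP z1.
(* The gradient of 0 is some representative, not visibly 0. Writing 0 as -1 * 0 + 0 lets linearity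
   show that its norm is 0. *)
have e0' : (fun x : 'rV[R]_d => -1 * 0 + 0 : R) = fun=> 0.
  by apply/funext => x; rewrite mulr0 addr0.
have := ip_linl mOm (-1) z2 z2 z2; have := ipv_grad_linl (-1) z1 z1 G2.
by rewrite e0' !mulN1r !addNr /H1sq => -> ->; rewrite addr0.
Qed.

(** The weak gradient condition sees [v] only under integrals over [Om]. Both choices are thus made
    from the same set, and the equality is exact, not merely almost everywhere. *)
Lemma grad_eq v w : (forall x, Om x -> v x = w x) -> grad Om v = grad Om w.
Proof.
move=> vw; rewrite /grad; congr (xget _); apply/seteqP; split => G [G2 wG];
  split => // phi tphi i; rewrite -(wG phi tphi i);
  by apply: eq_Rintegral => x /set_mem Ox; rewrite vw.
Qed.

End sobolev_lin.

(** * Polynomials on [0, 1] and positive semidefinite forms *)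

Section poly_integral.
Variable R : rcfType.
Implicit Types p r : {poly R}.

(* At [i = 0] the coefficient is [p`_0 / 0 = 0]. *)
Definition prim p : {poly R} := \poly_(i < (size p).+1) (p`_i.-1 / i%:R).

Lemma coef_prim p i : (prim p)`_i = p`_i.-1 / i%:R.
Proof.
rewrite coef_poly; case: ltnP => // pi; rewrite nth_default ?mul0r//.
by case: i pi.
Qed.

Lemma deriv_prim p : (prim p)^`() = p.
Proof.
apply/polyP => i; rewrite coef_deriv coef_prim /= -[LHS]mulr_natr -mulrA.
by rewrite mulVf ?mulr1// pnatr_eq0.
Qed.

Lemma prim0 p : (prim p).[0] = 0.
Proof. by rewrite horner_coef0 coef_prim invr0 mulr0. Qed.

Lemma primD p r : prim (p + r) = prim p + prim r.
Proof. by apply/polyP => i; rewrite coefD !coef_prim coefD mulrDl. Qed.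

Lemma primZ a p : prim (a *: p) = a *: prim p.
Proof. by apply/polyP => i; rewrite coefZ !coef_prim coefZ mulrA. Qed.

Lemma size_prim p k : (size p <= k)%N -> (size (prim p) <= k.+1)%N.
Proof. by move=> pk; apply: leq_trans (size_poly _ _) _. Qed.

Definition int01 p : R := (prim p).[1].

Lemma int01D p r : int01 (p + r) = int01 p + int01 r.
Proof. by rewrite /int01 primD hornerD. Qed.

Lemma int01Z a p : int01 (a *: p) = a * int01 p.
Proof. by rewrite /int01 primZ hornerZ. Qed.

Lemma int01_0 : int01 0 = 0.
Proof. by have := int01Z 0 0; rewrite scale0r mul0r. Qed.

Lemma int01N p : int01 (- p) = - int01 p.
Proof. by rewrite -scaleN1r int01Z mulN1r. Qed.

Lemma int01_sum (J : Type) (s : seq J) (P : pred J) (f : J -> {poly R}) :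
  int01 (\sum_(j <- s | P j) f j) = \sum_(j <- s | P j) int01 (f j).
Proof. by elim/big_rec2: _ => [|i y1 y2 _ <-]; rewrite ?int01_0 ?int01D. Qed.

Lemma deriv_eq0_const p : p^`() = 0 -> p = (p`_0)%:P.
Proof.
move=> dp; apply/polyP => -[|i]; rewrite coefC//=.
have := coef_deriv p i; rewrite dp coef0 => /esym/eqP.
by rewrite mulrn_eq0/= => /eqP.
Qed.

Lemma int01_deriv p : int01 p^`() = p.[1] - p.[0].
Proof.
rewrite /int01; have /deriv_eq0_const : (prim p^`() - p)^`() = 0.
  by rewrite derivB deriv_prim subrr.
move=> e; have := congr1 (horner^~ 1) e; have := congr1 (horner^~ 0) e.
rewrite !hornerE prim0 => <- /eqP; rewrite subr_eq => /eqP ->.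
by rewrite sub0r addrC.
Qed.

Lemma prim_homo p : (forall x, 0 <= x <= 1 -> 0 <= p.[x]) ->
  {in `[0, 1] &, {homo horner (prim p) : x y / x <= y}}.
Proof.
move=> p0; apply: ler_hornerW => x; rewrite deriv_prim in_itv/= => /andP[x0 x1].
by apply: p0; rewrite !ltW.
Qed.

Lemma int01_ge0 p : (forall x, 0 <= x <= 1 -> 0 <= p.[x]) -> 0 <= int01 p.
Proof.
move=> p0; rewrite /int01 -(prim0 p).
by apply: (prim_homo p0); rewrite ?in_itv/= ?lexx ?ler01.
Qed.

(** The primitive of p^2 is nondecreasing with equal end values, so it vanishes on [0, 1] and has
    more roots 1/(i+1) than its degree allows. *)
Lemma int01_sqr_eq0 p : int01 (p * p) = 0 -> p = 0.
Proof.
move=> pp0; have pp x : 0 <= x <= 1 -> 0 <= (p * p).[x].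
  by move=> _; rewrite hornerM -expr2 sqr_ge0.
have P0 x : 0 <= x <= 1 -> (prim (p * p)).[x] = 0.
  move=> /andP[x0 x1]; apply/le_anti/andP; split.
    by rewrite -[leRHS]pp0 (prim_homo pp) ?in_itv/= ?lexx ?ler01 ?x0 ?x1.
  by rewrite -[leLHS](prim0 (p * p)) (prim_homo pp) ?in_itv/= ?lexx ?ler01 ?x0 ?x1.
have : prim (p * p) = 0.
  apply/eqP; apply/negPn/negP => P_neq0.
  pose rs := [seq (i.+1%:R : R)^-1 | i <- iota 0 (size (prim (p * p)))].
  have /(_ rs) := max_poly_roots P_neq0.
  rewrite size_map size_iota ltnn => h; suff: false by [].
  apply: h; first apply/allP => _ /mapP[i _ ->].
    by apply/rootP/P0; rewrite invr_ge0 ler0n/= invf_le1 ?ltr0n// ler1n.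
  rewrite map_inj_uniq ?iota_uniq// => i j /invr_inj/eqP.
  by rewrite eqr_nat eqSS => /eqP.
move=> /(congr1 (@deriv _)); rewrite deriv_prim linear0 => /eqP.
by rewrite mulf_eq0 orbb => /eqP.
Qed.

Lemma poly_def_wide p k : (size p <= k)%N -> p = \sum_(i < k) p`_i *: 'X^i.
Proof.
move=> pk; rewrite -poly_def; apply/polyP => i; rewrite coef_poly.
by case: ltnP => // ki; rewrite nth_default// (leq_trans pk).
Qed.

(* The monomials of degree at most q are linearly independent for the L^2(0,1)
   inner product, so each coefficient functional has a Riesz representative. *)
Lemma coef_dual_poly q (k : nat) : (k <= q)%N ->
  exists d : {poly R}, [/\ (size d <= q.+1)%N, 0 < int01 (d * d) &
    forall p, (size p <= q.+1)%N -> int01 (d * p) = p`_k].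
Proof.
suff: (k <= q)%N -> exists d : {poly R}, (size d <= q.+1)%N /\
    forall p, (size p <= q.+1)%N -> int01 (d * p) = p`_k.
  move=> h kq; have [d [dq dP]] := h kq; exists d; split => //.
  rewrite lt_neqAle int01_ge0 ?andbT => [|x _]; last first.
    by rewrite hornerM -expr2 sqr_ge0.
  apply/eqP => /esym/int01_sqr_eq0 d0; have := dP 'X^k.
  rewrite d0 mul0r int01_0 size_polyXn ltnS coefXn eqxx => /(_ kq)/eqP.
  by rewrite eq_sym oner_eq0.
(* Gram matrix of the monomials. A kernel vector would be a polynomial of norm 0, so [H] is
   invertible, and a row of its inverse lists the coefficients of the dual polynomial. *)
rewrite -ltnS => kq; pose H : 'M[R]_q.+1 := \matrix_(i, j) int01 ('X^i * 'X^j).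
have rVE (u : 'rV[R]_q.+1) j : (u *m H) 0 j = int01 (rVpoly u * 'X^j).
  rewrite mxE [rVpoly u](@poly_def_wide _ q.+1) ?size_poly//.
  rewrite mulr_suml int01_sum; apply: eq_bigr => i _.
  by rewrite coef_rVpoly_ord !mxE -scalerAl int01Z.
have uH : H \in unitmx.
  rewrite -row_free_unit -kermx_eq0; apply/eqP/row_matrixP => i.
  set u := row i _; rewrite row0; have uH0 : u *m H = 0.
    by rewrite /u -row_mul mulmx_ker row0.
  suff : rVpoly u = 0.
    by move=> /(congr1 (@poly_rV _ q.+1)); rewrite rVpolyK linear0.
  apply: int01_sqr_eq0.
  rewrite {2}[rVpoly u](@poly_def_wide _ q.+1) ?size_poly//.
  rewrite mulr_sumr int01_sum big1// => j _.
  by rewrite -scalerAr int01Z -rVE uH0 mxE mulr0.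
pose u := row (Ordinal kq) (invmx H).
exists (rVpoly u); split; first exact: size_poly.
move=> p pq; rewrite {1}(poly_def_wide pq) mulr_sumr int01_sum.
rewrite (bigD1 (Ordinal kq))//= big1 ?addr0 => [|j jk].
  rewrite -scalerAr int01Z -(rVE _ (Ordinal kq)) /u -row_mul mulVmx//.
  by rewrite row1 mxE !eqxx mulr1.
rewrite -scalerAr int01Z -rVE /u -row_mul mulVmx// row1 mxE eqxx/=.
by rewrite (negbTE jk) mulr0.
Qed.

Definition coefsum p : R := \sum_(i < size p) `|p`_i|.

Lemma ler_horner_coefsum p x : 0 <= x <= 1 -> `|p.[x]| <= coefsum p.
Proof.
move=> /andP[x0 x1]; rewrite horner_coef (le_trans (ler_norm_sum _ _ _))//.
apply: ler_sum => i _; rewrite normrM ler_piMr// normrX ger0_norm//.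
exact: exprn_ile1.
Qed.

End poly_integral.

(** * Bilinear forms on coefficient vectors and on vectors of polynomials *)

Section form.
Variables (A : comNzRingType) (I : finType) (M : I -> I -> A).
Implicit Types c e f : I -> A.

(** Over a general commutative ring, because it is used twice: on real vectors at a fixed time, and
    as [pform] on vectors of polynomials in time. *)
Definition form c e : A := \sum_i \sum_j M i j * c i * e j.

Lemma formDl c e f :
  form (fun i => c i + e i) f = form c f + form e f.
Proof.
rewrite /form -big_split; apply: eq_bigr => i _ /=.
by rewrite -big_split; apply: eq_bigr => j _ /=; ring.
Qed.

Lemma formZl a c f : form (fun i => a * c i) f = a * form c f.
Proof.
rewrite /form mulr_sumr; apply: eq_bigr => i _ /=.
by rewrite mulr_sumr; apply: eq_bigr => j _ /=; ring.
Qed.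

Hypothesis M_sym : forall i j, M i j = M j i.

Lemma formC c e : form c e = form e c.
Proof.
rewrite /form exchange_big; apply: eq_bigr => i _; apply: eq_bigr => j _.
by rewrite M_sym; ring.
Qed.

Lemma formDr c e f :
  form f (fun i => c i + e i) = form f c + form f e.
Proof. by rewrite formC formDl !(formC _ f). Qed.

Lemma formZr a c f : form f (fun i => a * c i) = a * form f c.
Proof. by rewrite formC formZl formC. Qed.

Lemma form_lincomb a b c e : let f := fun i => a * c i + b * e i in
  form f f = a ^+ 2 * form c c + 2 * a * b * form c e + b ^+ 2 * form e e.
Proof.
rewrite /= formDl !formDr !formZl !formZr (formC e c); ring.
Qed.

End form.

Section psd_form.
Variables (R : realFieldType) (I : finType) (M : I -> I -> R).
Hypothesis M_sym : forall i j, M i j = M j i.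
Hypothesis M_psd : forall c, 0 <= form M c c.
Implicit Types c e f : I -> R.

(** Nonnegativity of the form at 2a c - e, divided by 4a. *)
Lemma form_young a c e : 0 < a ->
  form M c e <= a * form M c c + form M e e / (4 * a).
Proof.
move=> a0; have := M_psd (fun i => (2 * a) * c i + (-1) * e i).
rewrite form_lincomb// => h; rewrite -subr_ge0.
have -> : a * form M c c + form M e e / (4 * a) - form M c e =
  ((2 * a) ^+ 2 * form M c c + 2 * (2 * a) * -1 * form M c e +
     (-1) ^+ 2 * form M e e) / (4 * a) by field; rewrite gt_eqF.
by rewrite divr_ge0//; lra.
Qed.

Lemma form_add_le a b c e : let f := fun i => a * c i + b * e i in
  form M f f <= 2 * a ^+ 2 * form M c c + 2 * b ^+ 2 * form M e e.
Proof.
have := M_psd (fun i => a * c i + (- b) * e i).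
rewrite /= !form_lincomb//; lra.
Qed.

Lemma form_sum_le k (c : nat -> I -> R) :
  let f := fun i => \sum_(j < k) c j i in
  form M f f <= 2 ^+ k * \sum_(j < k) form M (c j) (c j).
Proof.
elim: k => [|k IH]/=.
  rewrite big_ord0 mulr0 (_ : form _ _ _ = 0)// /form big1// => i _.
  by apply: big1 => j _; rewrite !big_ord0 mulr0.
rewrite [X in form M X X](_ : _ =
    fun i => 1 * (\sum_(j < k) c j i) + 1 * c k i); last first.
  by apply/funext => i; rewrite big_ord_recr/= !mul1r.
rewrite (le_trans (form_add_le _ _ _ _))//= big_ord_recr/= !expr1n (exprS _ k).
have k1 : 1 <= 2 ^+ k :> R by rewrite exprn_ege1// ler1n.
have := ler_peMl (M_psd (c k)) k1; move: IH => /=.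
move: (form _ _ _) (form _ _ _) (\sum_(_ < k) _) (2 ^+ k) => a b s e; lra.
Qed.

End psd_form.

Section poly_form.
Variables (R : rcfType) (I : finType) (M : I -> I -> R).
Implicit Types P Q : I -> {poly R}.

Definition pform P Q : {poly R} := form (fun i j => (M i j)%:P) P Q.

Lemma horner_pform P Q x :
  (pform P Q).[x] = form M (fun i => (P i).[x]) (fun i => (Q i).[x]).
Proof.
rewrite horner_sum; apply: eq_bigr => i _; rewrite horner_sum.
by apply: eq_bigr => j _; rewrite !hornerE.
Qed.

Lemma deriv_pform P Q : (pform P Q)^`() =
  pform (fun i => (P i)^`()) Q + pform P (fun i => (Q i)^`()).
Proof.
rewrite /pform /form -big_split raddf_sum; apply: eq_bigr => i _ /=.
rewrite -big_split raddf_sum; apply: eq_bigr => j _ /=.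
by rewrite !poly.derivE; ring.
Qed.

Hypothesis M_sym : forall i j, M i j = M j i.

Let pM_sym i j : (M i j)%:P = (M j i)%:P.
Proof. by rewrite M_sym. Qed.

Lemma int01_pform_deriv P : let f x := fun i => (P i).[x] in
  int01 (pform (fun i => (P i)^`()) P) =
  2^-1 * (form M (f 1) (f 1) - form M (f 0) (f 0)).
Proof.
rewrite /= -!horner_pform -int01_deriv deriv_pform /pform.
rewrite [form _ P _]formC// int01D; lra.
Qed.

(** Integration by parts against 1 - theta, which is 1 at 0 and 0 at 1: only the left endpoint
    survives and the derivative of the weight yields the full integral. This is how the weighted
    test reaches the inside of a slab. *)
Lemma int01_pform_weight P : let f x := fun i => (P i).[x] in
  int01 ((1 - 'X) * pform (fun i => (P i)^`()) P) =
  2^-1 * (int01 (pform P P) - form M (f 0) (f 0)).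
Proof.
rewrite /= -!horner_pform; have := int01_deriv ((1 - 'X) * pform P P).
rewrite derivM deriv_pform !poly.derivE !int01D !hornerM.
rewrite !hornerD !hornerN !hornerX !hornerC subrr mul0r subr0 mul1r.
rewrite [X in _ * (_ + X)]formC// -/(pform _ _) mulrDr int01D sub0r mulN1r.
by rewrite int01N; lra.
Qed.

Hypothesis M_psd : forall c, 0 <= form M c c.

Lemma int01_pform_ge0 P : 0 <= int01 (pform P P).
Proof. by apply: int01_ge0 => x _; rewrite horner_pform. Qed.

(** Bessel's inequality: the integrated form is nonnegative at P minus its component y d / K along
    [d], with K the squared norm of [d]. *)
Lemma form_coef_le q k (d : {poly R}) P : 0 < int01 (d * d) ->
  (forall p : {poly R}, (size p <= q.+1)%N -> int01 (d * p) = p`_k) ->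
  (forall i, (size (P i) <= q.+1)%N) ->
  let y := fun i => (P i)`_k in
  form M y y <= int01 (d * d) * int01 (pform P P).
Proof.
move=> d0 dP Pq /=; set y := fun i => _; set K := int01 (d * d); pose Y i := (y i)%:P.
have dPY : int01 (d * pform P Y) = form M y y.
  rewrite dP.
    rewrite coef_sum; apply: eq_bigr => i _; rewrite coef_sum.
    by apply: eq_bigr => j _; rewrite coefMC coefCM.
  apply: (leq_trans (size_sum _ _ _)); apply/bigmax_leqP => i _.
  apply: (leq_trans (size_sum _ _ _)); apply/bigmax_leqP => j _.
  rewrite mulrAC -polyCM mul_polyC; exact: leq_trans (size_scale_leq _ _) _.
have := int01_pform_ge0 (fun i => 1 * P i + (- K^-1 *: d) * Y i).
rewrite /pform form_lincomb// -/(pform P P) -/(pform P Y) -/(pform Y Y).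
have -> : pform Y Y = (form M y y)%:P.
  rewrite /form rmorph_sum; apply: eq_bigr => i _; rewrite rmorph_sum.
  by apply: eq_bigr => j _; rewrite !rmorphM.
rewrite expr1n mul1r mulr1 expr2.
have -> : 2 * (- K^-1 *: d) * pform P Y = (- 2 * K^-1) *: (d * pform P Y).
  by rewrite -!mul_polyC !rmorphM !rmorphN /=; ring.
have -> : (- K^-1 *: d) * (- K^-1 *: d) * (form M y y)%:P =
    (K^-1 * K^-1 * form M y y) *: (d * d).
  by rewrite -!mul_polyC !rmorphM !rmorphN /=; ring.
rewrite !int01D !int01Z -/K dPY => h.
rewrite -ler_pdivrMl//.
have K0 : K != 0 by rewrite gt_eqF.
have e : K^-1 * K^-1 * form M y y * K = K^-1 * form M y y by field.
by move: h; rewrite e; lra.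
Qed.

(** Inverse inequality in time. The value at a point of [0, 1] is a combination of q + 1
    coefficients with weights at most 1; the power of 2 comes from [form_sum_le]. *)
Lemma form_horner_le q (Kq : R) :
  (forall k, (k <= q)%N -> forall P, (forall i, (size (P i) <= q.+1)%N) ->
    let y := fun i => (P i)`_k in form M y y <= Kq * int01 (pform P P)) ->
  forall P x, 0 <= x <= 1 -> (forall i, (size (P i) <= q.+1)%N) ->
  let y := fun i => (P i).[x] in
  form M y y <= 2 ^+ q.+1 * q.+1%:R * Kq * int01 (pform P P).
Proof.
move=> hK P x /andP[x0 x1] Pq /=.
have -> : (fun i => (P i).[x]) = fun i => \sum_(j < q.+1) x ^+ j * (P i)`_j.
  apply/funext => i; rewrite (horner_coef_wide _ (Pq i)).
  by apply: eq_bigr => j _; rewrite mulrC.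
apply: (le_trans (form_sum_le M_sym M_psd q.+1 (fun j i => x ^+ j * (P i)`_j))).
rewrite -!mulrA ler_wpM2l ?exprn_ge0//.
rewrite [leRHS](_ : _ = \sum_(j < q.+1) (Kq * int01 (pform P P))); last first.
  by rewrite sumr_const card_ord mulr_natl.
apply: ler_sum => j _; rewrite formZl formZr// mulrA.
have := hK j (ltn_ord j) P Pq; apply: le_trans.
by rewrite ler_piMl// -expr2 exprn_ile1// ?exprn_ge0// exprn_ile1.
Qed.

End poly_form.

(** * Stability of the time discretization *)

Lemma leq_size_deriv (R : nzSemiRingType) (p : {poly R}) k :
  (size p <= k)%N -> (size p^`() <= k.-1)%N.
Proof.
by move=> pk; apply: leq_trans (size_poly _ _) _; rewrite -!subn1 leq_sub2r.
Qed.

Lemma young_sqrt (R : rcfType) (a F x : R) : 0 < a -> 0 <= x ->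
  F * Num.sqrt x <= a * F ^+ 2 + x / (4 * a).
Proof.
move=> a0 x0; rewrite -{2}(sqr_sqrtr x0); set s := Num.sqrt x.
rewrite -subr_ge0 (_ : _ - _ = (2 * a * F - s) ^+ 2 / (4 * a)).
  by rewrite divr_ge0 ?sqr_ge0//; lra.
by field; rewrite gt_eqF.
Qed.

(** The sum over [k] of the squared norms of the dual polynomials bounds each of them. It is fixed
    before the index set and the form, so it depends on [q] only. *)
Lemma form_coef_bound (R : rcfType) (q : nat) : exists K : R, 0 < K /\
  forall (I : finType) (M : I -> I -> R), (forall i j, M i j = M j i) ->
  (forall c, 0 <= form M c c) ->
  forall k, (k <= q)%N -> forall P : I -> {poly R},
  (forall i, (size (P i) <= q.+1)%N) ->
  let y := fun i => (P i)`_k in form M y y <= K * int01 (pform M P P).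
Proof.
have /choice[d dP] : forall k : 'I_q.+1, exists d : {poly R},
    [/\ (size d <= q.+1)%N, 0 < int01 (d * d) &
    forall p : {poly R}, (size p <= q.+1)%N -> int01 (d * p) = p`_k].
  by move=> k; apply: coef_dual_poly; rewrite -ltnS.
have d_ge0 k : 0 <= int01 (d k * d k) by have [_ /ltW] := dP k.
exists (\sum_k int01 (d k * d k)); split.
  rewrite (bigD1 ord0)//= ltr_pwDl//; first by have [] := dP ord0.
  exact: sumr_ge0.
move=> I M Ms Mp k; rewrite -ltnS => kq P Pq /=.
have [_ dk dkP] := dP (Ordinal kq).
rewrite (le_trans (form_coef_le Ms Mp dk dkP Pq))// ler_wpM2r ?int01_pform_ge0//.
by rewrite (bigD1 (Ordinal kq))//= lerDl sumr_ge0.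
Qed.

Section slab_form.
Variables (R : rcfType) (I : finType) (M A : I -> I -> R).
Implicit Types (X W : I -> {poly R}).

Definition pderiv X i := (X i)^`().

Definition peval X (x : R) i := (X i).[x].

(* The contribution of one time slab to the bilinear form, in the variable
   theta = (s - t_n) / tau running over [0, 1]; jv and ju are the jumps of the
   velocity and of the displacement at theta = 0. *)
Definition slab_form (tau : R) (jv ju : I -> R) X W : R :=
  tau^-1 ^+ 2 * int01 (pform M (pderiv (pderiv X)) (pderiv W))
  + form M jv (fun i => tau^-1 * peval (pderiv W) 0 i)
  + int01 (pform A X (pderiv W))
  + form A ju (peval W 0).

End slab_form.

(** * The estimate inside a single slab *)

Section local_estimate.
Variables (R : rcfType) (q : nat) (K : R) (d : {poly R}).
Hypothesis q_gt0 : (0 < q)%N.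
Hypothesis K_gt0 : 0 < K.
Hypothesis size_d : (size d <= q.+1)%N.
Hypothesis d_dual : forall p : {poly R}, (size p <= q.+1)%N -> int01 (d * p) = p`_q.
Variables (I : finType) (M A : I -> I -> R).
Hypothesis M_sym : forall i j, M i j = M j i.
Hypothesis A_sym : forall i j, A i j = A j i.
Hypothesis M_psd : forall c, 0 <= form M c c.
Hypothesis A_psd : forall c, 0 <= form A c c.
Hypothesis M_coef : forall k, (k <= q)%N -> forall P : I -> {poly R},
  (forall i, (size (P i) <= q.+1)%N) ->
  let y := fun i => (P i)`_k in form M y y <= K * int01 (pform M P P).
Variables (tau : R) (X : I -> {poly R}).
Hypothesis tau_gt0 : 0 < tau.
Hypothesis size_X : forall i, (size (X i) <= q.+1)%N.
Hypothesis dd_gt0 : 0 < int01 (d * d).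

(** [d] is a multiple of the shifted Legendre polynomial of degree [q]; by duality with itself its
    leading coefficient is its squared norm. *)
Let L := d`_q.

Let L_gt0 : 0 < L. Proof. by rewrite /L -d_dual. Qed.

(** Chosen so that adding y d cancels the coefficient of degree [q] in (1 - theta) X', which is -q
    times that of X. *)
Let y i : R := q%:R * (X i)`_q / L.

(* (1 - theta) X' minus its component of degree q along d, that is, its L^2
   projection onto the polynomials of degree less than q *)
Definition slab_dtest i : {poly R} := (1 - 'X) * (X i)^`() + y i *: d.

Definition slab_test i : {poly R} := prim (slab_dtest i).

Let size_dX i : (size (X i)^`() <= q)%N.
Proof. exact: (leq_size_deriv (size_X i)). Qed.

(** The degree [q] part of [slab_dtest] cancels, so its primitive has degree at most [q] and is an
    admissible test function. *)
Lemma size_slab_test i : (size (slab_test i) <= q.+1)%N.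
Proof.
apply: size_prim; apply/leq_sizeP => j; rewrite leq_eqVlt => /predU1P[<-|qj].
  rewrite coefD coefZ mulrBl mul1r coefB coefXM -/L mulfVK ?gt_eqF//.
  rewrite [(X i)^`()`_q]nth_default// coef_deriv.
  by rewrite prednK// mulr_natl; ring.
rewrite coefD coefZ mulrBl mul1r coefB coefXM.
rewrite [d`_j]nth_default ?(leq_trans size_d)// mulr0 addr0.
have -> : (X i)^`()`_j = 0.
  by rewrite nth_default//; exact: leq_trans (size_dX i) (ltnW qj).
have -> : (X i)^`()`_j.-1 = 0; last by rewrite if_same subrr.
by rewrite nth_default//; apply: leq_trans (size_dX i) _; case: j qj.
Qed.

Lemma deriv_slab_test i : (slab_test i)^`() = slab_dtest i.
Proof. exact: deriv_prim. Qed.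

Lemma slab_test0 : peval slab_test 0 = fun=> 0.
Proof. by apply/funext => i; rewrite /peval prim0. Qed.

Let V i : {poly R} := tau^-1 *: (X i)^`().
Let I0 := int01 (pform M V V).
Let Ia := int01 (pform A X X).
Let v0 := peval V 0.

Let pformVV : pform M V V = tau^-1 ^+ 2 *: pform M (pderiv X) (pderiv X).
Proof.
have VE : V = fun i => tau^-1%:P * pderiv X i.
  by apply/funext => i; rewrite /V mul_polyC.
rewrite VE /pform formZl formZr; last by move=> i j; rewrite M_sym.
by rewrite mulrA -polyCM mul_polyC -expr2.
Qed.

Let pform_dtest (B : I -> I -> R) (P : I -> {poly R}) :
  (forall i j, B i j = B j i) ->
  pform B P slab_dtest =
  (1 - 'X) * pform B P (pderiv X) + d * pform B P (fun i => (y i)%:P).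
Proof.
move=> Bs; have Bs' i j : (B i j)%:P = (B j i)%:P by rewrite Bs.
rewrite /pform -!formZr// -formDr//; congr form; apply/funext => i.
by rewrite /slab_dtest -mul_polyC [d * _]mulrC.
Qed.

Let dual_pform (B : I -> I -> R) (P : I -> {poly R}) :
  (forall i, (size (P i) <= q.+1)%N) ->
  int01 (d * pform B P (fun i => (y i)%:P)) = form B (fun i => (P i)`_q) y.
Proof.
move=> Pq; rewrite d_dual.
  rewrite coef_sum; apply: eq_bigr => i _; rewrite coef_sum.
  by apply: eq_bigr => j _; rewrite coefMC coefCM.
apply: (leq_trans (size_sum _ _ _)); apply/bigmax_leqP => i _.
apply: (leq_trans (size_sum _ _ _)); apply/bigmax_leqP => j _.
rewrite mulrAC -polyCM mul_polyC; exact: leq_trans (size_scale_leq _ _) _.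
Qed.

(** The displacement jump drops because the test vanishes at 0. The part along [d] drops against
    X'', whose coefficient of degree [q] is 0, and against X it produces the last, nonnegative
    term. *)
Lemma slab_form_test (jv ju : I -> R) :
  slab_form M A tau jv ju X slab_test =
  2^-1 * (I0 - form M v0 v0)
  + form M jv (fun i => tau^-1 * peval slab_dtest 0 i)
  + 2^-1 * (Ia - form A (peval X 0) (peval X 0))
  + q%:R / L * form A (fun i => (X i)`_q) (fun i => (X i)`_q).
Proof.
have dW : pderiv slab_test = slab_dtest.
  by apply/funext => i; exact: deriv_slab_test.
rewrite /slab_form dW slab_test0.
have -> : form A ju (fun=> 0) = 0.
  by rewrite /form big1// => i _; rewrite big1// => j _; rewrite mulr0.
rewrite addr0 -!addrA; congr (_ + (_ + _)).
  rewrite pform_dtest// int01D dual_pform; last first.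
    move=> i; apply: leq_trans (leq_size_deriv (size_dX i)) _.
    by rewrite (leq_trans (leq_pred _)).
  have -> : form M (fun i => (pderiv (pderiv X) i)`_q) y = 0.
    rewrite /form big1// => i _; rewrite big1// => j _.
    rewrite /pderiv nth_default ?mulr0 ?mul0r//.
    by apply: leq_trans (leq_size_deriv (size_dX i)) (leq_pred _).
  rewrite addr0 int01_pform_weight// /I0 pformVV int01Z.
  have -> : v0 = fun i => tau^-1 * peval (pderiv X) 0 i.
    by apply/funext => i; rewrite /v0 /peval hornerZ.
  by rewrite formZl formZr// /peval; lra.
rewrite pform_dtest// int01D dual_pform//; congr (_ + _).
  rewrite [pform _ _ _]formC ?int01_pform_weight// => i j.
  by rewrite A_sym.
have -> : y = fun i => (q%:R / L) * (X i)`_q.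
  by apply/funext => i; rewrite /y mulrAC.
by rewrite formZr.
Qed.

(** [K'] is the constant of the inverse inequality. [K2] bounds the velocity of the test function:
    [K'] for the weighted velocity, the other term for the correction along [d], each doubled by
    [form_add_le]. *)
Let K' := 2 ^+ q.+1 * q.+1%:R * K.
Let K2 := 2 * K' + 2 * (coefsum d / L) ^+ 2 * K.

Let size_V i : (size (V i) <= q.+1)%N.
Proof. by rewrite (leq_trans (size_scale_leq _ _))// ltnW// ltnS. Qed.

(** The leading coefficient q X_q / tau of the velocity. As y / tau = w / L, the correction is
    bounded by the velocity alone, uniformly in tau. *)
Let w := fun i => (V i)`_q.-1.

Let dtestE x : (fun i => tau^-1 * peval slab_dtest x i) =
  fun i => (1 - x) * peval V x i + (d.[x] / L) * w i.
Proof.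
apply/funext => i; rewrite /peval /w /slab_dtest /V !hornerZ hornerD hornerM.
rewrite hornerZ hornerD hornerN hornerX hornerC coefZ coef_deriv.
by rewrite prednK// /y -[(X i)`_q *+ q]mulr_natl; ring.
Qed.

Let w_le : form M w w <= K * I0.
Proof. by apply: M_coef => //; exact: leq_pred. Qed.

Lemma slab_test_bound x : 0 <= x <= 1 ->
  form M (fun i => tau^-1 * peval slab_dtest x i)
         (fun i => tau^-1 * peval slab_dtest x i) <= K2 * I0.
Proof.
move=> x01; rewrite dtestE (le_trans (form_add_le M_sym M_psd _ _ _ _))//.
have h1 : form M (peval V x) (peval V x) <= K' * I0.
  by apply: (form_horner_le M_sym M_psd M_coef).
have h2 : (1 - x) ^+ 2 <= 1 by move: x01 => /andP[]; nra.
have h3 : (d.[x] / L) ^+ 2 <= (coefsum d / L) ^+ 2.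
  have c0 : 0 <= coefsum d by rewrite sumr_ge0.
  rewrite -[leLHS]real_normK ?num_real// lerXn2r ?nnegrE ?divr_ge0 ?(ltW L_gt0)//.
  by rewrite normrM normfV (gtr0_norm L_gt0) ler_pM2r ?invr_gt0// ler_horner_coefsum.
have m1 := M_psd (peval V x); have m2 := M_psd w.
rewrite /K2 [leRHS]mulrDl; apply: lerD.
  rewrite -[leLHS]mulrA -[leRHS]mulrA ler_pM2l//.
  by rewrite (le_trans _ h1)// ler_piMl.
by rewrite -[leLHS]mulrA -[leRHS]mulrA -[2 * _ * (K * I0)]mulrA ler_pM2l// ler_pM// sqr_ge0.
Qed.

(** The test provides I0/2. Young's inequality spends I0/8 on the source, at cost 2 K2 F^2, and I0/8
    on the velocity jump paired with [w], at cost 2 K (d(0)/L)^2 times the squared jump. The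
    remaining I0/4 explains the factor 4. *)
Definition local_const := 4 * (1 + 2 * K * (d.[0] / L) ^+ 2 + 2 * K2).

Lemma slab_estimate (jv ju : I -> R) (F : R) : 0 <= F ->
  (forall S, 0 <= S -> (forall x, 0 <= x <= 1 ->
     form M (fun i => tau^-1 * peval slab_dtest x i)
            (fun i => tau^-1 * peval slab_dtest x i) <= S ^+ 2) ->
     slab_form M A tau jv ju X slab_test <= F * S) ->
  I0 + Ia <= local_const *
    (form M v0 v0 + form A (peval X 0) (peval X 0) + form M jv jv + F ^+ 2).
Proof.
move=> F0 h; have K2_gt0 : 0 < K2.
  apply: ltr_pwDl; first by rewrite /K' !mulr_gt0 ?exprn_gt0 ?ltr0n.
  exact: mulr_ge0 (mulr_ge0 (ler0n R 2) (sqr_ge0 _)) (ltW K_gt0).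
have I0_ge0 : 0 <= I0 by exact: int01_pform_ge0.
have := h (Num.sqrt (K2 * I0)) (sqrtr_ge0 _).
rewrite sqr_sqrtr; last exact: mulr_ge0 (ltW K2_gt0) I0_ge0.
move=> /(_ slab_test_bound).
rewrite slab_form_test dtestE subr0.
have := young_sqrt F (mulr_gt0 (ltr0Sn R 1) K2_gt0) (mulr_ge0 (ltW K2_gt0) I0_ge0).
have -> : K2 * I0 / (4 * (2 * K2)) = I0 / 8 by field; rewrite gt_eqF.
set s := F * _ => hs.
rewrite formDr// formZr// formZr// mul1r.
have := @form_young _ _ _ M_sym M_psd 2^-1 (fun i => -1 * jv i) v0.
rewrite invr_gt0 => /(_ (ltr0Sn _ _)); rewrite !formZl formZr//.
have := @form_young _ _ _ M_sym M_psd (2 * K) (fun i => (- (d.[0] / L)) * jv i) w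
 (mulr_gt0 (ltr0Sn R 1) K_gt0).
rewrite !formZl formZr//.
have : form M w w / (4 * (2 * K)) <= I0 / 8.
  by rewrite ler_pdivrMr ?mulr_gt0//; move: w_le; lra.
have : 0 <= q%:R / L * form A (fun i => (X i)`_q) (fun i => (X i)`_q).
  by rewrite mulr_ge0// divr_ge0// ltW.
have Ia0 : 0 <= Ia by exact: int01_pform_ge0.
have := M_psd jv; have := M_psd v0; have := A_psd (peval X 0).
rewrite -/v0 /local_const.
have : 0 <= 2 * K * (d.[0] / L) ^+ 2.
  exact: mulr_ge0 (mulr_ge0 (ler0n R 2) (ltW K_gt0)) (sqr_ge0 _).
have := sqr_ge0 F.
move: (form A (peval X 0) _) (form M v0 v0) (form M jv v0) (form M jv jv)
  (form M jv w) (form M w w) (q%:R / L * _) (d.[0] / L) => a b c e f g j l.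
move: (g / _) K2_gt0 (sqr_ge0 F); set t := 2 * K * l ^+ 2.
rewrite (_ : 2 * K * (- l * (- l * e)) = t * e); last by rewrite /t; ring.
move: (F ^+ 2) hs => f2 hs G K2_gt0 f20 _ t0 a0 b0 e0 j0 h1 h2 h3 h4.
have k0 := ltW K2_gt0.
have := mulr_ge0 t0 a0; have := mulr_ge0 t0 b0; have := mulr_ge0 t0 f20.
have := mulr_ge0 k0 a0; have := mulr_ge0 k0 b0; have := mulr_ge0 k0 e0.
by move: h1 h2 h3 h4 hs; lra.
Qed.

End local_estimate.

(** * The energy identity over several slabs *)

Section global_form.
Variables (R : rcfType) (I : finType) (M A : I -> I -> R).
Variables (N : nat) (tau : nat -> R).
Implicit Types (X W : nat -> I -> {poly R}).

Definition vel X n (x : R) i := (tau n)^-1 * peval (pderiv (X n)) x i.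

(** At [n = 0] the state before the slab is 0, so the initial terms of the bilinear form and of the
    jump seminorm count as jumps. *)
Definition vjump X n i := vel X n 0 i - (if n is k.+1 then vel X k 1 i else 0).

Definition ujump X n i :=
  peval (X n) 0 i - (if n is k.+1 then peval (X k) 1 i else 0).

Definition dg_form X W : R :=
  \sum_(n < N) slab_form M A (tau n) (vjump X n) (ujump X n) (X n) (W n).

Hypothesis M_sym : forall i j, M i j = M j i.
Hypothesis A_sym : forall i j, A i j = A j i.

Definition energy X n := form M (vel X n 1) (vel X n 1) +
                  form A (peval (X n) 1) (peval (X n) 1).

Definition jumps X n := form M (vjump X n) (vjump X n) +
                        form A (ujump X n) (ujump X n).

Lemma slab_form0 tau' jv ju Y : slab_form M A tau' jv ju Y (fun=> 0) = 0.
Proof.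
rewrite /slab_form.
have p0 : pderiv (fun=> 0 : {poly R}) = (fun=> 0 : {poly R}) :> (I -> _).
  by apply/funext => i; rewrite /pderiv linear0.
have f0 (B : I -> I -> R) c (e : I -> R) : e = (fun=> 0) -> form B c e = 0.
  by move=> ->; rewrite /form big1// => i _; rewrite big1// => j _; rewrite mulr0.
have q0 (B : I -> I -> R) P : pform B P (fun=> 0) = 0.
  by rewrite /pform /form big1// => i _; rewrite big1// => j _; rewrite mulr0.
rewrite p0 !q0 int01_0 !f0 ?mulr0 ?addr0//; apply/funext => i;
  by rewrite /peval horner0 ?mulr0.
Qed.

(** Pairing a jump with the right trace gives half of right trace squared plus jump squared minus
    left trace squared; the right trace cancels the lower endpoint of the slab integral. *)
Lemma slab_energy X n :
  slab_form M A (tau n) (vjump X n) (ujump X n) (X n) (X n) =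
  2^-1 * (energy X n - (if n is k.+1 then energy X k else 0) + jumps X n).
Proof.
have formB B (c e : I -> R) : (forall i j, B i j = B j i) ->
    form B (fun i => c i - e i) c =
    2^-1 * (form B c c + form B (fun i => c i - e i) (fun i => c i - e i)
            - form B e e).
  move=> Bs; rewrite (_ : (fun i => c i - e i) = fun i => 1 * c i + (-1) * e i).
    by rewrite form_lincomb// formDl !formZl// (formC Bs e c); lra.
  by apply/funext => i; rewrite mul1r mulN1r.
have form0 B : form B (fun=> 0) (fun=> 0) = 0 :> R.
  by rewrite /form big1// => i _; rewrite big1// => j _; rewrite mulr0.
rewrite /slab_form (int01_pform_deriv M_sym) /=.
rewrite [pform A _ _]formC; last by move=> i j; rewrite A_sym.
rewrite -/(pform _ _ _) (int01_pform_deriv A_sym)/=.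
have velE x : form M (vel X n x) (vel X n x) = (tau n)^-1 ^+ 2 *
  form M (peval (pderiv (X n)) x) (peval (pderiv (X n)) x).
  by rewrite /vel formZl formZr// mulrA -expr2.
rewrite -/(vel X n 0) /vjump /ujump (formB M)// (formB A)//.
rewrite -/(peval (X n) _) -/(peval (pderiv (X n)) _).
rewrite /energy /jumps !velE.
case: n velE => [|k] velE; last by rewrite /vjump /ujump; lra.
by rewrite !form0 /vjump /ujump; lra.
Qed.

(** The solution cut off after slab [k] is admissible because nothing ties the slabs together, and
    the energies telescope. *)
Lemma dg_energy X k : (k < N)%N ->
  dg_form X (fun n i => if (n <= k)%N then X n i else 0) =
  2^-1 * (energy X k + \sum_(n < k.+1) jumps X n).
Proof.
move=> kN; rewrite /dg_form.
rewrite -(big_mkord xpredT (fun n => slab_form M A (tau n) (vjump X n)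
  (ujump X n) (X n) (fun i => if (n <= k)%N then X n i else 0))).
rewrite (big_cat_nat _ (n := k.+1))//= [X in _ + X = _]big_nat_cond.
rewrite [X in _ + X = _]big1 ?addr0; last first.
  by move=> n; rewrite andbT => /andP[kn _]; rewrite leqNgt kn/= slab_form0.
rewrite big_nat_cond (eq_bigr (fun n => 2^-1 * (energy X n -
  (if n is k.+1 then energy X k else 0) + jumps X n))); last first.
  by move=> n /=; rewrite ?andbT ltnS => nk; rewrite nk slab_energy.
rewrite -big_nat_cond -mulr_sumr big_mkord; congr (_ * _).
rewrite big_split/=; congr (_ + _).
elim: k kN => [|k IH] kN; first by rewrite big_ord1 subr0.
by rewrite big_ord_recr/= IH ?(ltnW kN)// addrC subrK.
Qed.

End global_form.

Lemma dg_form_slab (R : rcfType) (I : finType) (M A : I -> I -> R) N tau X k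
    (W : I -> {poly R}) : (k < N)%N ->
  dg_form M A N tau X (fun n i => if n == k then W i else 0) =
  slab_form M A (tau k) (vjump tau X k) (ujump X k) (X k) W.
Proof.
move=> kN; rewrite /dg_form (bigD1 (Ordinal kN))//= eqxx big1 ?addr0// => n nk.
have /negbTE -> : val n != k by [].
by rewrite slab_form0.
Qed.

(** Of the right-hand side only this is kept: [F] weighs the velocity of the test function and [D]
    its initial displacement in the form [A]. [C] is chosen before all other data, so it depends on
    [q] only. *)
Lemma dg_stability (R : realType) (q : nat) : (0 < q)%N ->
  exists C : R, 0 < C /\
  forall (I : finType) (M A : I -> I -> R) (N : nat) (tau : nat -> R)
    (X : nat -> I -> {poly R}) (F D : R),
  (forall i j, M i j = M j i) -> (forall i j, A i j = A j i) ->
  (forall c, 0 <= form M c c) -> (forall c, 0 <= form A c c) ->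
  (forall n, (n < N)%N -> 0 < tau n) ->
  (forall n i, (size (X n i) <= q.+1)%N) -> 0 <= F -> 0 <= D ->
  (forall (W : nat -> I -> {poly R}) (S Su : R),
     (forall n i, (size (W n i) <= q.+1)%N) -> 0 < S -> 0 <= Su ->
     (forall n (x : R), (n < N)%N -> 0 <= x <= 1 ->
        form M (vel tau W n x) (vel tau W n x) <= S ^+ 2) ->
     form A (peval (W 0%N) 0) (peval (W 0%N) 0) <= Su ^+ 2 ->
     dg_form M A N tau X W <= F * S + D * Su) ->
  (forall n (x : R), (n < N)%N -> 0 <= x <= 1 ->
     form M (vel tau X n x) (vel tau X n x) <= C * (F ^+ 2 + D ^+ 2) /\
     form A (peval (X n) x) (peval (X n) x) <= C * (F ^+ 2 + D ^+ 2)) /\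
  (forall k, (k < N)%N ->
    energy M A tau X k + \sum_(n < k.+1) jumps M A tau X n <=
    C * (F ^+ 2 + D ^+ 2)).
Proof.
move=> q0; have [K [K0 KP]] := form_coef_bound R q.
have [d [dq dd0 dP]] := @coef_dual_poly R q q (leqnn q).
pose C1 := local_const q K d; pose K' := 2 ^+ q.+1 * q.+1%:R * K.
have C1_ge4 : 4 <= C1.
  rewrite /C1 /local_const.
  have h1 : 0 <= 2 * K * (d.[0] / d`_q) ^+ 2.
    exact: mulr_ge0 (mulr_ge0 (ler0n R 2) (ltW K0)) (sqr_ge0 _).
  have h2 : 0 <= 2 * (coefsum d / d`_q) ^+ 2 * K.
    exact: mulr_ge0 (mulr_ge0 (ler0n R 2) (sqr_ge0 _)) (ltW K0).
  have h3 : 0 <= 2 ^+ q.+1 * q.+1%:R * K.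
    by rewrite !mulr_ge0 ?exprn_ge0 ?ler0n// ltW.
  by move: h1 h2 h3; lra.
have K'_gt0 : 0 < K' by rewrite /K' !mulr_gt0 ?exprn_gt0 ?ltr0n.
(* The absorption below gives g at most (400 C1^2 K' + 2 C1) F^2 + 40 C1 D^2; [C2] dominates both
   coefficients. *)
pose C2 := (36 * C1) ^+ 2 * K' + 72 * C1.
have C2_gt0 : 0 < C2.
  by have := mulr_ge0 (sqr_ge0 (36 * C1)) (ltW K'_gt0); rewrite /C2; lra.
have KC_gt0 : 0 < K' * C2 by rewrite mulr_gt0.
(* [K' * C2] bounds the suprema; Young's inequality bounds E by 4 F^2 + 4 D^2 plus K' g, which the 6
   covers. *)
exists (6 + K' * C2); split; first by rewrite addr_gt0.
move=> I M A N tau X F D Ms As Mp Ap tau0 Xq F0 D0 hB'.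
(* Extends the bound to S = 0: enlarging S by e / (F + 1) costs at most e. *)
have hB (W : nat -> I -> {poly R}) (S Su : R) : (forall n i, (size (W n i) <= q.+1)%N) -> 0 <= S -> 0 <= Su ->
    (forall n (x : R), (n < N)%N -> 0 <= x <= 1 ->
      form M (vel tau W n x) (vel tau W n x) <= S ^+ 2) ->
    form A (peval (W 0%N) 0) (peval (W 0%N) 0) <= Su ^+ 2 ->
    dg_form M A N tau X W <= F * S + D * Su.
  move=> Wq S0 Su0 WS WSu; apply/ler_addgt0Pr => e e0.
  have F1 : 0 < F + 1 by lra.
  have eF : 0 < e / (F + 1) by rewrite divr_gt0.
  have h : dg_form M A N tau X W <= F * (S + e / (F + 1)) + D * Su.
    apply: hB' => //; first by rewrite ltr_wpDl.
    move=> n x nN x01; apply: le_trans (WS n x nN x01) _.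
    by rewrite lerXn2r ?nnegrE//; lra.
  have : F * (e / (F + 1)) <= e.
    by rewrite mulrA ler_pdivrMr// mulrC ler_pM2l//; lra.
  by move: h; rewrite mulrDr; lra.
pose V n i : {poly R} := (tau n)^-1 *: (X n i)^`().
have velE n x : vel tau X n x = peval (V n) x.
  by apply/funext => i; rewrite /vel /peval hornerZ.
have Vq n i : (size (V n i) <= q.+1)%N.
  rewrite (leq_trans (size_scale_leq _ _))// (leq_trans (leq_size_deriv (Xq n i)))//.
pose G n := int01 (pform M (V n) (V n)) + int01 (pform A (X n) (X n)).
pose g := \big[Num.max/0]_(n < N) G n.
have Gm n : 0 <= int01 (pform M (V n) (V n)) by exact: int01_pform_ge0.
have Ga n : 0 <= int01 (pform A (X n) (X n)) by exact: int01_pform_ge0.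
have Gg n : (n < N)%N -> G n <= g.
  by move=> nN; exact: (le_bigmax _ (fun n : 'I_N => G n) (Ordinal nN)).
have g0 : 0 <= g by exact: bigmax_ge_id.
have Kg0 : 0 <= K' * g by rewrite mulr_ge0// ltW.
have supM n x : (n < N)%N -> 0 <= x <= 1 ->
    form M (vel tau X n x) (vel tau X n x) <= K' * g.
  move=> nN x01; rewrite velE.
  apply: le_trans (form_horner_le Ms Mp (KP _ _ Ms Mp) x01 (Vq n)) _.
  by rewrite ler_pM2l// (le_trans _ (Gg n nN))// lerDl.
have supA n x : (n < N)%N -> 0 <= x <= 1 ->
    form A (peval (X n) x) (peval (X n) x) <= K' * g.
  move=> nN x01; apply: le_trans (form_horner_le As Ap (KP _ _ As Ap) x01 (Xq n)) _.
  by rewrite ler_pM2l// (le_trans _ (Gg n nN))// lerDr.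
(* Testing with the truncated solution bounds half of energy plus jumps by F sqrt(K' g) + D sqrt s.
   The squared initial displacement [s] is one of the jumps, and D sqrt s is at most D^2 + s/4, so a
   quarter of the jumps remains: hence the factors 4. *)
pose E := 4 * (F * Num.sqrt (K' * g)) + 4 * D ^+ 2.
have jumps_ge0 n : 0 <= jumps M A tau X n by rewrite addr_ge0.
have energy_ge0 n : 0 <= energy M A tau X n by rewrite addr_ge0.
have hE k : (k < N)%N ->
    energy M A tau X k + \sum_(n < k.+1) jumps M A tau X n <= E.
  move=> kN; have N0 : (0 < N)%N by case: N kN {supM supA Gg g g0 Kg0 E hB hB' tau0}.
  set W := fun n i => if (n <= k)%N then X n i else 0.
  set s := form A (ujump X 0%N) (ujump X 0%N).
  have s0 : 0 <= s by exact: Ap.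
  have := hB W (Num.sqrt (K' * g)) (Num.sqrt s).
  rewrite dg_energy// !sqr_sqrtr// !sqrtr_ge0 => h.
  have {}h := h _ isT isT _ _.
  have : s <= \sum_(n < k.+1) jumps M A tau X n.
    rewrite big_ord_recl/= ler_wpDr ?sumr_ge0//.
    by rewrite /jumps lerDr.
  have := young_sqrt D (ltr01 : 0 < 1 :> R) s0; rewrite mul1r.
  have : 2^-1 * (energy M A tau X k + \sum_(n < k.+1) jumps M A tau X n) <=
      F * Num.sqrt (K' * g) + D * Num.sqrt s.
    apply: h.
    - by move=> n i; rewrite /W; case: ifP => // _; rewrite size_poly0.
    - move=> n x nN x01; rewrite /W; case: (leqP n k) => nk.
        have := supM n x nN x01; congr (_ <= _); congr form; apply/funext => i;
          by rewrite /vel /peval /pderiv nk.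
      rewrite (_ : form _ _ _ = 0)// (_ : vel _ _ _ _ = fun=> 0).
        by rewrite /form big1// => i _; rewrite big1// => j _; rewrite mulr0.
      apply/funext => i; rewrite /vel /peval /pderiv leqNgt nk/=.
      by rewrite linear0 horner0 mulr0.
    - rewrite /W/= /s (_ : ujump X 0%N = peval (X 0%N) 0)//.
      by apply/funext => i; rewrite /ujump subr0.
  by rewrite /E; move: (energy_ge0 k); lra.
have E_ge0 : 0 <= E.
  by rewrite /E; have := mulr_ge0 F0 (sqrtr_ge0 (K' * g)); have := sqr_ge0 D; lra.
have jumps_le n : (n < N)%N -> jumps M A tau X n <= E.
  move=> nN; apply: le_trans (hE n nN); rewrite big_ord_recr/=.
  by rewrite addrA lerDr addr_ge0// sumr_ge0.
have energy_le n : (n < N)%N -> energy M A tau X n <= E.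
  by move=> nN; apply: le_trans (hE n nN); rewrite lerDl sumr_ge0.
(* 4 E bounds the right traces at the left node, and one more E the velocity jump. *)
have hG n : (n < N)%N -> G n <= C1 * (5 * E + F ^+ 2).
  move=> nN.
  have h0 : form M (vel tau X n 0) (vel tau X n 0) +
            form A (peval (X n) 0) (peval (X n) 0) <= 4 * E.
    (* The right trace is the jump plus the state left by the previous slab, each controlled by E
       and doubled by [form_add_le]. *)
    pose pv i := if n is k.+1 then vel tau X k 1 i else 0.
    pose pu i := if n is k.+1 then peval (X k) 1 i else 0.
    have prev : form M pv pv + form A pu pu <= E.
      rewrite /pv /pu {pv pu}; case: n nN => [|k] nN; last exact: energy_le (ltnW nN).
      have z (B : I -> I -> R) : form B (fun=> 0) (fun=> 0) = 0.
        by rewrite /form big1// => i _; rewrite big1// => j _; rewrite mulr0.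
      by rewrite !z addr0.
    have := form_add_le Ms Mp 1 1 (vjump tau X n) pv.
    have := form_add_le As Ap 1 1 (ujump X n) pu.
    rewrite /= (_ : (fun i => 1 * vjump tau X n i + 1 * pv i) = vel tau X n 0);
      last by apply/funext => i; rewrite !mul1r subrK.
    rewrite (_ : (fun i => 1 * ujump X n i + 1 * pu i) = peval (X n) 0);
      last by apply/funext => i; rewrite !mul1r subrK.
    by move: prev (jumps_le n nN); rewrite /jumps !expr1n; lra.
  (* Supported on one slab and 0 at its left node, so the [D] term enters with Su = 0. *)
  pose W m i := if m == n then slab_test q d (X n) i else 0.
  have := @slab_estimate R q K d q0 K0 dq dP I M A Ms As Mp Ap (KP _ _ Ms Mp)
    (tau n) (X n) (Xq n) dd0 (vjump tau X n) (ujump X n) F F0.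
  move=> /(_ _)/le_trans; apply.
    move=> S S0 hS; rewrite -(@dg_form_slab _ _ _ _ N)//.
    rewrite -[leRHS]addr0 -(mulr0 D); apply: (hB W) => //.
    - move=> m i; rewrite /W; case: ifP => _; last by rewrite size_poly0.
      exact: size_slab_test.
    - move=> m x mN x01; rewrite /W /vel /peval /pderiv; case: eqP => [->|_].
        apply: le_trans (hS x x01); rewrite le_eqVlt; apply/orP; left; apply/eqP.
        by congr form; apply/funext => i; rewrite /peval deriv_slab_test.
      rewrite (_ : form _ _ _ = 0) ?sqr_ge0// /form big1// => i _; rewrite big1// => j _.
      by rewrite linear0 horner0 !mulr0.
    - rewrite expr0n/= (_ : form _ _ _ = 0)// /form big1// => i _; rewrite big1// => j _.
      rewrite /W /peval; case: eqP => _; last by rewrite horner0 mulr0.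
      by rewrite !prim0 mulr0.
  rewrite -/(V n) -velE -/C1 ler_pM2l; last by lra.
  have := jumps_le n nN; rewrite /jumps.
  by have := Ap (ujump X n); lra.
have g_le : g <= C1 * (5 * E + F ^+ 2).
  apply: bigmax_le => [|n _]; last exact: hG.
  rewrite mulr_ge0//; first by lra.
  by have := sqr_ge0 F; lra.
have g_le2 : g <= C2 * (F ^+ 2 + D ^+ 2).
  have C1_gt0 : 0 < C1 by lra.
  have a0 : 0 < 10 * C1 * K' by apply: mulr_gt0 => //; apply: mulr_gt0; lra.
  have := young_sqrt F a0 Kg0.
  have -> : K' * g / (4 * (10 * C1 * K')) = g / (40 * C1).
    by field; rewrite !gt_eqF.
  set s := F * _ => hs.
  have : 20 * C1 * s <= 20 * C1 * (10 * C1 * K' * F ^+ 2 + g / (40 * C1)).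
    by rewrite ler_pM2l//; lra.
  have -> : 20 * C1 * (10 * C1 * K' * F ^+ 2 + g / (40 * C1)) =
     200 * (C1 ^+ 2 * K' * F ^+ 2) + g / 2 by field; rewrite gt_eqF.
  move: g_le; rewrite /E -/s /C2.
  have : 0 <= C1 ^+ 2 * K' * F ^+ 2.
    exact: mulr_ge0 (mulr_ge0 (sqr_ge0 _) (ltW K'_gt0)) (sqr_ge0 _).
  have : 0 <= C1 ^+ 2 * K' * D ^+ 2.
    exact: mulr_ge0 (mulr_ge0 (sqr_ge0 _) (ltW K'_gt0)) (sqr_ge0 _).
  have : 0 <= C1 * F ^+ 2 by rewrite mulr_ge0 ?sqr_ge0// ltW.
  have : 0 <= C1 * D ^+ 2 by rewrite mulr_ge0 ?sqr_ge0// ltW.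
  by lra.
have Kg_le : K' * g <= K' * C2 * (F ^+ 2 + D ^+ 2) by rewrite -mulrA ler_pM2l.
have FD0 : 0 <= F ^+ 2 + D ^+ 2 by rewrite addr_ge0 ?sqr_ge0.
have KCFD : K' * C2 * (F ^+ 2 + D ^+ 2) <= (6 + K' * C2) * (F ^+ 2 + D ^+ 2).
  by rewrite ler_wpM2r//; lra.
split=> [n x nN x01|k kN].
  by rewrite (le_trans (supM n x nN x01)) ?(le_trans (supA n x nN x01))//; lra.
apply: le_trans (hE k kN) _; rewrite /E.
have := young_sqrt F (ltr01 : 0 < 1 :> R) Kg0.
by have := sqr_ge0 F; have := sqr_ge0 D; lra.
Qed.

(** * The finite element space *)

Lemma polytopic_domain_open (R : realType) d (Om : set 'rV[R]_d) :
  polytopic_domain Om -> open Om.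
Proof. by move=> [_ _ [s [_ ->]]]; exact: open_interior. Qed.

Lemma polytopic_domain_bounded (R : realType) d (Om : set 'rV[R]_d) :
  polytopic_domain Om ->
  exists m : R, forall x, Om x -> forall i, `|x ord0 i| <= m.
Proof.
move=> [_ _ [s [_ ->]]]; exists (\sum_(V <- s) \sum_i \sum_j `|V i j|).
move=> x /interior_subset[V /= Vs [l [l0 _ l1 ->]]] j.
have nonneg (V' : 'M[R]_(d.+1, d)) : 0 <= \sum_i \sum_j `|V' i j|.
  by apply: sumr_ge0 => i _; exact: sumr_ge0.
rewrite (big_rem V)//= ler_wpDr ?sumr_ge0//.
rewrite summxE (le_trans (ler_norm_sum _ _ _))//; apply: ler_sum => i _.
rewrite !mxE normrM ger0_norm// (@le_trans _ _ `|V i j|)//.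
  by rewrite ler_piMl// -l1 (bigD1 i)//= lerDl sumr_ge0.
by rewrite (bigD1 j)//= lerDl sumr_ge0.
Qed.

Section span.
Variables (R : realType) (d : nat) (Om : set 'rV[R]_d) (m : R).
Hypothesis oOm : open Om.
Hypothesis Om_bounded : forall x, Om x -> forall i, `|x ord0 i| <= m.
Variables (k : nat) (K : 'I_k -> 'M[R]_(d.+1, d)) (p : nat).

Let mOm : measurable Om := open_measurable_rV oOm.

Lemma polyP_lin a (P Q : 'rV[R]_d -> R) : Defs.polyP p P -> Defs.polyP p Q ->
  Defs.polyP p (fun x => a * P x + Q x).
Proof.
move=> [b hb] [b' hb']; exists (fun al => a * b al + b' al) => x.
rewrite hb hb' mulr_sumr -big_split; apply: eq_bigr => al _ /=.
by rewrite mulrDl mulrA.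
Qed.

Lemma Vh_lin a v w : Vh Om K p v -> Vh Om K p w ->
  Vh Om K p (fun x => a * v x + w x).
Proof.
move=> [v1 hv] [w1 hw]; split; first exact: (H10_lin oOm Om_bounded).
move=> i; have [P [hP vP]] := hv i; have [Q [hQ wQ]] := hw i.
exists (fun x => a * P x + Q x); split; first exact: polyP_lin.
by move=> x Kx; rewrite vP// wQ.
Qed.

Lemma Vh0 : Vh Om K p (fun=> 0).
Proof.
split; first exact: (H10_0 oOm Om_bounded).
move=> i; exists (fun=> 0); split => //; exists (fun=> 0) => x.
by rewrite big1// => al _; rewrite mul0r.
Qed.

Variables (I : finType) (U : I -> 'rV[R]_d -> R).
Hypothesis U_Vh : forall i, Vh Om K p (U i).

(** The family [U] may be linearly dependent, which is why its Gram matrices are only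
    semidefinite. *)
Definition span (c : I -> R) (x : 'rV[R]_d) : R := \sum_i c i * U i x.

Let spans (s : seq I) (c : I -> R) x : R := \sum_(i <- s) c i * U i x.

Let spans_cons i s c : spans (i :: s) c = fun x => c i * U i x + spans s c x.
Proof. by apply/funext => x; rewrite /spans big_cons. Qed.

Let spans_nil c : spans [::] c = fun=> 0.
Proof. by apply/funext => x; rewrite /spans big_nil. Qed.

Let Vh_spans s c : Vh Om K p (spans s c).
Proof.
elim: s => [|i s IH]; first by rewrite spans_nil; exact: Vh0.
by rewrite spans_cons; exact: Vh_lin.
Qed.

Lemma Vh_span c : Vh Om K p (span c).
Proof. exact: Vh_spans. Qed.

Lemma H1_span c : H1 Om (span c).
Proof. by have [[]] := Vh_span c. Qed.

Lemma L2fun_span c : L2fun Om (span c).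
Proof. by have [] := H1_span c. Qed.

Lemma L2funv_grad_span c : L2funv Om (grad Om (span c)).
Proof. by have [] := gradP (H1_span c). Qed.

Lemma ip_spanl c z : L2fun Om z -> ip Om (span c) z = \sum_i c i * ip Om (U i) z.
Proof.
move=> z2; rewrite /span -/(spans (index_enum I) c); elim: index_enum => [|i s IH].
  rewrite spans_nil big_nil /ip; under eq_Rintegral do rewrite mul0r.
  by rewrite /Rintegral integral0.
rewrite spans_cons big_cons ip_linl ?IH//.
- by have [[[]]] := U_Vh i.
- by have [[[]]] := Vh_spans s c.
Qed.

Lemma ipv_grad_spanl c G : L2funv Om G -> ipv Om (grad Om (span c)) G =
  \sum_i c i * ipv Om (grad Om (U i)) G.
Proof.
move=> G2; rewrite /span -/(spans (index_enum I) c); elim: index_enum => [|i s IH].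
  rewrite spans_nil big_nil.
  have z1 : H1 Om (fun=> 0) by have [[]] := Vh0.
  have := ipv_grad_linl oOm Om_bounded (-1) z1 z1 G2.
  have -> : (fun x : 'rV[R]_d => -1 * 0 + 0 : R) = fun=> 0.
    by apply/funext => x; rewrite mulr0 addr0.
  by rewrite mulN1r addNr.
rewrite spans_cons big_cons (ipv_grad_linl oOm Om_bounded) ?IH//.
- by have [[]] := U_Vh i.
- by have [[]] := Vh_spans s c.
Qed.

Definition massM i j : R := ip Om (U i) (U j).

Variable a : R.

Definition stiffM i j : R := a * ipv Om (grad Om (U i)) (grad Om (U j)).

Lemma form_mass c e : form massM c e = ip Om (span c) (span e).
Proof.
rewrite ip_spanl; last exact: L2fun_span.
apply: eq_bigr => i _; rewrite ipC ip_spanl; last by have [[[]]] := U_Vh i.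
rewrite mulr_sumr; apply: eq_bigr => j _.
by rewrite /massM (ipC Om (U j)); move: (ip _ _ _) => y; ring.
Qed.

Lemma form_stiff c e :
  form stiffM c e = a * ipv Om (grad Om (span c)) (grad Om (span e)).
Proof.
rewrite ipv_grad_spanl; last exact: L2funv_grad_span.
rewrite mulr_sumr; apply: eq_bigr => i _; rewrite ipvC ipv_grad_spanl; last first.
  by have [[h _] _] := U_Vh i; have [] := gradP h.
rewrite !mulr_sumr; apply: eq_bigr => j _.
by rewrite /stiffM (ipvC Om (grad Om (U j))); move: (ipv _ _ _) => y; ring.
Qed.

Lemma massM_sym i j : massM i j = massM j i. Proof. exact: ipC. Qed.

Lemma stiffM_sym i j : stiffM i j = stiffM j i.
Proof. by rewrite /stiffM ipvC. Qed.

Lemma massM_psd c : 0 <= form massM c c.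
Proof. by rewrite form_mass ip_ge0. Qed.

Lemma stiffM_psd c : 0 <= a -> 0 <= form stiffM c c.
Proof. by move=> a0; rewrite form_stiff mulr_ge0// ipv_ge0. Qed.

Lemma spanB c e x : span (fun i => c i - e i) x = span c x - span e x.
Proof.
by rewrite /span -sumrB; apply: eq_bigr => i _; rewrite mulrBl.
Qed.

Lemma span_0 x : span (fun=> 0) x = 0.
Proof. by rewrite /span big1// => i _; rewrite mul0r. Qed.

(** The chosen gradients agree only almost everywhere, so linearity is expressed under the inner
    product. *)
Lemma grad_spanB c e G : L2funv Om G ->
  ipv Om (grad Om (span (fun i => c i - e i))) G =
  ipv Om (fun x => grad Om (span c) x - grad Om (span e) x) G.
Proof.
move=> G2; rewrite (_ : (fun x => _ - _) =
    fun x => (-1) *: grad Om (span e) x + grad Om (span c) x); last first.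
  by apply/funext => x; rewrite scaleN1r addrC.
rewrite (ipv_linl mOm) ?ipv_grad_spanl//; try exact: L2funv_grad_span.
rewrite mulN1r addrC -sumrB; apply: eq_bigr => i _.
by rewrite mulrBl.
Qed.

End span.

(** * Time slabs and traces *)

Section partition.
Variables (R : realType) (N : nat) (t : nat -> R).
Hypothesis t_lt : forall n, (n < N)%N -> t n < t n.+1.

Lemma partition_le n k : (n <= k <= N)%N -> t n <= t k.
Proof.
move=> /andP[nk kN]; elim: k nk kN => [|k IH]; first by rewrite leqn0 => /eqP ->.
rewrite leq_eqVlt => /predU1P[<-//|]; rewrite ltnS => nk kN.
by rewrite (le_trans (IH nk (ltnW kN)))// ltW// t_lt.
Qed.

Lemma partition_unique n k s : (n < N)%N -> (k < N)%N ->
  t n < s < t n.+1 -> t k < s < t k.+1 -> n = k.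
Proof.
wlog nk : n k / (n <= k)%N.
  by move=> h nN kN hn hk; have [/h->//|/ltnW/h->//] := leqP n k.
move=> nN kN /andP[n1 n2] /andP[k1 k2]; apply/eqP; rewrite eqn_leq nk/=.
rewrite leqNgt; apply/negP => nk'.
have : t n.+1 <= t k by apply: partition_le; rewrite nk' ltnW.
by move=> h; have := lt_le_trans n2 (le_trans h (ltW k1)); rewrite ltxx.
Qed.

Lemma partition_cover s : t 0%N < s < t N -> (forall n, s != t n) ->
  exists n, (n < N)%N /\ t n < s < t n.+1.
Proof.
move=> /andP[s0 sN] st.
have ex : exists n, s < t n by exists N.
case: (ex_minnP ex) => -[|n] sn hmin; first by have := lt_trans s0 sn; rewrite ltxx.
exists n; split.
  by rewrite leqNgt; apply/negP => Nn; have := hmin _ sN; rewrite leqNgt Nn.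
rewrite sn andbT lt_neqAle eq_sym st/= leNgt; apply/negP => /hmin.
by rewrite ltnn.
Qed.

End partition.

Lemma Rintegral_horner (R : realType) (a b : R) (p : {poly R}) : a < b ->
  \int[@lebesgue_measure R]_(s in `]a, b[) p.[s] = (prim p).[b] - (prim p).[a].
Proof.
move=> ab; have mp (D : set R) : measurable_fun D (EFin \o horner p).
  apply/measurable_EFinP; apply: measurable_funTS.
  by apply: continuous_measurable_fun; exact: continuous_horner.
rewrite /Rintegral integral_itv_obnd_cbnd// integral_itv_bndo_bndc//.
rewrite (@continuous_FTC2 _ (horner p) (horner (prim p)))//.
- exact/continuous_subspaceT/continuous_horner.
- split; first by move=> x _; exact: derivable_horner.
    by apply: cvg_at_right_filter; exact: continuous_horner.
  by apply: cvg_at_left_filter; exact: continuous_horner.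
- by move=> x _; rewrite -derivE deriv_prim.
Qed.

Section affine.
Variables (R : realType) (a tau : R).

Definition aff : {poly R} := a%:P + tau *: 'X.

Lemma horner_aff x : aff.[x] = a + tau * x.
Proof. by rewrite hornerD hornerC hornerZ hornerX. Qed.

Lemma deriv_comp_aff (p : {poly R}) : (p \Po aff)^`() = tau *: (p^`() \Po aff).
Proof.
by rewrite deriv_comp /aff derivD derivC add0r derivZ derivX -scalerAr mulr1.
Qed.

Lemma size_comp_aff (p : {poly R}) k : (size p <= k)%N -> (size (p \Po aff) <= k)%N.
Proof.
have [->|p0] := eqVneq p 0; first by rewrite comp_poly0 size_poly0.
move=> pk; rewrite (leq_trans (size_comp_poly_leq _ _))//.
have sa : (size aff <= 2)%N.
  rewrite (leq_trans (size_polyD _ _))// geq_max (leq_trans (size_polyC_leq1 _))//=.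
  by rewrite (leq_trans (size_scale_leq _ _))// size_polyX.
rewrite (leq_trans _ pk)// -[leqRHS]prednK ?size_poly_gt0// ltnS.
by rewrite -[leqRHS]muln1 leq_mul2l; case: (size aff) sa => [|[|[|]]]//=; rewrite orbT.
Qed.

Lemma Rintegral_aff (p : {poly R}) : 0 < tau ->
  \int[@lebesgue_measure R]_(s in `]a, a + tau[) p.[s] = tau * int01 (p \Po aff).
Proof.
move=> tau0; rewrite Rintegral_horner ?ltrDl// -int01Z.
rewrite -[in RHS](deriv_prim p) -deriv_comp_aff int01_deriv !horner_comp !horner_aff.
by rewrite mulr1 mulr0 addr0.
Qed.

End affine.

Lemma comp_pform (R : realType) (I : finType) (M : I -> I -> R) P Q (L : {poly R}) :
  pform M P Q \Po L = pform M (fun i => P i \Po L) (fun i => Q i \Po L).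
Proof.
rewrite /pform /form rmorph_sum; apply: eq_bigr => i _ /=.
rewrite rmorph_sum; apply: eq_bigr => j _ /=.
by rewrite !comp_polyM comp_polyC.
Qed.

Section slab_representation.
Variables (R : realType) (d : nat) (Om : set 'rV[R]_d).
Variables (N : nat) (t : nat -> R).
Hypothesis t_lt : forall n, (n < N)%N -> t n < t n.+1.
Variables (I : finType) (U : I -> 'rV[R]_d -> R).
Implicit Types (u w : R -> 'rV[R]_d -> R) (W : nat -> I -> {poly R}).

(** The polynomials are in physical time, one vector per slab. The open slabs are enough:
    derivatives, traces and integrals do not see the values at the nodes. *)
Definition slabrep u W := forall n s x, (n < N)%N -> t n < s < t n.+1 -> Om x ->
  u s x = span U (peval (W n) s) x.

Definition span_poly (P : I -> {poly R}) x : {poly R} := \sum_i U i x *: P i.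

Lemma horner_span_poly P x s : (span_poly P x).[s] = span U (peval P s) x.
Proof.
rewrite horner_sum; apply: eq_bigr => i _.
by rewrite hornerZ mulrC.
Qed.

Lemma deriv_span_poly P x : (span_poly P x)^`() = span_poly (pderiv P) x.
Proof.
by rewrite /span_poly raddf_sum; apply: eq_bigr => i _; rewrite /= derivZ.
Qed.

Lemma slabrep_dt u W : slabrep u W -> slabrep (dt u) (fun n => pderiv (W n)).
Proof.
move=> uW n s x nN sn Ox; rewrite /dt derive1E.
rewrite (@near_eq_derive _ _ _ _ (horner (span_poly (W n) x))); last first.
  near=> r; rewrite horner_span_poly; apply: uW => //.
  apply/andP; split; near: r.
    by apply: lt_nbhsr; case/andP: sn.
  by apply: lt_nbhsl; case/andP: sn.
by rewrite -derive1E -derivE deriv_span_poly horner_span_poly.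
Unshelve. all: by end_near. Qed.

Lemma rtraceE u W n x : slabrep u W -> (n < N)%N -> Om x ->
  rtrace u (t n) x = span U (peval (W n) (t n)) x.
Proof.
move=> uW nN Ox; rewrite /rtrace -horner_span_poly; apply/cvg_lim => //.
apply: (@cvg_trans _ ((span_poly (W n) x).[r] @[r --> (t n)^'+])); last first.
  by apply: cvg_at_right_filter; exact: continuous_horner.
apply: near_eq_cvg; near=> r; rewrite horner_span_poly; apply/esym/uW => //.
apply/andP; split; near: r; first exact: nbhs_right_gt.
by apply: nbhs_right_lt; exact: t_lt.
Unshelve. all: by end_near. Qed.

Lemma ltraceE u W n x : slabrep u W -> (n < N)%N -> Om x ->
  ltrace u (t n.+1) x = span U (peval (W n) (t n.+1)) x.
Proof.
move=> uW nN Ox; rewrite /ltrace -horner_span_poly; apply/cvg_lim => //.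
apply: (@cvg_trans _ ((span_poly (W n) x).[r] @[r --> (t n.+1)^'-])); last first.
  by apply: cvg_at_left_filter; exact: continuous_horner.
apply: near_eq_cvg; near=> r; rewrite horner_span_poly; apply/esym/uW => //.
apply/andP; split; near: r; last exact: nbhs_left_lt.
by apply: nbhs_left_gt; exact: t_lt.
Unshelve. all: by end_near. Qed.

End slab_representation.

(** * Norms in time and the source term *)

(** The nodes form a countable, hence null, set, so the essential supremum sees only the open
    slabs. *)
Lemma bochner_oo_le (R : realType) (T : R) N (t : nat -> R) (g : R -> \bar R) (S : R) :
  time_partition T N t -> 0 <= S ->
  (forall n s, (n < N)%N -> t n < s < t n.+1 -> (0 <= g s <= S%:E)%E) ->
  (bochner_norm +oo T g <= S%:E)%E.
Proof.
move=> [N0 t0 tN t_lt] S0 gS; rewrite /bochner_norm unlock.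
case: ifPn => [_|_]; last by rewrite lee_fin.
apply/ess_supP.
have nodes0 : lebesgue_measure (range t) = 0%E.
  by apply: countable_lebesgue_measure0; exact: card_image_le.
have mnodes : measurable (range t).
  by apply: countable_measurable; [exact: measurable_set1|exact: card_image_le].
exists (range t); split => // s /=; apply: contra_notP => st.
rewrite patchE; case: ifPn => [/set_mem/=|_]; last by rewrite abse0 lee_fin.
rewrite in_itv/= -tN -t0 => s0T.
have [n [nN sn]] : exists n, (n < N)%N /\ t n < s < t n.+1.
  apply: partition_cover s0T _ => n; apply/eqP => sE; apply: st.
  by exists n.
by have /andP[g0 gs] := gS n s nN sn; rewrite gee0_abs.
Qed.

Section source_term.
Variables (R : realType) (d : nat) (Om : set 'rV[R]_d).
Hypothesis mOm : measurable Om.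
Variables (T : R) (N : nat) (t : nat -> R).
Hypothesis tp : time_partition T N t.
Variables (I : finType) (U : I -> 'rV[R]_d -> R).
Hypothesis mU : forall i, measurable_fun Om (U i).
Variable f : R -> 'rV[R]_d -> R.
Let QT : set (measurableTypeR R * 'rV[R]_d) := `]0, T[ `*` Om.
Let g := fun z : measurableTypeR R * 'rV[R]_d => f z.1 z.2.
Hypothesis mf : measurable_fun QT g.
Local Notation mu := (lebesgue_rV R d).
Local Notation leb := (@lebesgue_measure R).

Let F := g \_ QT.

Let mF : measurable_fun setT F.
Proof. by apply/(measurable_restrictT g); [exact: measurableX|]. Qed.

Let FE s x : `]0, T[%classic s -> F (s, x) = (f s \_ Om) x.
Proof.
move=> s0T; rewrite /F !patchE; have [Ox|Ox] := pselect (Om x).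
  by rewrite !mem_set.
by rewrite !memNset// => -[].
Qed.

Let measurable_section s : `]0, T[%classic s -> measurable_fun Om (f s).
Proof.
move=> s0T; apply/(measurable_restrictT (f s) mOm).
have -> : f s \_ Om = fun x => F (s, x) by apply/funext => x; rewrite FE.
exact: (measurableT_comp mF (@pair1_measurable _ _ (measurableTypeR R) 'rV[R]_d s)).
Qed.

(** Tonelli applies to the positive and negative parts separately, which also covers slices that are
    not integrable. *)
Let measurable_slice (G : measurableTypeR R * 'rV[R]_d -> \bar R) :
  measurable_fun setT G ->
  measurable_fun setT (fun s : measurableTypeR R => \int[mu]_x G (s, x))%E.
Proof.
move=> mG.
have -> : (fun s : measurableTypeR R => \int[mu]_x G (s, x))%E =
    (fubini_F mu G^\+ \- fubini_F mu G^\-)%E.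
  apply/funext => s; rewrite integralE /fubini_F; congr (_ - _)%E; by apply: eq_integral => x _; rewrite ?funeposE ?funenegE.
by apply: emeasurable_funB; apply: measurable_fun_fubini_tonelli_F => //;
  [exact: measurable_funepos|exact: measurable_funeneg].
Qed.

Let h s := L2norm Om (f s).

Let measurable_h : measurable_fun `]0, T[%classic h.
Proof.
apply: (@eq_measurable_fun _ _ _ _ _
  (fun s : measurableTypeR R => (\int[mu]_x (F (s, x) ^+ 2)%:E) `^ 2^-1)%E).
  move=> s /set_mem s0T; rewrite /h /L2norm unlock; congr (_ `^ _)%E.
  apply: eq_integral => x _; rewrite FE//= powR_mulrn//.
  by rewrite real_normK ?num_real.
apply: measurable_funTS.
apply: (measurableT_comp (measurable_poweR _)).
apply: (@measurable_slice (fun z => (F z ^+ 2)%:E)).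
by apply/measurable_EFinP; exact: measurable_funX.
Qed.

Let h_ge0 s : (0 <= h s)%E. Proof. exact: L2norm_ge0. Qed.

Lemma bochner1E : bochner_norm 1 T h = (\int[leb]_(s in `]0%R, T[) h s)%E.
Proof.
rewrite /bochner_norm Lnorm1 [RHS]integral_mkcond; apply: eq_integral => s _.
by rewrite patchE; case: ifPn => _; rewrite gee0_abs.
Qed.

Let slab_sub n : (n < N)%N -> `]t n, t n.+1[%classic `<=` `]0, T[%classic.
Proof.
move=> nN s /=; rewrite !in_itv/=; have [_ t0 tN t_lt] := tp.
move=> /andP[h1 h2]; rewrite -t0 -tN.
rewrite (le_lt_trans _ h1) ?(lt_le_trans h2)//; apply: partition_le t_lt _ _ _.
  by rewrite nN leqnn.
by rewrite leq0n ltnW.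
Qed.

Lemma sum_slab_le k : (k <= N)%N ->
  (\sum_(0 <= n < k) \int[leb]_(s in `]t n, t n.+1[) h s <=
   \int[leb]_(s in `]0%R, t k[) h s)%E.
Proof.
have [_ t0 tN t_lt] := tp.
elim: k => [|k IH] kN; first by rewrite big_nil integral_ge0.
rewrite big_nat_recr//= (le_trans (leeD (IH (ltnW kN)) (lexx _)))//.
have sub1 : `]0, t k[%classic `<=` `]0, t k.+1[%classic.
  by move=> s /=; rewrite !in_itv/= => /andP[-> /lt_trans ->]//; exact: t_lt.
have sub2 : `]t k, t k.+1[%classic `<=` `]0, t k.+1[%classic.
  move=> s /=; rewrite !in_itv/= => /andP[h1 ->]; rewrite andbT (le_lt_trans _ h1)//.
  by rewrite -t0; apply: partition_le t_lt _ _ _; rewrite leq0n ltnW.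
have sub3 : `]0, t k.+1[%classic `<=` `]0, T[%classic.
  move=> s /=; rewrite !in_itv/= => /andP[-> h1] /=; rewrite (lt_le_trans h1)//.
  by rewrite -tN; apply: partition_le t_lt _ _ _; rewrite kN leqnn.
have mh : measurable_fun `]0, t k.+1[%classic h.
  by apply: measurable_funS measurable_h => //; exact: measurable_itv.
rewrite -ge0_integral_setU//.
- apply: ge0_subset_integral => //; try exact: measurable_itv.
    by apply: measurableU; exact: measurable_itv.
  by move=> s [/sub1|/sub2].
- by apply: measurable_funS mh => // s [/sub1|/sub2].
- apply/disj_setPS => s [] /=; rewrite !in_itv/= => /andP[_ h1] /andP[h2 _].
  by have := lt_trans h1 h2; rewrite ltxx.
Qed.

(** Cauchy-Schwarz in space at each time, then integration over the slab. The delicate point is that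
    the spatial inner product is measurable in time. *)
Lemma ipQ_source_le (w : R -> 'rV[R]_d -> R) W n (S : R) :
  slabrep Om N t U w W -> (n < N)%N -> 0 <= S ->
  (forall s, t n < s < t n.+1 -> (L2norm Om (w s) <= S%:E)%E) ->
  (`|ipQ Om (t n) (t n.+1) f w|%:E <=
   (\int[leb]_(s in `]t n, t n.+1[) h s) * S%:E)%E.
Proof.
move=> wW nN S0 wS; set J := `]t n, t n.+1[%classic.
have mJ : measurable J by exact: measurable_itv.
have JE s : J s -> t n < s < t n.+1 by rewrite /J /= in_itv.
(* A jointly measurable function on the whole product that agrees with [f] times [w] on the slab and
   is 0 off [Om] there. *)
pose G z := (F z * \sum_i (W n i).[z.1] * (U i \_ Om) z.2)%:E.
have mG : measurable_fun setT G.
  apply/measurable_EFinP; apply: measurable_funM => //.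
  apply: measurable_sum => i; apply: measurable_funM.
    apply: (@measurableT_comp _ _ _ _ _ _ (horner (W n i))).
      by apply: continuous_measurable_fun; exact: continuous_horner.
    exact: measurable_fst.
  apply: (@measurableT_comp _ _ _ _ _ _ (U i \_ Om)).
    exact: (measurable_restrictT (U i) mOm).1.
  exact: measurable_snd.
have mw s : J s -> measurable_fun Om (w s).
  move=> Js; apply: (@eq_measurable_fun _ _ _ _ _ (span U (peval (W n) s))).
    by move=> x /set_mem Ox; rewrite (wW n)// JE.
  apply: measurable_sum => i; apply: measurable_funM => //.
have mk : measurable_fun J (fun s => (ip Om (f s) (w s))%:E).
  apply: (@eq_measurable_fun _ _ _ _ _
      (fun s : measurableTypeR R => (fine (\int[mu]_x G (s, x)))%:E)%E).
    move=> s /set_mem Js; congr EFin; rewrite /ip /Rintegral; congr fine.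
    rewrite [RHS]integral_mkcond; apply: eq_integral => x _.
    rewrite /G FE; last exact: slab_sub Js.
    rewrite !patchE; have [Ox|Ox] := pselect (Om x); last by rewrite memNset// mul0r.
    rewrite mem_set//; congr (_ * _)%:E; rewrite (wW n s x nN (JE s Js) Ox).
    by apply: eq_bigr => i _; rewrite patchE mem_set.
  apply: measurable_funTS; apply/measurable_EFinP.
  by apply: measurableT_comp; [exact: fine_measurable|exact: measurable_slice].
have mhJ : measurable_fun J h.
  by apply: measurable_funS measurable_h; [exact: measurable_itv|exact: slab_sub].
apply: (@le_trans _ _ (`|\int[leb]_(s in J) (ip Om (f s) (w s))%:E|)%E).
  rewrite /ipQ /Rintegral; case: (integral _ _ _) => [r| |] /=;
    by rewrite ?normr0 ?leey ?lexx.
apply: (le_trans (le_abse_integral leb mJ mk)); rewrite -ge0_integralZr//.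
apply: ge0_le_integral => //.
- exact: measurableT_comp.
- by apply: emeasurable_funM => //; exact: measurable_cst.
- move=> s Js; apply: (le_trans (ip_CS mOm (measurable_section (slab_sub nN Js)) (mw s Js))).
  by apply: lee_wpmul2l; [exact: L2norm_ge0|apply: wS; exact: JE].
Qed.

Lemma source_le (w : R -> 'rV[R]_d -> R) W (S Ff : R) :
  slabrep Om N t U w W -> 0 <= S -> bochner_norm 1 T h = Ff%:E ->
  (forall n s, (n < N)%N -> t n < s < t n.+1 -> (L2norm Om (w s) <= S%:E)%E) ->
  \sum_(0 <= n < N) ipQ Om (t n) (t n.+1) f w <= Ff * S.
Proof.
move=> wW S0 hF wS; have [_ t0 tN t_lt] := tp.
rewrite -lee_fin EFinM -hF bochner1E -tN.
apply: (@le_trans _ _ ((\sum_(0 <= n < N) \int[leb]_(s in `]t n, t n.+1[) h s) * S%:E)%E).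
  rewrite ge0_sume_distrl; last by move=> n _; exact: integral_ge0.
  rewrite -sumEFin !big_nat; apply: lee_sum => n /= nN.
  apply: le_trans (ipQ_source_le wW nN S0 (fun s => wS n s nN)).
  by rewrite lee_fin ler_norm.
by rewrite lee_wpmul2r ?lee_fin//; exact: sum_slab_le.
Qed.

End source_term.

(** * Reduction to polynomial coefficients *)

Lemma pformZ (R : realType) (I : finType) (M : I -> I -> R) a b P Q :
  pform M (fun i => a *: P i) (fun i => b *: Q i) = (a * b) *: pform M P Q.
Proof.
rewrite /pform /form scaler_sumr; apply: eq_bigr => i _.
rewrite scaler_sumr; apply: eq_bigr => j _.
by rewrite -!mul_polyC polyCM; ring.
Qed.

Section identification.
Variables (R : realType) (d : nat) (Om : set 'rV[R]_d) (m : R).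
Hypothesis oOm : open Om.
Hypothesis Om_bounded : forall x, Om x -> forall i, `|x ord0 i| <= m.
Variables (k : nat) (K : 'I_k -> 'M[R]_(d.+1, d)) (p : nat).
Variables (I : finType) (U : I -> 'rV[R]_d -> R).
Hypothesis U_Vh : forall i, Vh Om K p (U i).
Variables (N : nat) (t : nat -> R) (c : R).
Hypothesis N_gt0 : (0 < N)%N.
Hypothesis t00 : t 0%N = 0.
Hypothesis t_lt : forall n, (n < N)%N -> t n < t n.+1.

(** The value 1 beyond the last slab keeps all lengths positive, so that [rescale] undoes [unscale]
    at every index. *)
Definition slab_len n : R := if (n < N)%N then t n.+1 - t n else 1.
Local Notation tau := slab_len.

Lemma slab_len_gt0 n : 0 < tau n.
Proof. by rewrite /tau; case: ifP => // nN; rewrite subr_gt0 t_lt. Qed.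

Lemma slab_lenE n : (n < N)%N -> t n + tau n = t n.+1.
Proof. by rewrite /tau => ->; rewrite addrC subrK. Qed.

Definition rescale (W : nat -> I -> {poly R}) n i : {poly R} :=
  W n i \Po aff (t n) (tau n).

Definition unscale (Y : nat -> I -> {poly R}) n i : {poly R} :=
  Y n i \Po aff (- t n / tau n) (tau n)^-1.

Lemma unscaleK Y : rescale (unscale Y) = Y.
Proof.
apply/funext => n; apply/funext => i; rewrite /rescale /unscale -comp_polyA.
rewrite [X in _ \Po X](_ : _ = 'X) ?comp_polyXr//.
have t0 : tau n != 0 by rewrite gt_eqF// slab_len_gt0.
rewrite {1}/aff comp_polyD comp_polyC comp_polyZ comp_polyX /aff scalerDr scalerA.
rewrite mulVf// scale1r addrA -[_ *: _%:P]mul_polyC -polyCM -polyCD.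
by rewrite mulNr [_^-1 * _]mulrC addNr add0r.
Qed.

Lemma peval_rescale W n x :
  peval (rescale W n) x = peval (W n) (t n + tau n * x).
Proof. by apply/funext => i; rewrite /peval horner_comp horner_aff. Qed.

Lemma pderiv_rescale W n i :
  pderiv (rescale W n) i = tau n *: rescale (fun n => pderiv (W n)) n i.
Proof. by rewrite /pderiv deriv_comp_aff. Qed.

Lemma vel_rescale W n x :
  vel tau (rescale W) n x = peval (pderiv (W n)) (t n + tau n * x).
Proof.
apply/funext => i; rewrite /vel /peval pderiv_rescale hornerZ mulrA mulVf.
  by rewrite mul1r horner_comp horner_aff.
by rewrite gt_eqF// slab_len_gt0.
Qed.

Local Notation M := (massM Om U).
Local Notation A := (stiffM Om U (c ^+ 2)).

Variables (u w : R -> 'rV[R]_d -> R) (X W : nat -> I -> {poly R}).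
Hypothesis uX : slabrep Om N t U u X.
Hypothesis wW : slabrep Om N t U w W.

Let X1 := fun n => pderiv (X n).
Let X2 := fun n => pderiv (X1 n).
Let W1 := fun n => pderiv (W n).
Let uX1 : slabrep Om N t U (dt u) X1 := slabrep_dt uX.
Let uX2 : slabrep Om N t U (dt (dt u)) X2 := slabrep_dt uX1.
Let wW1 : slabrep Om N t U (dt w) W1 := slabrep_dt wW.

(** Two time derivatives on [u] and one on [w] give tau^-3, the change of variable gives tau. In the
    stiffness term the powers cancel. *)
Lemma ipQ_dg n : (n < N)%N -> ipQ Om (t n) (t n.+1) (dt (dt u)) (dt w) =
  (tau n)^-1 ^+ 2 * int01 (pform M (pderiv (pderiv (rescale X n)))
                                   (pderiv (rescale W n))).
Proof.
move=> nN; rewrite /ipQ -slab_lenE//.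
transitivity (\int[@lebesgue_measure R]_(s in `]t n, t n + tau n[)
    (pform M (X2 n) (W1 n)).[s]).
  apply: eq_Rintegral => s /set_mem; rewrite /= in_itv/= slab_lenE// => sn.
  rewrite horner_pform (form_mass oOm Om_bounded U_Vh).
  by apply: eq_ip => x Ox; [exact: uX2|exact: wW1].
rewrite Rintegral_aff ?slab_len_gt0// comp_pform.
have e2 : pderiv (pderiv (rescale X n)) =
    fun i => (tau n ^+ 2) *: (X2 n i \Po aff (t n) (tau n)).
  apply/funext => i; rewrite [LHS]/pderiv pderiv_rescale derivZ.
  by rewrite -/(pderiv (rescale X1 n) i) pderiv_rescale scalerA -expr2.
have e1 : pderiv (rescale W n) = fun i => tau n *: (W1 n i \Po aff (t n) (tau n)).
  by apply/funext => i; rewrite pderiv_rescale.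
rewrite e1 e2 pformZ int01Z; have := slab_len_gt0 n.
move: (int01 _) => y; move: (tau n) => z z0; field; by rewrite gt_eqF.
Qed.

Lemma gipQ_dg n : (n < N)%N -> c ^+ 2 * gipQ Om (t n) (t n.+1) u (dt w) =
  int01 (pform A (rescale X n) (pderiv (rescale W n))).
Proof.
move=> nN; rewrite /gipQ -slab_lenE//.
have e1 : pderiv (rescale W n) = fun i => tau n *: (W1 n i \Po aff (t n) (tau n)).
  by apply/funext => i; rewrite pderiv_rescale.
have e0 : rescale X n = fun i => 1 *: (X n i \Po aff (t n) (tau n)).
  by apply/funext => i; rewrite scale1r.
rewrite e1 e0 pformZ int01Z mul1r -comp_pform -Rintegral_aff ?slab_len_gt0//.
rewrite (_ : (fun s => (pform A (X n) (W1 n)).[s]) = horner (pform A (X n) (W1 n)))//.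
pose q : {poly R} := pform (stiffM Om U 1) (X n) (W1 n).
have qE : pform A (X n) (W1 n) = c ^+ 2 *: q.
  rewrite /q /pform /form scaler_sumr; apply: eq_bigr => i _.
  rewrite scaler_sumr; apply: eq_bigr => j _.
  rewrite /stiffM mul1r; move: (ipv _ _ _) => y.
  by rewrite -!mul_polyC polyCM; ring.
rewrite qE Rintegral_horner; last by rewrite ltrDl slab_len_gt0.
rewrite primZ !hornerZ -mulrBr -Rintegral_horner; last by rewrite ltrDl slab_len_gt0.
congr (_ * _); apply: eq_Rintegral => s /set_mem; rewrite /= in_itv/= slab_lenE// => sn.
rewrite horner_pform (form_stiff oOm Om_bounded U_Vh) mul1r.
have g1 : grad Om (u s) = grad Om (span U (peval (X n) s)).
  by apply: grad_eq => x Ox; exact: uX.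
have g2 : grad Om (dt w s) = grad Om (span U (peval (W1 n) s)).
  by apply: grad_eq => x Ox; exact: wW1.
by rewrite g1 g2.
Qed.

Lemma jump_dg n x : (0 < n < N)%N -> Om x ->
  jump (dt u) (t n) x = span U (vjump tau (rescale X) n) x.
Proof.
case: n => // n /andP[_ nN] Ox; rewrite /jump /vjump spanB.
rewrite (rtraceE t_lt uX1 nN Ox) (ltraceE t_lt uX1 (ltnW nN) Ox).
by rewrite !vel_rescale mulr0 addr0 mulr1 slab_lenE ?(ltnW nN).
Qed.

Lemma rtrace_dg0 x : Om x ->
  rtrace (dt u) 0 x = span U (vjump tau (rescale X) 0) x.
Proof.
move=> Ox; rewrite /vjump spanB span_0 subr0 -[in LHS]t00.
by rewrite (rtraceE t_lt uX1 N_gt0 Ox) vel_rescale mulr0 addr0.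
Qed.

Lemma ltrace_dgN x : Om x ->
  ltrace (dt u) (t N) x = span U (vel tau (rescale X) N.-1 1) x.
Proof.
move=> Ox; have NE : N = N.-1.+1 by rewrite prednK.
have nN : (N.-1 < N)%N by rewrite [in ltnRHS]NE.
rewrite [in LHS]NE (ltraceE t_lt uX1 nN Ox) vel_rescale mulr1 slab_lenE//.
Qed.

Lemma rtrace_dgw n x : (n < N)%N -> Om x ->
  rtrace (dt w) (t n) x = span U (vel tau (rescale W) n 0) x.
Proof.
by move=> nN Ox; rewrite (rtraceE t_lt wW1 nN Ox) vel_rescale mulr0 addr0.
Qed.

Lemma grad_rtrace n (v : R -> 'rV[R]_d -> R) Y : slabrep Om N t U v Y -> (n < N)%N ->
  grad Om (rtrace v (t n)) = grad Om (span U (peval (rescale Y n) 0)).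
Proof.
move=> vY nN; apply: grad_eq => x Ox.
by rewrite (rtraceE t_lt vY nN Ox) peval_rescale mulr0 addr0.
Qed.

Lemma grad_rtrace0 (v : R -> 'rV[R]_d -> R) Y : slabrep Om N t U v Y ->
  grad Om (rtrace v 0) = grad Om (span U (peval (rescale Y 0) 0)).
Proof. by move=> vY; rewrite -(grad_rtrace vY N_gt0) t00. Qed.

Lemma grad_ltrace n (v : R -> 'rV[R]_d -> R) Y : slabrep Om N t U v Y -> (n < N)%N ->
  grad Om (ltrace v (t n.+1)) = grad Om (span U (peval (rescale Y n) 1)).
Proof.
move=> vY nN; apply: grad_eq => x Ox.
by rewrite (ltraceE t_lt vY nN Ox) peval_rescale mulr1 slab_lenE.
Qed.

Lemma gjump_dg n G : (0 < n < N)%N -> L2funv Om G ->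
  ipv Om (gjump Om u (t n)) G = ipv Om (grad Om (span U (ujump (rescale X) n))) G.
Proof.
case: n => // n /andP[_ nN] G2.
rewrite /gjump (grad_rtrace uX nN) (grad_ltrace uX (ltnW nN)).
exact/esym/(grad_spanB oOm Om_bounded U_Vh (peval (rescale X n.+1) 0)
  (peval (rescale X n) 1) G2).
Qed.

Lemma ujump0 : ujump (rescale X) 0 = peval (rescale X 0) 0.
Proof. by apply/funext => i; rewrite /ujump subr0. Qed.

Lemma Bform_dg : Bform Om N t c u w = dg_form M A N tau (rescale X) (rescale W).
Proof.
pose b n := form M (vjump tau (rescale X) n) (vel tau (rescale W) n 0).
pose b' n := form A (ujump (rescale X) n) (peval (rescale W n) 0).
rewrite /dg_form /slab_form !big_split /=.
rewrite -(big_mkord xpredT b) -(big_mkord xpredT b').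
have h1 : \sum_(0 <= n < N) ipQ Om (t n) (t n.+1) (dt (dt u)) (dt w) =
    \sum_(n < N) (tau n)^-1 ^+ 2 * int01 (pform M (pderiv (pderiv (rescale X n)))
                                   (pderiv (rescale W n))).
  by rewrite big_mkord; apply: eq_bigr => n _; exact: ipQ_dg.
have h2 : c ^+ 2 * (\sum_(0 <= n < N) gipQ Om (t n) (t n.+1) u (dt w)) =
    \sum_(n < N) int01 (pform A (rescale X n) (pderiv (rescale W n))).
  by rewrite mulr_sumr big_mkord; apply: eq_bigr => n _; exact: gipQ_dg.
have h3 : \sum_(1 <= n < N) ip Om (jump (dt u) (t n)) (rtrace (dt w) (t n)) +
    ip Om (rtrace (dt u) 0) (rtrace (dt w) 0) = \sum_(0 <= n < N) b n.
  rewrite [RHS]big_ltn// addrC; congr (_ + _).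
    rewrite /b (form_mass oOm Om_bounded U_Vh); apply: eq_ip => x Ox.
      exact: rtrace_dg0.
    by rewrite -[in LHS]t00; exact: rtrace_dgw.
  rewrite !big_nat; apply: eq_bigr => n nN.
  rewrite /b (form_mass oOm Om_bounded U_Vh); apply: eq_ip => x Ox.
    exact: jump_dg.
  by apply: rtrace_dgw => //; case/andP: nN.
have h4 : c ^+ 2 * (\sum_(1 <= n < N) ipv Om (gjump Om u (t n)) (grad Om (rtrace w (t n)))) +
    c ^+ 2 * ipv Om (grad Om (rtrace u 0)) (grad Om (rtrace w 0)) =
    \sum_(0 <= n < N) b' n.
  rewrite [RHS]big_ltn// addrC; congr (_ + _).
    rewrite /b' (form_stiff oOm Om_bounded U_Vh) ujump0.
    by rewrite (grad_rtrace0 uX) (grad_rtrace0 wW).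
  rewrite mulr_sumr !big_nat; apply: eq_bigr => n nN.
  have [_ nN'] := andP nN.
  rewrite /b' (form_stiff oOm Om_bounded U_Vh) (grad_rtrace wW nN') gjump_dg//.
  exact: (L2funv_grad_span oOm Om_bounded U_Vh).
rewrite /Bform h2 -h1 -h3 -h4.
move: (\sum_(0 <= n < N) ipQ _ _ _ _ _) (\sum_(1 <= n < N) ip _ _ _) (ip _ _ _)
  (\sum_(n < N) _) (_ * _) (_ * _) => *; ring.
Qed.

End identification.

(** * The stability estimate *)

(** The coefficient functions of all slabs are gathered in one family indexed by slab and power; on
    slab [n] those of the other slabs get the polynomial 0. *)
Definition slab_monomial (R : realType) N q n (i : 'I_N * 'I_q.+1) : {poly R} :=
  if val i.1 == n then 'X^(val i.2) else 0.

Lemma Vdisc_slabrep (R : realType) d (Om : set 'rV[R]_d) k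
    (K : 'I_k -> 'M[R]_(d.+1, d)) N t p q u : Vdisc Om K N t p q u ->
  exists U : 'I_N * 'I_q.+1 -> 'rV[R]_d -> R, (forall i, Vh Om K p (U i)) /\
    slabrep Om N t U u (@slab_monomial R N q).
Proof.
move=> hu; have /choice[v hv] : forall n : 'I_N, exists v : 'I_q.+1 -> 'rV[R]_d -> R,
    (forall j, Vh Om K p (v j)) /\ forall s x, t n < s < t n.+1 -> Om x ->
      u s x = \sum_(j < q.+1) s ^+ j * v j x.
  by move=> n; exact: hu.
exists (fun i => v i.1 i.2); split; first by move=> i; have [] := hv i.1.
move=> n s x nN sn Ox; have [_ /(_ s x sn Ox) ->] := hv (Ordinal nN).
rewrite /span -(pair_bigA _ (fun a b =>
  peval (@slab_monomial R N q n) s (a, b) * v a b x)).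
rewrite (bigD1 (Ordinal nN))//= [X in _ = _ + X]big1 ?addr0 => [|a an].
  by apply: eq_bigr => j _; rewrite /peval /slab_monomial /= eqxx hornerXn.
rewrite big1// => j _; rewrite /peval /slab_monomial /=.
have /negbTE -> : nat_of_ord a != n by [].
by rewrite horner0 mul0r.
Qed.

(** Turns every choice of polynomials of degree at most [q] into an admissible test function, so the
    scheme can be tested inside the span of [U]. *)
Lemma slabrep_Vdisc (R : realType) d (Om : set 'rV[R]_d) (m : R) k
    (K : 'I_k -> 'M[R]_(d.+1, d)) N t p q (I : finType) (U : I -> 'rV[R]_d -> R) Z :
  open Om -> (forall x, Om x -> forall i, `|x ord0 i| <= m) ->
  (forall n, (n < N)%N -> t n < t n.+1) ->
  (forall i, Vh Om K p (U i)) -> (forall n i, (size (Z n i : {poly R}) <= q.+1)%N) ->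
  exists w, Vdisc Om K N t p q w /\ slabrep Om N t U w Z.
Proof.
move=> oOm bOm t_lt U_Vh Zq.
(* The slab containing [s]; at the nodes and outside the time interval it defaults to 0. *)
pose idx s := xget 0%N [set n | (n < N)%N /\ t n < s < t n.+1].
have idxE n s : (n < N)%N -> t n < s < t n.+1 -> idx s = n.
  move=> nN sn; have [h1 h2] := @xgetPex _ 0%N [set n | (n < N)%N /\ t n < s < t n.+1]
    (ex_intro _ n (conj nN sn)).
  exact: (partition_unique t_lt h1 nN h2 sn).
pose w s x := span U (peval (Z (idx s)) s) x.
have wZ : slabrep Om N t U w Z.
  by move=> n s x nN sn Ox; rewrite /w (idxE n).
exists w; split => // n nN.
exists (fun j => span U (fun i => (Z n i)`_j)); split.
  by move=> j; exact: (Vh_span oOm bOm U_Vh).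
move=> s x sn Ox; rewrite (wZ n)// /span.
transitivity (\sum_i \sum_(j < q.+1) s ^+ j * ((Z n i)`_j * U i x)).
  apply: eq_bigr => i _; rewrite /peval (horner_coef_wide _ (Zq n i)) mulr_suml.
  by apply: eq_bigr => j _; rewrite mulrCA mulrA.
by rewrite exchange_big; apply: eq_bigr => j _; rewrite -mulr_sumr.
Qed.

Lemma sqre_le (R : realType) (x : \bar R) (s r : R) :
  (0 <= x)%E -> (x <= s%:E)%E -> s ^+ 2 <= r -> (x ^+ 2 <= r%:E)%E.
Proof.
case: x => [y| |]// y0 ys sr; rewrite -EFin_expe.
move: y0 ys; rewrite !lee_fin => y0 ys.
by rewrite (le_trans _ sr)// lerXn2r ?nnegrE// (le_trans y0).
Qed.

Lemma slab_param (R : realType) N (t : nat -> R) n s :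
  (forall n, (n < N)%N -> t n < t n.+1) -> (n < N)%N -> t n < s < t n.+1 ->
  exists x, 0 <= x <= 1 /\ s = t n + slab_len N t n * x.
Proof.
move=> t_lt nN /andP[sn1 sn2]; have tau0 := slab_len_gt0 t_lt n.
exists ((s - t n) / slab_len N t n); split; last first.
  by rewrite mulrC divfK ?gt_eqF// addrC subrK.
apply/andP; split; first by rewrite divr_ge0 ?subr_ge0 ?ltW.
by rewrite ler_pdivrMr// mul1r lerBlDl slab_lenE// ltW.
Qed.

Theorem proposition6p2 (R : realType) (q : nat) (hq : (2 <= q)%N) :
  exists C : R, 0 < C /\
  forall (d p : nat) (sigma : R), (1 <= d <= 3)%N -> (1 <= p)%N ->
  exists C_CFL : R, 0 < C_CFL /\
  forall (Om : set 'rV[R]_d) (m : nat) (K : 'I_m -> 'M[R]_(d.+1, d))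
         (T : R) (N : nat) (t : nat -> R) (c : R)
         (f : R -> 'rV[R]_d -> R) (u0 v0 : 'rV[R]_d -> R),
  polytopic_domain Om -> conforming_mesh Om K -> shape_regular sigma K ->
  0 < T -> time_partition T N t -> 0 < c ->
  L2funQ Om T f -> H10 Om u0 -> L2fun Om v0 ->
  max_step N t <= C_CFL * hmin K / c ->
  forall u : R -> 'rV[R]_d -> R, Vdisc Om K N t p q u ->
  (forall w : R -> 'rV[R]_d -> R, Vdisc Om K N t p q w ->
     Bform Om N t c u w = lform Om N t c f u0 v0 w) ->
  (bochner_norm +oo T (fun s => L2norm Om (dt u s)) ^+ 2
   + (c ^+ 2)%:E * bochner_norm +oo T (fun s => L2normv Om (grad Om (u s))) ^+ 2
   + Jsq Om N t (dt u) + (c ^+ 2)%:E * gJsq Om N t u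
   <= C%:E * (bochner_norm 1 T (fun s => L2norm Om (f s)) ^+ 2
              + L2norm Om v0 ^+ 2
              + (c ^+ 2)%:E * L2normv Om (grad Om u0) ^+ 2))%E.
Proof.
have [C [C0 stab]] := @dg_stability R q (ltnW hq).
(* A factor 3 for the two suprema and the jump terms taken together, and a factor 2 from (Ff + Fv)^2
   being at most 2 Ff^2 + 2 Fv^2. *)
exists (6 * C); split; first by rewrite mulr_gt0.
move=> d p sigma _ _; exists 1; split => //.
move=> Om m K T N t c f u0 v0 dom _ _ _ tp c0 [mf _] [u01 _] v02 _ u Vu scheme.
have oOm := polytopic_domain_open dom.
have [b bOm] := polytopic_domain_bounded dom.
have mOm := open_measurable_rV oOm.
have [N0 t0 tN t_lt] := tp.
have [U [U_Vh uX]] := Vdisc_slabrep Vu.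
pose X := @slab_monomial R N q.
have Xq n i : (size (X n i) <= q.+1)%N.
  by rewrite /X /slab_monomial; case: ifP => _; rewrite ?size_poly0// size_polyXn; exact: ltn_ord.
have [G2 _] := gradP u01.
have c20 : 0 < c ^+ 2 by rewrite exprn_gt0.
pose M := massM Om U; pose A := stiffM Om U (c ^+ 2).
pose tau := slab_len N t.
have tau0 n : 0 < tau n by exact: slab_len_gt0.
have L2U i : L2fun Om (U i) by have [[[]]] := U_Vh i.
(* An infinite source norm makes the right-hand side infinite. *)
have [Ffoo|] := eqVneq (bochner_norm 1 T (fun s => L2norm Om (f s))) +oo%E.
  have C60 : 0 < 6 * C by rewrite mulr_gt0.
  rewrite Ffoo (L2norm_ip mOm v02) (L2normv_ipv mOm G2) -EFinM.
  have -> : (+oo ^+ 2 = +oo :> \bar R)%E by [].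
  by rewrite !addye// mulry gtr0_sg// mul1e leey.
move=> Ff_fin.
have [Ff FfE] : exists Ff, bochner_norm 1 T (fun s => L2norm Om (f s)) = Ff%:E.
  have : (0 <= bochner_norm 1 T (fun s => L2norm Om (f s)))%E by exact: Lnorm_ge0.
  by case: bochner_norm Ff_fin => [r| |]//; exists r.
have Ff0 : 0 <= Ff by rewrite -lee_fin -FfE; exact: Lnorm_ge0.
pose Fv := Num.sqrt (ip Om v0 v0).
pose Dg := Num.sqrt (ipv Om (grad Om u0) (grad Om u0)).
have Fv0 : 0 <= Fv by exact: sqrtr_ge0.
have Dg0 : 0 <= Dg by exact: sqrtr_ge0.
have Fv2 : Fv ^+ 2 = ip Om v0 v0 by rewrite sqr_sqrtr// ip_ge0.
have Dg2 : Dg ^+ 2 = ipv Om (grad Om u0) (grad Om u0) by rewrite sqr_sqrtr// ipv_ge0.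
(* [v0] is paired with the initial velocity of the test function and so joins [f]; the factor c^2 of
   the [u0] term is shared equally between [u0] and the test function. *)
pose CC := C * ((Ff + Fv) ^+ 2 + (c * Dg) ^+ 2).
have bound : (forall n x, (n < N)%N -> 0 <= x <= 1 ->
     form M (vel tau (rescale N t X) n x) (vel tau (rescale N t X) n x) <= CC /\
     form A (peval (rescale N t X n) x) (peval (rescale N t X n) x) <= CC) /\
  (forall k, (k < N)%N ->
    energy M A tau (rescale N t X) k + \sum_(n < k.+1) jumps M A tau (rescale N t X) n <=
    CC).
  apply: (stab _ M A N tau (rescale N t X) (Ff + Fv) (c * Dg)).
  - exact: massM_sym.
  - exact: stiffM_sym.
  - exact: (massM_psd oOm bOm U_Vh).
  - by move=> e; apply: (stiffM_psd oOm bOm U_Vh); exact: ltW.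
  - by move=> n _; exact: tau0.
  - by move=> n i; exact: size_comp_aff.
  - by rewrite addr_ge0.
  - by rewrite mulr_ge0// ltW.
  move=> Y S Su Yq S0 Su0 hS hSu.
  (* The abstract test polynomials live on [0, 1]; [unscale] takes them back to physical time. *)
  have Zq n i : (size (unscale N t Y n i) <= q.+1)%N by exact: size_comp_aff.
  have [w [Vw wZ]] := slabrep_Vdisc oOm bOm t_lt U_Vh Zq.
  have := Bform_dg oOm bOm U_Vh c N0 t0 t_lt uX wZ.
  rewrite (unscaleK t_lt) -/tau => <-; rewrite (scheme w Vw) /lform.
  have wZ1 := slabrep_dt wZ.
  have velY n x : vel tau Y n x = peval (pderiv (unscale N t Y n)) (t n + tau n * x).
    by rewrite -[in LHS](unscaleK t_lt Y) vel_rescale.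
  have h1 : \sum_(0 <= n < N) ipQ Om (t n) (t n.+1) f (dt w) <= Ff * S.
    apply: (source_le mOm tp (fun i => (L2U i).1) mf wZ1 (ltW S0) FfE).
    move=> n s nN sn.
    rewrite (eq_L2norm (fun x Ox => wZ1 n s x nN sn Ox)).
    apply: (L2norm_le mOm (ltW S0)); first exact: (L2fun_span oOm bOm U_Vh).
    rewrite -(form_mass oOm bOm U_Vh).
    have [x [x01 ->]] := slab_param t_lt nN sn.
    by have := hS n x nN x01; rewrite velY.
  have h2 : ip Om v0 (rtrace (dt w) 0) <= Fv * S.
    pose z := span U (peval (pderiv (unscale N t Y 0%N)) 0).
    have -> : ip Om v0 (rtrace (dt w) 0) = ip Om v0 z.
      apply: eq_ip => // x Ox.
      by have := rtraceE t_lt wZ1 N0 Ox; rewrite t0.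
    rewrite -lee_fin EFinM.
    have z2 : L2fun Om z by exact: (L2fun_span oOm bOm U_Vh).
    apply: (@le_trans _ _ (L2norm Om v0 * L2norm Om z)%E).
      apply: le_trans (ip_CS mOm v02.1 z2.1); by rewrite lee_fin ler_norm.
    apply: lee_pmul; [exact: L2norm_ge0|exact: L2norm_ge0| |].
      by apply: (L2norm_le mOm Fv0 v02); rewrite Fv2.
    apply: (L2norm_le mOm (ltW S0) z2).
    rewrite /z -(form_mass oOm bOm U_Vh).
    have := hS 0%N 0 N0; rewrite velY t0 mulr0 addr0; apply.
    by rewrite lexx ler01.
  have h3 : c ^+ 2 * ipv Om (grad Om u0) (grad Om (rtrace w 0)) <= c * Dg * Su.
    rewrite (grad_rtrace0 N0 t0 t_lt wZ) (unscaleK t_lt).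
    set z := span _ _; have z2 := L2funv_grad_span oOm bOm U_Vh (peval (Y 0%N) 0).
    have Suc : 0 <= Su / c by rewrite divr_ge0// ltW.
    have h : ipv Om (grad Om u0) (grad Om z) <= Dg * (Su / c).
      apply: (ipv_CS mOm Dg0 Suc G2 z2); first by rewrite Dg2.
      rewrite expr_div_n ler_pdivlMr// mulrC -(form_stiff oOm bOm U_Vh).
      exact: hSu.
    apply: (@le_trans _ _ (c ^+ 2 * (Dg * (Su / c)))); first by rewrite ler_pM2l.
    by rewrite le_eqVlt; apply/orP; left; apply/eqP; field; rewrite gt_eqF.
  move: h1 h2 h3; move: (\sum_(0 <= n < N) _) (ip _ _ _) (c ^+ 2 * _) => x y z.
  by lra.
have [bnd bndJ] := bound.
have CC0 : 0 <= CC by rewrite mulr_ge0 ?(ltW C0)// addr_ge0 ?sqr_ge0.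
have sC0 : 0 <= Num.sqrt CC by exact: sqrtr_ge0.
have uX1 := slabrep_dt uX.
have B1 : (bochner_norm +oo T (fun s => L2norm Om (dt u s)) ^+ 2 <= CC%:E)%E.
  apply: (@sqre_le _ _ (Num.sqrt CC)); [exact: Lnorm_ge0| |by rewrite sqr_sqrtr].
  apply: (bochner_oo_le tp sC0) => n s nN sn; apply/andP; split; first exact: L2norm_ge0.
  rewrite (eq_L2norm (fun x Ox => uX1 n s x nN sn Ox)).
  apply: (L2norm_le mOm sC0); first exact: (L2fun_span oOm bOm U_Vh).
  rewrite -(form_mass oOm bOm U_Vh) sqr_sqrtr//.
  have [x [x01 ->]] := slab_param t_lt nN sn.
  by have [+ _] := bnd n x nN x01; rewrite (vel_rescale t_lt).
have B2 : ((c ^+ 2)%:E *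
    bochner_norm +oo T (fun s => L2normv Om (grad Om (u s))) ^+ 2 <= CC%:E)%E.
  have sc0 : 0 <= Num.sqrt CC / c by rewrite divr_ge0// ltW.
  have -> : CC = c ^+ 2 * (CC / c ^+ 2) by rewrite mulrC divfK// gt_eqF.
  rewrite [leRHS]EFinM lee_pmul2l ?lte_fin//.
  apply: (@sqre_le _ _ (Num.sqrt CC / c)); [exact: Lnorm_ge0| |]; last first.
    by rewrite expr_div_n sqr_sqrtr.
  apply: (bochner_oo_le tp sc0) => n s nN sn; apply/andP; split; first exact: L2normv_ge0.
  have -> : grad Om (u s) = grad Om (span U (peval (X n) s)).
    by apply: grad_eq => x Ox; exact: uX.
  apply: (L2normv_le mOm sc0); first exact: (L2funv_grad_span oOm bOm U_Vh).
  rewrite expr_div_n sqr_sqrtr// ler_pdivlMr// mulrC -(form_stiff oOm bOm U_Vh).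
  have [x [x01 ->]] := slab_param t_lt nN sn.
  by have [_] := bnd n x nN x01; rewrite peval_rescale.
pose X' := rescale N t X.
pose e1 := form M (vel tau X' N.-1 1) (vel tau X' N.-1 1).
pose e2 := form A (peval (X' N.-1) 1) (peval (X' N.-1) 1).
pose j1 n := form M (vjump tau X' n) (vjump tau X' n).
pose j2 n := form A (ujump X' n) (ujump X' n).
have spanM v z : (forall x, Om x -> v x = span U z x) ->
    (L2norm Om v ^+ 2 = (form M z z)%:E)%E.
  move=> vz; rewrite (eq_L2norm vz) (L2norm_ip mOm (L2fun_span oOm bOm U_Vh z)).
  by rewrite -(form_mass oOm bOm U_Vh).
have J1 : Jsq Om N t (dt u) = (e1 + \sum_(1 <= n < N) j1 n + j1 0%N)%:E.
  rewrite /Jsq !EFinD; congr (_ + _ + _)%E.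
  - by apply: spanM => x Ox; exact: (ltrace_dgN N0 t_lt uX).
  - rewrite -sumEFin !big_nat; apply: eq_bigr => n nN.
    by apply: spanM => x Ox; exact: (jump_dg t_lt uX).
  - by apply: spanM => x Ox; exact: (rtrace_dg0 N0 t0 t_lt uX).
have J2 : ((c ^+ 2)%:E * gJsq Om N t u = (e2 + \sum_(1 <= n < N) j2 n + j2 0%N)%:E)%E.
  have NE : N = N.-1.+1 by rewrite prednK.
  have nN1 : (N.-1 < N)%N by rewrite [in ltnRHS]NE.
  have gN : grad Om (ltrace u (t N)) = grad Om (span U (peval (X' N.-1) 1)).
    by rewrite -(grad_ltrace t_lt uX nN1) -NE.
  have g0 : grad Om (rtrace u 0) = grad Om (span U (ujump X' 0%N)).
    by rewrite (ujump0 N t X) (grad_rtrace0 N0 t0 t_lt uX).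
  have gJ n : (1 <= n < N)%N -> (L2normv Om (gjump Om u (t n)) ^+ 2 =
      L2normv Om (grad Om (span U (ujump X' n))) ^+ 2)%E.
    move=> nN; have J2f : L2funv Om (gjump Om u (t n)).
      case: n nN => // n /andP[_ nN].
      rewrite /gjump (grad_rtrace t_lt uX nN) (grad_ltrace t_lt uX (ltnW nN)).
      rewrite (_ : (fun x => _) = fun x =>
        (-1) *: grad Om (span U (peval (rescale N t X n) 1)) x +
        grad Om (span U (peval (rescale N t X n.+1) 0)) x); last first.
        by apply/funext => x; rewrite scaleN1r addrC.
      by apply: (L2funv_lin mOm); exact: (L2funv_grad_span oOm bOm U_Vh).
    have s2 := L2funv_grad_span oOm bOm U_Vh (ujump X' n).
    rewrite (L2normv_ipv mOm J2f) (L2normv_ipv mOm s2); congr EFin.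
    (* The jump of the gradients is replaced in one argument of the inner product, then by symmetry
       in the other. *)
    apply: etrans (gjump_dg oOm bOm U_Vh t_lt uX nN J2f) _.
    apply: etrans (ipvC _ _ _) _.
    exact: (gjump_dg oOm bOm U_Vh t_lt uX nN s2).
  rewrite /gJsq gN g0.
  have sumE : (\sum_(1 <= n < N) L2normv Om (gjump Om u (t n)) ^+ 2 =
      (\sum_(1 <= n < N) (c ^+ 2)^-1 * j2 n)%:E)%E.
    rewrite -sumEFin !big_nat; apply: eq_bigr => n nN; rewrite (gJ n nN).
    rewrite (L2normv_ipv mOm (L2funv_grad_span oOm bOm U_Vh _)) /j2.
    by rewrite (form_stiff oOm bOm U_Vh) mulKf// gt_eqF.
  rewrite sumE !(L2normv_ipv mOm (L2funv_grad_span oOm bOm U_Vh _)).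
  rewrite -!EFinD -EFinM; congr EFin.
  have -> : e2 = c ^+ 2 * ipv Om (grad Om (span U (peval (X' N.-1) 1)))
    (grad Om (span U (peval (X' N.-1) 1))) by exact: (form_stiff oOm bOm U_Vh).
  have -> : j2 0%N = c ^+ 2 * ipv Om (grad Om (span U (ujump X' 0%N)))
    (grad Om (span U (ujump X' 0%N))) by exact: (form_stiff oOm bOm U_Vh).
  rewrite -mulr_sumr.
  move: (\sum_(1 <= n < N) _) (ipv _ _ _) (ipv _ _ _) => x y z.
  by field; rewrite gt_eqF.
have total : e1 + \sum_(1 <= n < N) j1 n + j1 0%N +
    (e2 + \sum_(1 <= n < N) j2 n + j2 0%N) <= CC.
  have nN1 : (N.-1 < N)%N by rewrite ltn_predL.
  (* At the last slab the energy is the pair of final traces, and the sum contains every jump, the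
     initial one included. *)
  apply: le_trans (bndJ N.-1 nN1); rewrite prednK// /energy -/X' -/e1 -/e2.
  rewrite -(big_mkord xpredT (jumps M A tau X')) big_ltn//.
  have -> : \sum_(1 <= n < N) jumps M A tau X' n =
    \sum_(1 <= n < N) j1 n + \sum_(1 <= n < N) j2 n by rewrite -big_split.
  rewrite [jumps _ _ _ _ 0]/jumps -/(j1 0%N) -/(j2 0%N).
  clear J1 J2; move: e1 e2 (\sum_(1 <= n < N) j1 n) (\sum_(1 <= n < N) j2 n) (j1 0%N) (j2 0%N) => *.
  by lra.
rewrite J1 J2 FfE (L2norm_ip mOm v02) (L2normv_ipv mOm G2) -Fv2 -Dg2.
apply: (@le_trans _ _ (CC + CC + CC)%:E).
  have -> : (CC + CC + CC)%:E = (CC%:E + CC%:E + CC%:E)%E by rewrite !EFinD.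
  by rewrite -[leLHS]addeA; apply: leeD; [exact: leeD|rewrite -EFinD lee_fin].
rewrite -EFin_expe.
rewrite [leRHS](_ : _ = (6 * C * (Ff ^+ 2 + Fv ^+ 2 + c ^+ 2 * Dg ^+ 2))%:E)//.
rewrite lee_fin /CC.
have := sqr_ge0 (Ff - Fv).
move: Ff Fv Dg C C0 {stab CC CC0 sC0 B1 B2 total bound bnd bndJ Ff0 Fv0 Dg0 FfE Fv2 Dg2} => a b' y z z0 h.
have := mulr_ge0 (ltW z0) h; have := mulr_ge0 (ltW z0) (sqr_ge0 (c * y)).
by lra.
Qed.
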